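(* For each agent $i$ there exists an optimal mechanism $x_i$ for agent $i$ which is a monotone threshold mechanism with partition $\mathcal S_i$ such that, for some countable subcollection $\mathcal T_i\subset\mathcal S_i$ of intervals: (1) for every interval $S\in\mathcal S_i\setminus\mathcal T_i$ and every $s_i\in S$, $x_i(s_i,s_{-i})=\mathbb I\{\mathrm{LR}(s_i,s_{-i})\ge1\}$ for all $s_{-i}$; (2) whenever $S,T\in\mathcal T_i$ are adjacent intervals, on one of the two intervals the mechanism has the form $x_i(s_i,s_{-i})=\kappa\,\mathbb I\{\mathrm{LR}(s_{-i})\ge\tau\}$ with $\kappa\in\{0,1\}$ (i.e., it is deterministic there).
   Context: Setup. A state $\omega\in\{-1,+1\}$ is drawn with $\mathbb P[\omega=+1]=\mathbb P[\omega=-1]=1/2$. There are $n\ge 2$ agents. Conditional on $\omega$, signals $s_1,\dots,s_n$ are i.i.d. with distribution $\mathbb F_\omega$ on $[0,1]$, normalized so that $s_i=\mathbb P[\omega=+1\mid s_i]$. $\mathbb F_{-1},\mathbb F_{+1}$ are mutually absolutely continuous with densities; $\mathbb F=(\mathbb F_{-1}+\mathbb F_{+1})/2$ has density $f$ supported on a non-singleton interval with endpoints $\underline s<\overline s$ in $[0,1]$, $f$ differentiable on its support with continuous derivative and $|f'/f|$ bounded. $\mathrm{LR}(E)=\mathbb P[E\mid\omega=+1]/\mathbb P[E\mid\omega=-1]$; $\mathrm{LR}(s_{-i})=\prod_{k\ne i}\frac{s_k}{1-s_k}$, $\mathrm{LR}(s_i,s_{-i})=\prod_k\frac{s_k}{1-s_k}$.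 A mechanism is a measurable $x:[\underline s,\overline s]^n\to[0,1]^n$ ($x_i(s)$ = probability agent $i$ gets a good worth $\omega$ to her, else payoff $0$). Feasibility for agent $i$: for all $s_i,\hat s_i$ in the support, (P) $\mathbb E[\omega x_i(s_i,s_{-i})\mid s_i]\ge0$ and (IC) $\mathbb E[\omega x_i(s_i,s_{-i})\mid s_i]\ge\mathbb E[\omega x_i(\hat s_i,s_{-i})\mid s_i]$. An optimal mechanism for agent $i$ maximizes $\mathbb E[x_i(s)]$ subject to (P) and (IC) for agent $i$. Monotone threshold mechanism: there is a partition $\mathcal S_i$ of $[\underline s,\overline s]$ into disjoint intervals such that on each $S\in\mathcal S_i$, $x_i(s_i,s_{-i})=\kappa\,\mathbb I\{\mathrm{LR}(s_{-i})\ge\tau\}$ for some $\kappa\in[0,1]$, $\tau\ge0$ (depending on $S$; for singleton intervals $S=\{s_i\}$ this includes $\tau=\mathrm{LR}(s_i)^{-1}$). *)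

(* Defs.v *)
From HB Require Import structures.
From mathcomp Require Import all_boot all_order all_algebra.
From mathcomp Require Import all_classical all_reals all_analysis.
Set Implicit Arguments. Unset Strict Implicit. Unset Printing Implicit Defensive.
Import Order.TTheory GRing.Theory Num.Theory.
Import numFieldNormedType.Exports.
Local Open Scope classical_set_scope.
Local Open Scope ring_scope.

Section Model.
Variables (R : realType) (n : nat).

(* signal profiles s = (s_1,...,s_n) are n-tuples; n.-tuple R carries the
   product sigma-algebra generated by the coordinate projections *)
Definition prof := n.-tuple R.

Definition Icc (a b : R) : set R := [set` `[a, b]].

Definition tupd (s : prof) (k : 'I_n) (v : R) : prof :=
  [tuple (if j == k then v else tnth s j) | j < n].

Definition prof0 : prof := [tuple (0 : R) | _ < n].

Fixpoint iint (a b : R) (ks : seq 'I_n) (g : prof -> \bar R) (s : prof) : \bar R :=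
  match ks with
  | [::] => g s
  | k :: ks' =>
      (\int[@lebesgue_measure R]_(v in `[a, b]) iint a b ks' g (tupd s k v))%E
  end.

Definition others (i : 'I_n) : seq 'I_n := [seq k <- enum 'I_n | k != i].

(* densities of F_{+1} and F_{-1}: since s = P[w=+1 | s] and f = (f_+ + f_-)/2,
   f_+(t) = 2 t f(t), f_-(t) = 2 (1-t) f(t) *)
Definition dplus (f : R -> R) (t : R) : R := 2 * t * f t.
Definition dminus (f : R -> R) (t : R) : R := 2 * (1 - t) * f t.

(* E[ x(th, s_{-i}) | s_i = t, w = +1 ] and the same for w = -1 *)
Definition condE_plus a b f (i : 'I_n) (x : prof -> R) (th : R) : \bar R :=
  iint a b (others i)
    (fun s => (x s * \prod_(k < n | k != i) dplus f (tnth s k))%:E) (tupd prof0 i th).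
Definition condE_minus a b f (i : 'I_n) (x : prof -> R) (th : R) : \bar R :=
  iint a b (others i)
    (fun s => (x s * \prod_(k < n | k != i) dminus f (tnth s k))%:E) (tupd prof0 i th).

(* E[ w * x_i(th, s_{-i}) | s_i = t ] *)
Definition interim a b f i x (t th : R) : \bar R :=
  (t%:E * condE_plus a b f i x th - (1 - t)%:E * condE_minus a b f i x th)%E.

(* E[ x_i(s) ] (ex ante, averaging over w with prob. 1/2 each) *)
Definition exante a b f (x : prof -> R) : \bar R :=
  ((2^-1)%:E * iint a b (enum 'I_n)
      (fun s => (x s * \prod_(k < n) dplus f (tnth s k))%:E) prof0
 + (2^-1)%:E * iint a b (enum 'I_n)
      (fun s => (x s * \prod_(k < n) dminus f (tnth s k))%:E) prof0)%E.

Definition insupp a b (s : prof) := forall k, Icc a b (tnth s k).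

Definition feasible a b f i (x : prof -> R) :=
  [/\ measurable_fun setT x,
      (forall s, 0 <= x s <= 1),
      (forall t, Icc a b t -> (0 <= interim a b f i x t t)%E) &
      (forall t th, Icc a b t -> Icc a b th ->
          (interim a b f i x t th <= interim a b f i x t t)%E)].

Definition optimal a b f i x :=
  feasible a b f i x /\
  forall y, feasible a b f i y -> (exante a b f y <= exante a b f x)%E.

(* LR(s_{-i}) >= tau, with LR(s_{-i}) = prod_{k<>i} s_k/(1-s_k), cross-multiplied *)
Definition lr_others_ge (i : 'I_n) (s : prof) (tau : R) : bool :=
  tau * \prod_(k < n | k != i) (1 - tnth s k) <= \prod_(k < n | k != i) tnth s k.
(* LR(s_i, s_{-i}) >= 1, cross-multiplied *)
Definition lr_all_ge1 (s : prof) : bool :=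
  \prod_(k < n) (1 - tnth s k) <= \prod_(k < n) tnth s k.

Definition interval_partition a b (P : set (set R)) :=
  [/\ (forall S, P S -> [/\ S !=set0, is_interval S & S `<=` Icc a b]),
      (forall S T, P S -> P T -> S `&` T !=set0 -> S = T) &
      (forall t, Icc a b t -> exists2 S, P S & S t)].

(* on S, x_i(s_i,s_{-i}) = kappa * 1{LR(s_{-i}) >= tau}; for a singleton S = {t}
   tau may be LR(t)^{-1}, i.e. the indicator is 1{LR(s_i,s_{-i}) >= 1} *)
Definition threshold_on a b (K : set R) i (x : prof -> R) (S : set R) :=
  exists2 kappa, K kappa &
    ((exists2 tau, 0 <= tau &
       forall s, insupp a b s -> S (tnth s i) -> x s = kappa * (lr_others_ge i s tau)%:R)
  \/ ((exists t, S = [set t]) /\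
       forall s, insupp a b s -> S (tnth s i) -> x s = kappa * (lr_all_ge1 s)%:R)).

Definition monotone_threshold a b i x (P : set (set R)) :=
  interval_partition a b P /\
  forall S, P S -> threshold_on a b (Icc 0 1) i x S.

Definition deterministic_on a b i x S := threshold_on a b [set 0; 1] i x S.

Definition adjacent_cells (S T : set R) := S <> T /\ is_interval (S `|` T).

End Model.

(* Main.v *)
(* A type t facing the option (p, q), accepted with probability p when omega = +1
   and q when omega = -1, gets t p - (1 - t) q.  Hence a mechanism for agent i is
   its menu of lines, and its indirect utility u is a convex function lying between
   max(0, 2 t - 1) (offering "never" and "always" costs nothing) and the
   full-information value V, the integral of max(0, t dF_+ - (1 - t) dF_-) over the
   signals of the others; conversely every such u is implementable.  The acceptance
   probability of type t is 2 t (1 - t) u'(t) + (2 t - 1) u(t), so the objective is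
   linear in u.  It is upper semicontinuous on the compact convex set of admissible
   u, and a maximizer of a strictly convex functional among its maximizers is an
   extreme point.  An extreme u has at most three slopes on a component of {u < V};
   the extreme slopes there belong to lines touching V, and since V is
   differentiable such lines are deterministic thresholds. *)
Require Import Defs.
From HB Require Import structures.
From mathcomp Require Import all_boot all_order all_algebra.
From mathcomp Require Import all_classical all_reals all_analysis.
From mathcomp Require Import measurable_realfun.
From mathcomp Require Import ring lra.
Import Order.TTheory GRing.Theory Num.Theory.
Import numFieldNormedType.Exports.
Local Open Scope classical_set_scope.
Local Open Scope ring_scope.

(** * Iterated integrals *)

(** Utilities live on the whole real line: V equals 0 below 0 and 2 r - 1 above 1, so every
    admissible u is pinned outside [0, 1]. Its slopes then lie in [0, 2], and this one Lipschitz
    bound yields compactness for the sup norm. Slopes are right derivatives: the acceptance of a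
    type in [0, 1] increases with the slope, the right derivative is the largest subgradient, and
    being an infimum of difference quotients it makes the objective upper semicontinuous.
    Extremality is contradicted by reweighting the curvature on three consecutive intervals: fixing
    total slope and intercept is two linear conditions, so three unknowns leave a nonzero solution.
    Of two adjacent slopes among at most three, one is the smallest or the largest, whence the
    deterministic interval. The same bound keeps slopes from accumulating from the right, so each
    maximal interval of constant slope contains a rational or the point b; this gives countability,
    and measurability of thresholds obtained by choice. Differentiability of V rests on the level
    sets of LR being null, which holds since there is another agent. *)

Section iterated_integrals.
Context (R : realType) (n : nat) (a b : R).
Local Notation mu := (@lebesgue_measure R).
Local Notation prof := (n.-tuple R).
Implicit Types (ks : seq 'I_n) (g : prof -> \bar R) (s : prof).

Lemma tnth_tupd s (k j : 'I_n) (v : R) :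
  tnth (tupd s k v) j = if j == k then v else tnth s j.
Proof. by rewrite tnth_mktuple. Qed.

Lemma tupdC s (j k : 'I_n) (v w : R) : j != k ->
  tupd (tupd s j v) k w = tupd (tupd s k w) j v.
Proof.
move=> jk; apply: eq_from_tnth => l; rewrite !tnth_tupd.
by have [->|//] := eqVneq l k; rewrite eq_sym (negbTE jk).
Qed.

Lemma measurable_tupd (k : 'I_n) :
  measurable_fun setT (fun p : prof * R => tupd p.1 k p.2).
Proof.
apply/measurable_fun_tnthP => j /=.
rewrite (_ : _ \o _ = fun p : prof * R => if j == k then p.2 else tnth p.1 j).
  case: (j == k); first exact: measurable_snd.
  exact: (measurableT_comp (measurable_tnth j) measurable_fst).
by apply/funext => p /=; rewrite tnth_tupd.
Qed.

Lemma measurable_tupd1 s (k : 'I_n) : measurable_fun setT (tupd s k).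
Proof.
rewrite (_ : tupd s k = (fun p : prof * R => tupd p.1 k p.2) \o (fun v => (s, v))) //.
exact: (measurableT_comp (measurable_tupd k) (measurable_pair1 _)).
Qed.

Lemma iint_ge0 ks g s : (forall s, (0 <= g s)%E) -> (0 <= iint a b ks g s)%E.
Proof.
by move=> g0; elim: ks s => [|k ks IH] s //=; apply: integral_ge0 => v _.
Qed.

Lemma measurable_iint ks g : (forall s, (0 <= g s)%E) ->
  measurable_fun setT g -> measurable_fun setT (iint a b ks g).
Proof.
move=> g0 mg; elim: ks => [|k ks IH] //=.
(* Extending the integrand by 0 off [a, b] turns the integral into a section integral over the whole
   line, to which Tonelli's measurability applies. *)
pose F := (fun p : prof * R => iint a b ks g (tupd p.1 k p.2)) \_ (setT `*` `[a, b]).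
rewrite (_ : (fun _ => _) = fubini_F mu F).
  apply: measurable_fun_fubini_tonelli_F; last first.
    by move=> p; rewrite /F /patch; case: ifP => // _; exact: iint_ge0.
  have mD : measurable ([set: n.-tuple R] `*` `[a, b]).
    by apply: measurableX => //; exact: measurable_itv.
  apply/(measurable_restrictT _ mD).
  by apply: measurable_funTS; exact: (measurableT_comp IH (measurable_tupd k)).
apply/funext => s; rewrite /fubini_F [LHS]integral_mkcond.
apply: eq_integral => v _.
rewrite /F /patch /=; congr (if _ then _ else _).
by apply/idP/idP; rewrite !inE /=; [move=> vab; split|case].
Qed.

Lemma measurable_iint_tupd ks g s k : (forall s, (0 <= g s)%E) ->
  measurable_fun setT g ->
  measurable_fun setT (fun v => iint a b ks g (tupd s k v)).
Proof.
move=> g0 mg.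
exact: (measurableT_comp (measurable_iint ks _ g0 mg) (measurable_tupd1 s k)).
Qed.

(** The integral started at [s] only visits profiles that agree with [s] off [ks] and have their
    other coordinates in [a, b]. Through this the fixed report of agent i and the support enter
    pointwise arguments. *)
Lemma le_iint_local ks g1 g2 s : (forall s, (0 <= g1 s)%E) ->
  (forall s, (0 <= g2 s)%E) ->
  measurable_fun setT g1 -> measurable_fun setT g2 ->
  (forall s', (forall j, j \notin ks -> tnth s' j = tnth s j) ->
     (forall j, j \in ks -> Icc a b (tnth s' j)) -> (g1 s' <= g2 s')%E) ->
  (iint a b ks g1 s <= iint a b ks g2 s)%E.
Proof.
move=> g10 g20 mg1 mg2; elim: ks s => [|k ks IH] s H /=; first exact: H.
apply: ge0_le_integral => //.
- by move=> v _; exact: iint_ge0.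
- by apply: measurable_funTS; exact: measurable_iint_tupd.
- by apply: measurable_funTS; exact: measurable_iint_tupd.
move=> v vab; apply: IH => s' s's s'ab; apply: H => j.
  rewrite inE negb_or => /andP[jk jks].
  by rewrite s's// tnth_tupd (negbTE jk).
rewrite inE => jk; have [jks|jks] := boolP (j \in ks); first exact: s'ab.
by move: jk; rewrite (negbTE jks) orbF => jk; rewrite s's// tnth_tupd jk.
Qed.

Lemma le_iint ks g1 g2 s : (forall s, (0 <= g1 s)%E) ->
  (forall s, (0 <= g2 s)%E) ->
  measurable_fun setT g1 -> measurable_fun setT g2 ->
  (forall s', (g1 s' <= g2 s')%E) ->
  (iint a b ks g1 s <= iint a b ks g2 s)%E.
Proof. by move=> *; apply: le_iint_local. Qed.

Lemma eq_iint_local ks g1 g2 s : (forall s, (0 <= g1 s)%E) ->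
  (forall s, (0 <= g2 s)%E) ->
  measurable_fun setT g1 -> measurable_fun setT g2 ->
  (forall s', (forall j, j \notin ks -> tnth s' j = tnth s j) ->
     (forall j, j \in ks -> Icc a b (tnth s' j)) -> g1 s' = g2 s') ->
  iint a b ks g1 s = iint a b ks g2 s.
Proof.
move=> g10 g20 mg1 mg2 H; apply/eqP; rewrite eq_le.
by rewrite !le_iint_local// => s' h1 h2; rewrite H.
Qed.

Lemma iintD ks g1 g2 s : (forall s, (0 <= g1 s)%E) ->
  (forall s, (0 <= g2 s)%E) ->
  measurable_fun setT g1 -> measurable_fun setT g2 ->
  iint a b ks (fun s => g1 s + g2 s)%E s =
  (iint a b ks g1 s + iint a b ks g2 s)%E.
Proof.
move=> g10 g20 mg1 mg2; elim: ks s => [|k ks IH] s //=.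
rewrite -ge0_integralD//.
- by apply: eq_integral => v _; rewrite IH.
- by move=> v _; exact: iint_ge0.
- by apply: measurable_funTS; exact: measurable_iint_tupd.
- by move=> v _; exact: iint_ge0.
- by apply: measurable_funTS; exact: measurable_iint_tupd.
Qed.

Lemma iintZ ks g s (c : R) : 0 <= c -> (forall s, (0 <= g s)%E) ->
  measurable_fun setT g ->
  iint a b ks (fun s => c%:E * g s)%E s = (c%:E * iint a b ks g s)%E.
Proof.
move=> c0 g0 mg; elim: ks s => [|k ks IH] s //=.
rewrite -ge0_integralZl_EFin//.
- by apply: eq_integral => v _; rewrite IH.
- by move=> v _; exact: iint_ge0.
- by apply: measurable_funTS; exact: measurable_iint_tupd.
Qed.

Lemma cvg_iint ks (g : nat -> prof -> \bar R) g' s :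
  (forall k s, (0 <= g k s)%E) -> (forall k, measurable_fun setT (g k)) ->
  (forall s, {homo g ^~ s : k l / (k <= l)%N >-> (k <= l)%E}) ->
  (forall s, g k s @[k --> \oo] --> g' s) ->
  iint a b ks (g k) s @[k --> \oo] --> iint a b ks g' s.
Proof.
move=> g0 mg ndg gg'.
elim: ks s => [|k ks IH] s /=; first exact: gg'.
have -> : (\int[mu]_(v in `[a, b]) iint a b ks g' (tupd s k v) =
    \int[mu]_(v in `[a, b]) limn (fun l => iint a b ks (g l) (tupd s k v)))%E.
  by apply: eq_integral => v _; apply/esym/cvg_lim => //; exact: IH.
apply: (@cvg_monotone_convergence _ _ _ mu _ _
  (fun l v => iint a b ks (g l) (tupd s k v))) => //.
- by move=> l; apply: measurable_funTS; exact: measurable_iint_tupd.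
- by move=> l v _; exact: iint_ge0.
- move=> v _ l m lm; apply: le_iint => // s'; exact: ndg.
Qed.

Lemma iint_swap ks g s j k : j != k -> (forall s, (0 <= g s)%E) ->
  measurable_fun setT g ->
  iint a b (j :: k :: ks) g s = iint a b (k :: j :: ks) g s.
Proof.
move=> jk g0 mg /=.
pose F := (fun p : R * R => iint a b ks g (tupd (tupd s j p.1) k p.2)) \_
  (`[a, b] `*` `[a, b]).
have F0 p : (0 <= F p)%E.
  by rewrite /F /patch; case: ifP => // _; exact: iint_ge0.
have mF : measurable_fun setT F.
  have mD : measurable (`[a, b] `*` `[a, b] : set (R * R)).
    by apply: measurableX => //; exact: measurable_itv.
  apply/(measurable_restrictT _ mD).
  apply: measurable_funTS.
  apply: (measurableT_comp (measurable_iint ks _ g0 mg)).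
  rewrite (_ : (fun _ => _) = (fun q : prof * R => tupd q.1 k q.2) \o
    (fun p : R * R => (tupd s j p.1, p.2))) //.
  apply: (measurableT_comp (measurable_tupd k)).
  apply: measurable_fun_pair; last exact: measurable_snd.
  exact: (measurableT_comp (measurable_tupd1 s j) measurable_fst).
transitivity (\int[mu]_v \int[mu]_w F (v, w))%E.
  rewrite [LHS]integral_mkcond; apply: eq_integral => v _; rewrite /patch.
  case: ifPn => [vab|vab].
    rewrite [LHS]integral_mkcond; apply: eq_integral => w _; rewrite /F /patch.
    congr (if _ then _ else _); apply/idP/idP; rewrite !inE/= => H.
      by split => //; move: vab; rewrite inE.
    by case: H.
  apply/esym/integral0_eq => w _; rewrite /F /patch ifF//.
  apply/negbTE; apply: contra vab; rewrite !inE/=; by case.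
transitivity (\int[mu]_w \int[mu]_v F (v, w))%E; first exact: (@fubini_tonelli _ _ _ _ _ mu mu F mF F0).
apply/esym.
rewrite [LHS]integral_mkcond; apply: eq_integral => w _; rewrite /patch.
case: ifPn => [wab|wab].
  rewrite [LHS]integral_mkcond; apply: eq_integral => v _; rewrite /F /patch tupdC 1?eq_sym//.
  congr (if _ then _ else _); apply/idP/idP; rewrite !inE/= => H.
    by split => //; move: wab; rewrite inE.
  by case: H.
apply/esym/integral0_eq => v _; rewrite /F /patch ifF//.
apply/negbTE; apply: contra wab; rewrite !inE/=; by case.
Qed.

Lemma iint_move l1 i l2 g s : i \notin l1 -> (forall s, (0 <= g s)%E) ->
  measurable_fun setT g ->
  iint a b (l1 ++ i :: l2) g s = iint a b (i :: l1 ++ l2) g s.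
Proof.
move=> il1 g0 mg; elim: l1 il1 s => [//|k l1 IH] il1 s.
move: il1; rewrite inE negb_or => /andP[ik il1].
rewrite iint_swap//; rewrite -[LHS]/(\int[mu]_(v in `[a, b])
  iint a b (l1 ++ i :: l2) g (tupd s k v))%E.
by apply: eq_integral => v _; rewrite IH.
Qed.

Lemma iint_prod_density ks (d : R -> R) (s : prof) :
  uniq ks -> (forall t, 0 <= d t) -> measurable_fun setT d ->
  (\int[mu]_(t in `[a, b]) (d t)%:E = 1)%E ->
  iint a b ks (fun s => (\prod_(k <- ks) d (tnth s k))%:E) s = 1%E.
Proof.
move=> + d0 md d1.
have p0 l (s' : prof) : 0 <= \prod_(k <- l) d (tnth s' k) by apply: prodr_ge0.
have mp l : measurable_fun setT (fun s' : prof => \prod_(k <- l) d (tnth s' k)).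
  apply: measurable_prod => k _.
  exact: (measurableT_comp md (measurable_tnth k)).
elim: ks s => [|k ks IH] s /=; first by rewrite big_nil.
move=> /andP[kks uks]; rewrite -[RHS]d1; apply: eq_integral => v _.
transitivity (iint a b ks (fun s' => (d v)%:E * (\prod_(j <- ks) d (tnth s' j))%:E)%E
   (tupd s k v)).
  apply: eq_iint_local.
  - by move=> s'; rewrite lee_fin.
  - by move=> s'; rewrite -EFinM lee_fin mulr_ge0.
  - by apply/measurable_EFinP; exact: mp.
  - by apply: emeasurable_funM => //; apply/measurable_EFinP; exact: mp.
  - by move=> s' s's _; rewrite big_cons s's// tnth_tupd eqxx EFinM.
rewrite iintZ//.
- by rewrite IH// mule1.
- by move=> s'; rewrite lee_fin.
- by apply/measurable_EFinP; exact: mp.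
Qed.

(* The innermost integrand vanishes off the single point v = A / (A + B); the
   outer variables keep the two coefficients from vanishing simultaneously,
   except at v = 0 and v = 1. *)
Lemma iint_eq0_hyperplane ks g s (A B : R) : 0 <= a -> b <= 1 ->
  ks != [::] -> uniq ks -> 0 <= A -> 0 <= B -> 0 < A + B ->
  (forall s, (0 <= g s)%E) -> measurable_fun setT g ->
  (forall s', (forall j, j \notin ks -> tnth s' j = tnth s j) ->
    A * \prod_(k <- ks) (1 - tnth s' k) <> B * \prod_(k <- ks) tnth s' k ->
    g s' = 0%E) ->
  iint a b ks g s = 0%E.
Proof.
move=> a0 b1 + + + + + g0 mg.
elim: ks s A B => [//|k ks IH] s A B _ /= /andP[kks uks] A0 B0 AB H.
have cst_tupd (v : R) (s' : prof) :
    (forall j, j \notin ks -> tnth s' j = tnth (tupd s k v) j) ->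
    (forall j, j \notin k :: ks -> tnth s' j = tnth s j) /\ tnth s' k = v.
  move=> s's; split=> [j|]; last by rewrite s's// tnth_tupd eqxx.
  by rewrite inE negb_or => /andP[jk jks]; rewrite s's// tnth_tupd (negbTE jk).
case: (eqVneq ks [::]) => [ks0|ksN].
  rewrite -(@integral_setD1 _ _ (A / (A + B))); last 2 first.
  - exact: measurableD.
  - by apply: measurable_funTS; exact: measurable_iint_tupd.
  apply: integral0_eq => v /= [_ vr]; rewrite ks0 /= H//.
    by move=> j; rewrite ks0 inE tnth_tupd => /negbTE ->.
  rewrite ks0 !big_cons !big_nil !mulr1 tnth_tupd eqxx => e; apply: vr.
  have AB0 : A + B != 0 by rewrite gt_eqF.
  by apply: (mulIf AB0); rewrite divfK//; lra.
(* On the open interval 0 < v < 1, so the new coefficients A (1 - v) and B v again have a positive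
   sum. *)
rewrite -integral_itv_bndo_bndc; last first.
  by apply: measurable_funTS; exact: measurable_iint_tupd.
rewrite -integral_itv_obnd_cbnd; last first.
  by apply: measurable_funTS; exact: measurable_iint_tupd.
apply: integral0_eq => v; rewrite /= in_itv/= => /andP[av vb].
apply: (IH _ (A * (1 - v)) (B * v)) => //.
- by rewrite mulr_ge0//; lra.
- by rewrite mulr_ge0//; lra.
- have [A1|A1] := ltrP 0 A.
    by apply: ltr_pwDl; [rewrite mulr_gt0//; lra|rewrite mulr_ge0//; lra].
  by apply: ltr_wpDl; [rewrite mulr_ge0//; lra|rewrite mulr_gt0//; lra].
- move=> s' /cst_tupd[s's s'k] ne; apply: H => //.
  by rewrite !big_cons s'k !mulrA.
Qed.

End iterated_integrals.

(** * Convex functions between two bounds *)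

Section convex_functions.
Context (R : realType).
Implicit Types (u v w V : R -> R) (s t m c : R).

(** The chord inequality with denominators cleared, so that degenerate triples need no separate
    treatment. *)
Definition convex3 u := forall x y z, x <= y -> y <= z ->
  (z - x) * u y <= (z - y) * u x + (y - x) * u z.

Definition subgradient u t m := forall s, u t + m * (s - t) <= u s.

Definition slope u t s := (u s - u t) / (s - t).

(** The slopes of a convex u to the right of t shrink with the interval, so their infimum is the
    right derivative and no limit has to be shown to exist. *)
Definition rderiv u t := inf [set slope u t s | s in [set s | t < s]].

Lemma subgradient_convex3 u : (forall t, exists m, subgradient u t m) -> convex3 u.
Proof.
move=> H x y z xy yz; have [m Hm] := H y.
have := ler_wpM2l (_ : 0 <= z - y) (Hm x); have := ler_wpM2l (_ : 0 <= y - x) (Hm z).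
by move=> /(_ ltac:(lra)) h1 /(_ ltac:(lra)) h2; nra.
Qed.

Lemma convex3D u v : convex3 u -> convex3 v -> convex3 (fun t => u t + v t).
Proof.
by move=> cu cv x y z xy yz; have := cu _ _ _ xy yz; have := cv _ _ _ xy yz; nra.
Qed.

Lemma convex3Z u c : 0 <= c -> convex3 u -> convex3 (fun t => c * u t).
Proof.
move=> c0 cu x y z xy yz; have := ler_wpM2l c0 (cu _ _ _ xy yz); nra.
Qed.

Section fixed_convex_function.
Variable u : R -> R.
Hypothesis cu : convex3 u.

Let rderiv_has_inf t : has_inf [set slope u t s | s in [set s | t < s]].
Proof.
split; first by exists (slope u t (t + 1)), (t + 1) => //=; lra.
(* The slope over [t - 1, t] is below every slope to the right of t. *)
exists (u t - u (t - 1)) => _ [s /= ts <-].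
rewrite /slope ler_pdivlMr; last lra.
have := cu (t - 1) t s ltac:(lra) ltac:(lra); nra.
Qed.

Lemma rderiv_le_slope t s : t < s -> rderiv u t <= slope u t s.
Proof. by move=> ts; apply: ge_inf; [exact: (rderiv_has_inf t).2|exists s]. Qed.

Lemma subgradient_le_rderiv t m : subgradient u t m -> m <= rderiv u t.
Proof.
move=> H; apply: lb_le_inf; first exact: (rderiv_has_inf t).1.
move=> _ [s /= ts <-]; rewrite /slope ler_pdivlMr; last lra.
have := H s; lra.
Qed.

Lemma rderiv_subgradient t : subgradient u t (rderiv u t).
Proof.
move=> s; have [st|ts|->] := ltgtP s t; last by rewrite subrr mulr0 addr0.
  suff H : (u t - u s) / (t - s) <= rderiv u t.
    move: H; rewrite ler_pdivrMr; [nra|lra].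
  apply: lb_le_inf; first exact: (rderiv_has_inf t).1.
  move=> _ [x /= tx <-]; rewrite /slope ler_pdivrMr; last lra.
  rewrite mulrAC ler_pdivlMr; last lra.
  have := cu s t x ltac:(lra) ltac:(lra); nra.
have := rderiv_le_slope _ _ ts; rewrite /slope ler_pdivlMr; [nra|lra].
Qed.

Lemma rderiv_homo t s : t <= s -> rderiv u t <= rderiv u s.
Proof.
rewrite le_eqVlt => /predU1P[->//|ts].
have := rderiv_subgradient t s; have := rderiv_subgradient s t => h1 h2.
have : 0 < s - t by lra.
by move=> st; rewrite -subr_ge0 -(pmulr_lge0 _ st); nra.
Qed.

(** Some slope comes within e of the infimum, and slopes over shorter intervals are no larger. *)
Lemma rderiv_approx t e : 0 < e -> exists2 s, t < s &
  forall s', t < s' -> s' <= s -> u s' - u t <= (rderiv u t + e) * (s' - t).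
Proof.
move=> e0; have [_ [s /= ts <-] H] := inf_adherent e0 (rderiv_has_inf t).
exists s => // s' ts' s's.
have := cu t s' s (ltW ts') s's.
move: H; rewrite -/(rderiv u t) /slope ltr_pdivrMr; last lra.
set g := rderiv u t => H1 H2.
have st : 0 < s - t by lra.
rewrite -(ler_pM2l st).
have := ler_wpM2l (_ : 0 <= s' - t) (ltW H1) => /(_ ltac:(lra)).
nra.
Qed.

Lemma rderiv_right_continuous t e : 0 < e ->
  exists2 s, t < s & rderiv u s < rderiv u t + e.
Proof.
(* At the midpoint y of [t, s] the slope is at most that over [y, s]; halving the interval doubles
   the error e / 3, which stays below e. *)
move=> e0; have [s ts H] := rderiv_approx t (e / 3) ltac:(lra).
exists ((t + s) / 2); first lra.
set y := (t + s) / 2.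
have ys : y < s by rewrite /y; lra.
have ty : t < y by rewrite /y; lra.
have h1 := rderiv_subgradient y s; have h2 := rderiv_subgradient t y.
have h3 := H s ts (lexx _).
have e1 : s - y = y - t by rewrite /y; lra.
have e2 : s - t = 2 * (y - t) by rewrite /y; lra.
rewrite e1 in h1; rewrite e2 in h3.
have yt : 0 < y - t by lra.
rewrite -(ltr_pM2r yt); nra.
Qed.

End fixed_convex_function.

(** Near-optimal slopes of v and w over one common short interval average to a slope of u, which
    dominates its right derivative. *)
Lemma rderiv_average u v w t : convex3 u -> convex3 v -> convex3 w ->
  (forall t, u t = (v t + w t) / 2) ->
  rderiv u t <= (rderiv v t + rderiv w t) / 2.
Proof.
move=> cu cv cw uvw; apply/ler_addgt0Pr => e e0.
have [s1 ts1 H1] := rderiv_approx _ cv t e e0.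
have [s2 ts2 H2] := rderiv_approx _ cw t e e0.
pose s := Num.min s1 s2.
have ts : t < s by rewrite lt_min ts1.
have := rderiv_subgradient _ cu t s.
have := H1 s ts _; rewrite ge_min lexx => /(_ isT) h1.
have := H2 s ts _; rewrite ge_min lexx orbT => /(_ isT) h2.
rewrite !uvw => h3; have st : 0 < s - t by lra.
rewrite -(ler_pM2r st); nra.
Qed.

(** Follows u up to c, then its right tangent: the convex function whose curvature is that of u on
    ]-oo, c], a kink at c included. The difference of two cuts isolates the curvature of u between
    two points. *)
Definition tangent_cut u c t :=
  if t <= c then u t else u c + rderiv u c * (t - c).

Section tangent_cuts.
Variable u : R -> R.
Hypothesis cu : convex3 u.
Local Notation g := (rderiv u).
Local Notation cut := (tangent_cut u).

Lemma tangent_cut_left c t : t <= c -> cut c t = u t.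
Proof. by rewrite /tangent_cut => ->. Qed.

Lemma tangent_cut_right c t : c <= t -> cut c t = u c + g c * (t - c).
Proof.
rewrite /tangent_cut le_eqVlt => /predU1P[->|ct]; last by rewrite leNgt ct.
by rewrite lexx subrr mulr0 addr0.
Qed.

Lemma tangent_cut_le c t : cut c t <= u t.
Proof. rewrite /tangent_cut; case: ifP => // _; exact: rderiv_subgradient. Qed.

Lemma tangent_cut_convex3 c : convex3 (cut c).
Proof.
apply: subgradient_convex3 => t; rewrite /subgradient /tangent_cut.
have [tc|ct] := leP t c.
  exists (g t) => s; have [sc|cs] := leP s c; first exact: rderiv_subgradient.
  have h1 := rderiv_subgradient _ cu t c; have h2 := rderiv_homo _ cu _ _ tc.
  have : 0 <= (g c - g t) * (s - c) by rewrite mulr_ge0//; lra.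
  nra.
exists (g c) => s; have [sc|cs] := leP s c; last lra.
have h1 := rderiv_subgradient _ cu c s; lra.
Qed.

(** With c <= c' a subgradient at t is 0 up to c, g t - g c between the two points and g c' - g c
    beyond. *)
Lemma tangent_cutB_convex3 c c' : c <= c' -> convex3 (fun t => cut c' t - cut c t).
Proof.
move=> cc'; apply: subgradient_convex3 => t; rewrite /subgradient /tangent_cut.
have hcc' := rderiv_homo _ cu _ _ cc'.
have h0 := rderiv_subgradient _ cu c c'.
have h0' := rderiv_subgradient _ cu c' c.
have [tc|ct] := leP t c.
  rewrite (le_trans tc cc'); exists 0 => s.
  have [sc|cs] := leP s c; first by rewrite (le_trans sc cc'); lra.
  have [sc'|c's] := leP s c'.
    by have := rderiv_subgradient _ cu c s; lra.
  have : 0 <= (g c' - g c) * (s - c') by rewrite mulr_ge0//; lra.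
  nra.
have [tc'|c't] := leP t c'.
  exists (g t - g c) => s.
  have h1 := rderiv_homo _ cu _ _ (ltW ct).
  have h2 := rderiv_homo _ cu _ _ tc'.
  have h3 := rderiv_subgradient _ cu t c.
  have h4 := rderiv_subgradient _ cu t c'.
  have [sc|cs] := leP s c.
    rewrite (le_trans sc cc').
    have : 0 <= (g t - g c) * (c - s) by rewrite mulr_ge0//; lra.
    nra.
  have [sc'|c's] := leP s c'.
    by have := rderiv_subgradient _ cu t s; nra.
  have : 0 <= (g c' - g t) * (s - c') by rewrite mulr_ge0//; lra.
  nra.
exists (g c' - g c) => s.
have [sc|cs] := leP s c.
  rewrite (le_trans sc cc').
  have : 0 <= (g c' - g c) * (c - s) by rewrite mulr_ge0//; lra.
  nra.
have [sc'|c's] := leP s c'; last nra.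
by have := rderiv_subgradient _ cu c' s; nra.
Qed.

Lemma sub_tangent_cut_convex3 c : convex3 (fun t => u t - cut c t).
Proof.
apply: subgradient_convex3 => t; rewrite /subgradient /tangent_cut.
have [tc|ct] := leP t c.
  exists 0 => s; have [sc|cs] := leP s c; first lra.
  have := rderiv_subgradient _ cu c s; lra.
exists (g t - g c) => s.
have h3 := rderiv_subgradient _ cu t c.
have h1 := rderiv_homo _ cu _ _ (ltW ct).
have [sc|cs] := leP s c; last by have := rderiv_subgradient _ cu t s; nra.
have : 0 <= (g t - g c) * (c - s) by rewrite mulr_ge0//; lra.
nra.
Qed.

(* A perturbation whose second derivative is D1, D2, D3 times that of u on the
   three intervals between t1, t2, t3 and t4. *)
Definition bump (t1 t2 t3 t4 D1 D2 D3 t : R) :=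
  D1 * (cut t2 t - cut t1 t) + D2 * (cut t3 t - cut t2 t) + D3 * (cut t4 t - cut t3 t).

Section bumps.
Variables t1 t2 t3 t4 : R.
Hypothesis t12 : t1 < t2.
Hypothesis t23 : t2 < t3.
Hypothesis t34 : t3 < t4.
Let le12 : t1 <= t2 := ltW t12.
Let le23 : t2 <= t3 := ltW t23.
Let le34 : t3 <= t4 := ltW t34.
Let le13 : t1 <= t3 := le_trans le12 le23.
Let le24 : t2 <= t4 := le_trans le23 le34.
Local Notation h := (bump t1 t2 t3 t4).

Lemma bumpZ k D1 D2 D3 t : h (k * D1) (k * D2) (k * D3) t = k * h D1 D2 D3 t.
Proof. rewrite /bump; ring. Qed.

Lemma bump_left D1 D2 D3 t : t <= t1 -> h D1 D2 D3 t = 0.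
Proof.
move=> tt1; have tt2 := le_trans tt1 le12; have tt3 := le_trans tt1 le13.
by rewrite /bump !tangent_cut_left ?(le_trans tt3 le34)//; ring.
Qed.

(** Beyond t4 the bump is affine; its slope and intercept give the two linear conditions on D1, D2,
    D3 under which it vanishes there. *)
Lemma bump_right D1 D2 D3 t : t4 <= t ->
  h D1 D2 D3 t =
    (D1 * (g t2 - g t1) + D2 * (g t3 - g t2) + D3 * (g t4 - g t3)) * t +
    (D1 * ((u t2 - g t2 * t2) - (u t1 - g t1 * t1)) +
     D2 * ((u t3 - g t3 * t3) - (u t2 - g t2 * t2)) +
     D3 * ((u t4 - g t4 * t4) - (u t3 - g t3 * t3))).
Proof.
move=> t4t; have t3t := le_trans le34 t4t; have t2t := le_trans le23 t3t.
by rewrite /bump !tangent_cut_right ?(le_trans le12 t2t)//; ring.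
Qed.

(** u is its cut at t1, plus three differences of cuts, plus a convex remainder beyond t4; the bump
    merely changes the weights of the three differences from 1 to 1 + Dj. *)
Lemma bump_convex3 D1 D2 D3 : 0 <= 1 + D1 -> 0 <= 1 + D2 -> 0 <= 1 + D3 ->
  convex3 (fun t => u t + h D1 D2 D3 t).
Proof.
move=> p1 p2 p3.
have -> : (fun t => u t + h D1 D2 D3 t) = (fun t =>
    cut t1 t + ((1 + D1) * (cut t2 t - cut t1 t) + ((1 + D2) * (cut t3 t - cut t2 t) +
    ((1 + D3) * (cut t4 t - cut t3 t) + (u t - cut t4 t))))).
  by apply/funext => t; rewrite /bump; ring.
apply: convex3D; first exact: tangent_cut_convex3.
apply: convex3D; first by apply: convex3Z => //; exact: tangent_cutB_convex3.
apply: convex3D; first by apply: convex3Z => //; exact: tangent_cutB_convex3.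
apply: convex3D; first by apply: convex3Z => //; exact: tangent_cutB_convex3.
exact: sub_tangent_cut_convex3.
Qed.

(* u is differentiable from the right at t with slope g t, so a multiple of the
   excess of u over its tangent at t cannot equal a nonzero linear function. *)
Lemma excess_not_linear t T A C : t < T -> 0 < A ->
  (forall s, t < s -> s <= T -> A * (s - t) + C * (u s - (u t + g t * (s - t))) = 0) ->
  False.
Proof.
move=> tT A0 H; have C1 : 0 < 1 + `|C| by rewrite ltr_pwDl.
have [|s ts Hs] := rderiv_approx _ cu t (A / (2 * (1 + `|C|))).
  by rewrite divr_gt0 ?mulr_gt0.
pose s' := Num.min s T.
have ts' : t < s' by rewrite lt_min ts.
have := H s' ts' _; rewrite ge_min lexx orbT => /(_ isT).
have := Hs s' ts' _; rewrite ge_min lexx => /(_ isT).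
have := rderiv_subgradient _ cu t s'.
move: s' ts' => x tx q0 q1; set q := u x - (u t + g t * (x - t)) => e.
have {}q0 : 0 <= q by rewrite subr_ge0.
have {}q1 : (1 + `|C|) * q <= A / 2 * (x - t).
  have -> : A / 2 * (x - t) = (1 + `|C|) * (A / (2 * (1 + `|C|)) * (x - t)).
    by field; rewrite gt_eqF.
  by rewrite ler_pM2l// /q; lra.
have : - (C * q) <= `|C| * q by rewrite -mulNr ler_wpM2r// -normrN ler_norm.
have : 0 < A * (x - t) by rewrite mulr_gt0// subr_gt0.
lra.
Qed.

(** Just to the right of t2 a vanishing bump is D1 (g t2 - g t1) times the distance plus a term of
    smaller order, so D1 = 0. The same expansion to the right of t3 then contradicts D2 > 0. *)
Lemma bump_neq0 D1 D2 D3 : g t1 < g t2 -> g t2 < g t3 -> 0 < D2 ->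
  (forall t, h D1 D2 D3 t = 0) -> False.
Proof.
move=> g12 g23 D20 h0.
have e2 : D1 * (u t2 - (u t1 + g t1 * (t2 - t1))) = 0.
  rewrite -(h0 t2) /bump (tangent_cut_right t1)// (tangent_cut_left t2)//.
  by rewrite (tangent_cut_left t3)// (tangent_cut_left t4)//; ring.
have h23 s : t2 < s -> s <= t3 ->
    D1 * (g t2 - g t1) * (s - t2) + D2 * (u s - (u t2 + g t2 * (s - t2))) = 0.
  move=> /ltW t2s st3; transitivity (h D1 D2 D3 s - D1 * (u t2 - (u t1 + g t1 * (t2 - t1)))).
    rewrite /bump (tangent_cut_right t1) ?(le_trans le12 t2s)// (tangent_cut_right t2)//.
    by rewrite (tangent_cut_left t3)// (tangent_cut_left t4) ?(le_trans st3 le34)//; ring.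
  by rewrite h0 e2 subrr.
have D10 : D1 = 0.
  apply/eqP/negPn/negP => D1N; have [D1p|D1n] := ltP 0 D1.
    by apply: (excess_not_linear t2 t3 _ D2 t23 _ h23); rewrite mulr_gt0// subr_gt0.
  have {}D1n : D1 < 0 by rewrite lt_neqAle D1N.
  apply: (excess_not_linear t2 t3 (- (D1 * (g t2 - g t1))) (- D2) t23).
    by rewrite oppr_gt0 nmulr_rlt0// subr_gt0.
  by move=> s t2s st3; rewrite -[RHS]oppr0 -(h23 s t2s st3); ring.
have e3 : D2 * (u t3 - (u t2 + g t2 * (t3 - t2))) = 0.
  by have := h23 t3 t23 (lexx _); rewrite D10 !mul0r add0r.
apply: (excess_not_linear t3 t4 (D2 * (g t3 - g t2)) D3 t34).
  by rewrite mulr_gt0// subr_gt0.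
move=> s /ltW t3s st4.
transitivity (h D1 D2 D3 s - D2 * (u t3 - (u t2 + g t2 * (t3 - t2)))).
  rewrite /bump D10 (tangent_cut_right t2) ?(le_trans le23 t3s)//.
  by rewrite (tangent_cut_right t3)// (tangent_cut_left t4)//; ring.
by rewrite h0 e3 subrr.
Qed.

End bumps.
End tangent_cuts.

(** * Convex functions between max(0, 2 t - 1) and V *)

Definition between V u :=
  [/\ convex3 u, (forall t, 0 <= u t), (forall t, 2 * t - 1 <= u t) &
      (forall t, u t <= V t)].

Section between_functions.
Variable V : R -> R.
Hypothesis V0 : forall t, t <= 0 -> V t = 0.
Hypothesis V1 : forall t, 1 <= t -> V t = 2 * t - 1.

Lemma between_le0 u t : between V u -> t <= 0 -> u t = 0.
Proof.
by move=> [_ u0 _ uV] t0; apply/eqP; rewrite eq_le u0 -(V0 _ t0) uV.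
Qed.

Lemma between_ge1 u t : between V u -> 1 <= t -> u t = 2 * t - 1.
Proof.
by move=> [_ _ u1 uV] t1; apply/eqP; rewrite eq_le u1 -(V1 _ t1) uV.
Qed.

Lemma between_lt01 u t : between V u -> u t < V t -> 0 < t < 1.
Proof.
move=> Ku uV; apply/andP; split; rewrite ltNge; apply/negP => h.
  by move: uV; rewrite V0// (between_le0 _ _ Ku h) ltxx.
by move: uV; rewrite V1// (between_ge1 _ _ Ku h) ltxx.
Qed.

(** u vanishes left of 0 and has slope 2 right of 1, so a slope outside [0, 2] would break the
    support inequality at a point far enough on one side. *)
Lemma between_rderiv u t : between V u -> 0 <= rderiv u t <= 2.
Proof.
move=> Ku; have [cu u0 u1 uV] := Ku.
apply/andP; split; rewrite leNgt; apply/negP => h.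
  pose s := - 1 - `|t|.
  have s0 : s <= 0 by rewrite /s; have := normr_ge0 t; lra.
  have st : s < t by rewrite /s; have := ler_norm (- t); rewrite normrN; lra.
  have := rderiv_subgradient _ cu t s; rewrite (between_le0 _ _ Ku s0).
  have := u0 t; nra.
pose s := 1 + `|t|.
have s0 : 1 <= s by rewrite /s; have := normr_ge0 t; lra.
have st : t < s by rewrite /s; have := ler_norm t; lra.
have := rderiv_subgradient _ cu t s; rewrite (between_ge1 _ _ Ku s0).
have := u1 t; nra.
Qed.

Lemma between_lipschitz u s t : between V u -> s <= t ->
  u s <= u t <= u s + 2 * (t - s).
Proof.
move=> Ku st; have [cu _ _ _] := Ku.
have := rderiv_subgradient _ cu s t; have := rderiv_subgradient _ cu t s.
have /andP[a1 a2] := between_rderiv _ s Ku.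
have /andP[b1 b2] := between_rderiv _ t Ku.
by move=> h1 h2; apply/andP; split; nra.
Qed.

Lemma between_dist u s t : between V u -> `|u s - u t| <= 2 * `|s - t|.
Proof.
move=> Ku; wlog st : s t / s <= t.
  move=> H; have [|/ltW] := leP s t; first exact: H.
  by rewrite distrC [`|s - t|]distrC; exact: H.
have /andP[h1 h2] := between_lipschitz _ _ _ Ku st.
by rewrite distrC [`|s - t|]distrC !ger0_norm; lra.
Qed.

Lemma between_continuous u : between V u -> continuous u.
Proof.
move=> Ku t; apply/cvgrPdist_le => e e0.
exists (e / 2); first by rewrite /= divr_gt0.
move=> s /= ts; rewrite (le_trans (between_dist _ _ _ Ku))//; lra.
Qed.

(** The lower bounds follow from convexity: v lies above the extensions of its chords over [-1, 0]
    and over [1, 2]. *)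
Lemma between_of_eq_outside u v : convex3 v ->
  (forall t, t <= 0 -> v t = 0) -> (forall t, 1 <= t -> v t = 2 * t - 1) ->
  (forall t, v t <= V t) -> between V v.
Proof.
move=> cv v0 v1 vV; split => // t.
  have [/v0 ->//|t0] := leP t 0.
  have := cv (-1) 0 t ltac:(lra) ltac:(lra).
  by rewrite (v0 (-1) ltac:(lra)) (v0 0 (lexx _)); lra.
have [/v1 ->//|t1] := leP 1 t.
have := cv t 1 2 ltac:(lra) ltac:(lra).
by rewrite (v1 1 (lexx _)) (v1 2 ltac:(lra)); lra.
Qed.

Definition extreme_between u := between V u /\
  forall v w, between V v -> between V w ->
    (forall t, u t = (v t + w t) / 2) -> forall t, v t = w t.

Hypothesis cV : convex3 V.
Hypothesis V_ge0 : forall t, 0 <= V t.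
Hypothesis V_ge1 : forall t, 2 * t - 1 <= V t.

Lemma between_refl : between V V. Proof. by split. Qed.

Lemma tangent_cutB_bound u c c' t T : between V u -> c <= c' -> t <= T -> c <= T ->
  0 <= tangent_cut u c' t - tangent_cut u c t <= 2 * (T - c).
Proof.
move=> Ku cc' tT cT; have [cu _ _ _] := Ku.
have [tc|ct] := leP t c.
  by rewrite !tangent_cut_left ?(le_trans tc cc')// subrr lexx mulr_ge0// subr_ge0.
rewrite (tangent_cut_right _ c) ?(ltW ct)//; apply/andP; split.
  have [tc'|/ltW c't] := leP t c'.
    by rewrite tangent_cut_left// subr_ge0; exact: rderiv_subgradient.
  rewrite tangent_cut_right//.
  have := rderiv_subgradient _ cu c c'; have := rderiv_homo _ cu _ _ cc'.
  nra.
have := tangent_cut_le _ cu c' t; have /andP[_] := between_lipschitz _ _ _ Ku (ltW ct).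
have /andP[g0 _] := between_rderiv _ c Ku.
have : 0 <= rderiv u c * (t - c) by rewrite mulr_ge0// subr_ge0 ltW.
lra.
Qed.

Lemma bump_bound u t1 t2 t3 t4 D1 D2 D3 t : between V u ->
  t1 < t2 -> t2 < t3 -> t3 < t4 -> t <= t4 ->
  `|bump u t1 t2 t3 t4 D1 D2 D3 t| <= (`|D1| + `|D2| + `|D3|) * (2 * (t4 - t1)).
Proof.
move=> Ku t12 t23 t34 tt4.
have le1 (D x c : R) : t1 <= c -> 0 <= x <= 2 * (t4 - c) ->
    `|D * x| <= `|D| * (2 * (t4 - t1)).
  by move=> t1c /andP[x0 xN]; rewrite normrM ler_wpM2l// ger0_norm//; lra.
have := le1 D1 _ t1 (lexx _)
  (tangent_cutB_bound u t1 t2 t t4 Ku ltac:(lra) tt4 ltac:(lra)).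
have := le1 D2 _ t2 (ltW t12)
  (tangent_cutB_bound u t2 t3 t t4 Ku ltac:(lra) tt4 ltac:(lra)).
have := le1 D3 _ t3 (ltW (lt_trans t12 t23))
  (tangent_cutB_bound u t3 t4 t t4 Ku ltac:(lra) tt4 ltac:(lra)).
rewrite /bump !mulrDl.
set x1 := D1 * _; set x2 := D2 * _; set x3 := D3 * _ => h3 h2 h1.
apply: le_trans (ler_normD _ _) _; apply: lerD => //.
by apply: le_trans (ler_normD _ _) _; apply: lerD.
Qed.

(* With four slopes on a stretch where u < V, the second derivative of u can be
   reweighted by 1 + e D_j between t_j and t_(j+1); the D_j are chosen so that mass
   and barycentre do not change, hence the perturbation vanishes outside [t1, t4]. *)
Lemma extreme_four_slopes u t1 t2 t3 t4 : extreme_between u ->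
  t1 < t2 -> t2 < t3 -> t3 < t4 ->
  (forall t, t1 <= t <= t4 -> u t < V t) ->
  rderiv u t1 < rderiv u t2 -> rderiv u t2 < rderiv u t3 ->
  rderiv u t3 < rderiv u t4 -> False.
Proof.
move=> [Ku ext] t12 t23 t34 uV g12 g23 g34.
have [cu u0 u1 uleV] := Ku.
have t14 : t1 < t4 := lt_trans t12 (lt_trans t23 t34).
have [D1 [D2 [D3 [D20 h_ge]]]] : exists D1 D2 D3, 0 < D2 /\
    forall t, t4 <= t -> bump u t1 t2 t3 t4 D1 D2 D3 t = 0.
  pose c t := u t - rderiv u t * t.
  pose A1 := rderiv u t2 - rderiv u t1; pose A2 := rderiv u t3 - rderiv u t2.
  pose A3 := rderiv u t4 - rderiv u t3.
  pose B1 := c t2 - c t1; pose B2 := c t3 - c t2; pose B3 := c t4 - c t3.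
  (* The cross product of the vectors A and B: being orthogonal to both, it makes slope and
     intercept vanish beyond t4. *)
  exists (A2 * B3 - A3 * B2), (A3 * B1 - A1 * B3), (A1 * B2 - A2 * B1); split.
    have A10 : 0 < A1 by rewrite subr_gt0.
    have A30 : 0 < A3 by rewrite subr_gt0.
    (* The tangents at t1 and t2 cross no later than t2, those at t3 and t4 no earlier than t3; as
       t2 < t3, this makes the middle weight positive. *)
    have L2 : 0 <= A1 * t2 + B1.
      by have := rderiv_subgradient _ cu t1 t2; rewrite /A1 /B1 /c; lra.
    have L3 : A3 * t3 + B3 <= 0.
      by have := rderiv_subgradient _ cu t4 t3; rewrite /A3 /B3 /c; lra.
    move: A1 A3 B1 B3 A10 A30 L2 L3 => x1 x3 y1 y3 x10 x30 L2 L3.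
    have : 0 <= x3 * (x1 * t2 + y1) by rewrite mulr_ge0// ltW.
    have : 0 <= x1 * - (x3 * t3 + y3) by rewrite mulr_ge0// ?oppr_ge0// ltW.
    have : 0 < x1 * x3 * (t3 - t2) by rewrite !mulr_gt0// subr_gt0.
    clear; lra.
  by move=> t t4t; rewrite bump_right//; rewrite /A1 /A2 /A3 /B1 /B2 /B3 /c; ring.
pose h := bump u t1 t2 t3 t4 D1 D2 D3.
pose D := `|D1| + `|D2| + `|D3|; pose N := 2 * (t4 - t1).
have h_bound t : t <= t4 -> `|h t| <= D * N by exact: bump_bound.
have [D1D D2D D3D] : [/\ `|D1| <= D, `|D2| <= D & `|D3| <= D].
  have := normr_ge0 D1; have := normr_ge0 D2; have := normr_ge0 D3.
  by rewrite /D; clear; split; lra.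
have D0 : 0 <= D by rewrite /D !addr_ge0.
have N0 : 0 <= N by rewrite mulr_ge0// subr_ge0 ltW.
have DN : 0 <= D * N by rewrite mulr_ge0.
have [d d0 dP] : exists2 d, 0 < d & forall t, t1 <= t <= t4 -> d <= V t - u t.
  have [|tm] := @EVT_min R (fun t => V t - u t) t1 t4 (ltW t14).
    apply: continuous_subspaceT => t.
    by apply: cvgB; apply: between_continuous => //; exact: between_refl.
  rewrite in_itv/= => tmI tmP; exists (V tm - u tm).
    by rewrite subr_gt0; exact: uV.
  by move=> t tI; apply: tmP; rewrite in_itv.
(* The bound on e D keeps the weights 1 + e Dj and 1 - e Dj nonnegative, hence convexity; the bound
   on e D N keeps both perturbations below V. *)
have [e [e0 eD eN]] : exists e, [/\ 0 < e, e * D <= 1 & e * (D * N) <= d].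
  move: (D * N) DN => M M0.
  have M1 : 0 < 1 + M by rewrite ltr_pwDl.
  have D1' : 0 < 1 + D by rewrite ltr_pwDl.
  exists (Num.min ((1 + D)^-1) (d / (1 + M))); split.
  - by rewrite lt_min invr_gt0 divr_gt0// andbT.
  - apply: (@le_trans _ _ ((1 + D)^-1 * D)); first by rewrite ler_wpM2r// ge_min lexx.
    by rewrite mulrC ler_pdivrMr// mul1r lerDr ler01.
  - apply: (@le_trans _ _ (d / (1 + M) * M)).
      by rewrite ler_wpM2r// ge_min lexx orbT.
    by rewrite mulrAC ler_pdivrMr// mulrDr mulr1 lerDr ltW.
have coef (z Dj : R) : `|z| = 1 -> `|Dj| <= D -> 0 <= 1 + z * e * Dj.
  move=> z1 DjD; have : `|z * e * Dj| <= 1.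
    rewrite !normrM z1 mul1r (ger0_norm (ltW e0)); apply: le_trans eD.
    by rewrite ler_wpM2l// ltW.
  by rewrite ler_norml => /andP[+ _]; rewrite -subr_ge0 opprK addrC.
have Kz (z : R) : `|z| = 1 -> between V (fun t => u t + z * e * h t).
  move=> z1; have /andP[t10 _] := between_lt01 _ t1 Ku (uV t1 ltac:(by rewrite lexx ltW)).
  have /andP[_ t41] := between_lt01 _ t4 Ku (uV t4 ltac:(by rewrite lexx ltW)).
  apply: (between_of_eq_outside u).
  - rewrite (_ : (fun t => _) = fun t => u t +
        bump u t1 t2 t3 t4 (z * e * D1) (z * e * D2) (z * e * D3) t).
      by apply: bump_convex3 => //; exact: coef.
    by apply/funext => t; rewrite bumpZ.
  - move=> t t0; rewrite /h bump_left// ?mulr0 ?addr0; first exact: between_le0.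
    exact: le_trans t0 (ltW t10).
  - move=> t t0; rewrite /h h_ge ?mulr0 ?addr0; first exact: between_ge1.
    exact: le_trans (ltW t41) t0.
  - move=> t; have [tt1|t1t] := leP t t1.
      by rewrite /h bump_left// mulr0 addr0.
    have [tt4|/ltW t4t] := leP t t4; last by rewrite /h h_ge// mulr0 addr0.
    have := dP t; rewrite (ltW t1t) tt4 => /(_ isT); rewrite lerBrDl; apply: le_trans.
    rewrite lerD2l; apply: le_trans (ler_norm _) _.
    rewrite !normrM z1 mul1r (ger0_norm (ltW e0)); apply: le_trans eN.
    by rewrite ler_wpM2l ?h_bound// ltW.
apply: (bump_neq0 u cu t1 t2 t3 t4 t12 t23 t34 D1 D2 D3 g12 g23 D20) => t.
have avg (x y : R) : x = ((x + 1 * e * y) + (x + -1 * e * y)) / 2 by field.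
have := ext _ _ (Kz 1 (normr1 _)) (Kz (-1) (normrN1 _)) (fun t => avg (u t) (h t)) t.
rewrite -/(h t) mul1r mulN1r mulNr => /addrI /eqP.
by rewrite -subr_eq0 opprK -mulr2n mulrn_eq0 /= mulf_eq0 gt_eqF//= => /eqP.
Qed.

End between_functions.
End convex_functions.

(** * Compactness and extreme maximizers *)

Section uniform_compactness.
Context (R : realType).
Implicit Types (A : set (R -> R)) (J : (R -> R) -> R).

(* Compactness for uniform convergence, phrased with filters on the bare type
   R -> R, which carries no topology. *)
Definition uniformly_compact A := forall F : set_system (R -> R),
  ProperFilter F -> F A -> exists2 p, A p &
    forall B e, F B -> 0 < e ->
      exists f, [/\ B f, A f & forall t, `|f t - p t| <= e].

Definition usc_on A J := forall u, A u -> forall e, 0 < e ->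
  exists2 d, 0 < d &
    forall v, A v -> (forall t, `|v t - u t| <= d) -> J v < J u + e.

Lemma usc_on_sub A A' J : A' `<=` A -> usc_on A J -> usc_on A' J.
Proof.
move=> AA' H u /AA' Au e e0; have [d d0 P] := H u Au e e0.
by exists d => // v /AA'; exact: P.
Qed.

(** The sets where J exceeds s - e generate a filter, and at its cluster point upper semicontinuity
    forces J up to the supremum s. *)
Lemma uniformly_compact_max A J (C : R) : uniformly_compact A -> A !=set0 ->
  (forall u, A u -> J u <= C) -> usc_on A J ->
  exists2 u, A u & forall v, A v -> J v <= J u.
Proof.
move=> cA [u0 Au0] JC Jusc.
have hs : has_sup (J @` A).
  by split; [exists (J u0), u0|exists C => _ [u Au <-]; exact: JC].
set s := sup (J @` A).
pose F := filter_from [set e : R | 0 < e] (fun e => [set u | A u /\ s - e < J u]).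
have FF : ProperFilter F.
  apply: filter_from_proper.
    apply: filter_from_filter; first by exists 1 => /=; lra.
    move=> e1 e2 /= e10 e20; exists (Num.min e1 e2) => /=; first by rewrite lt_min e10.
    move=> u [Au su]; split; split => //; apply: le_lt_trans su; rewrite lerD2l lerN2;
      by rewrite ge_min lexx ?orbT.
  move=> e /= e0; have [_ [u Au <-] H] := sup_adherent e0 hs.
  by exists u; split.
have FA : F A by exists 1 => /=; [lra|move=> u []].
have [p Ap Hp] := cA F FF FA.
exists p => // v Av; apply: (@le_trans _ _ s).
  by apply: ub_le_sup; [exact: hs.2|exists v].
rewrite leNgt; apply/negP => ps.
have [d d0 P] := Jusc p Ap ((s - J p) / 2) ltac:(lra).
have FB : F [set u | A u /\ s - (s - J p) / 2 < J u] by exists ((s - J p) / 2) => //=; lra.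
have [f [[_ sf] Af /P]] := Hp _ _ FB d0.
by move=> /(_ Af); lra.
Qed.

(** Prepares a second maximization, carried out over the maximizers of the first. *)
Lemma uniformly_compact_superlevel A J (c : R) : uniformly_compact A ->
  usc_on A J -> uniformly_compact [set u | A u /\ c <= J u].
Proof.
move=> cA Jusc F FF FA'.
have FA : F A by apply: filterS FA' => u [].
have [p Ap Hp] := cA F FF FA; exists p.
  split => //; rewrite leNgt; apply/negP => pc.
  have [d d0 P] := Jusc p Ap (c - J p) ltac:(lra).
  have [f [[_ cf] Af /P]] := Hp _ _ FA' d0.
  by move=> /(_ Af); lra.
move=> B e FB e0; have [f [[Bf A'f] _ fp]] := Hp _ _ (filterI FB FA') e0.
by exists f.
Qed.

Section between_compact.
Variable V : R -> R.
Hypothesis V0 : forall t, t <= 0 -> V t = 0.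
Hypothesis V1 : forall t, 1 <= t -> V t = 2 * t - 1.
Hypothesis cV : convex3 R V.
Hypothesis V_ge0 : forall t, 0 <= V t.
Hypothesis V_ge1 : forall t, 2 * t - 1 <= V t.
Local Notation K := (between R V).

(** Members coincide outside [0, 1] and are 2-Lipschitz, so finitely many points control the sup
    norm. *)
Lemma between_grid (e : R) : 0 < e -> exists l : seq R, forall u v, K u -> K v ->
  (forall t, t \in l -> `|u t - v t| < e / 2) -> forall t, `|u t - v t| <= e.
Proof.
(* Moving to the nearest grid point on the left costs at most 2 / N for u and for v each; N > 8 / e
   makes the total 4 / N less than e / 2. *)
move=> e0; pose N := (Num.truncn (8 / e)).+1.
have N0 : 0 < N%:R :> R by rewrite ltr0n.
have Ne : 4 / N%:R < e / 2.
  have : 8 / e < N%:R by rewrite /N truncnS_gt.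
  rewrite ltr_pdivrMr// => h; rewrite ltr_pdivrMr//; lra.
exists [seq j%:R / N%:R | j <- iota 0 N.+1] => u v Ku Kv H t.
have [t0|t0] := leP t 0.
  by rewrite (between_le0 _ _ V0 u t Ku t0) (between_le0 _ _ V0 v t Kv t0) subrr normr0 ltW.
have [t1|t1] := leP 1 t.
  by rewrite (between_ge1 _ _ V1 u t Ku t1) (between_ge1 _ _ V1 v t Kv t1) subrr normr0 ltW.
pose j := Num.truncn (t * N%:R).
have tN0 : 0 <= t * N%:R by rewrite mulr_ge0// ltW.
have /andP[j1 j2] : j%:R <= t * N%:R < j.+1%:R by rewrite /j truncn_itv.
have jN : (j < N.+1)%N.
  rewrite -(@ltr_nat R); apply: le_lt_trans j1 _.
  by rewrite -[ltLHS]addr0 -natr1; apply: ltrD => //; rewrite gtr_pMl.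
pose r := j%:R / N%:R : R.
have tr : `|t - r| <= 1 / N%:R.
  rewrite ger0_norm ?subr_ge0 /r ?ler_pdivrMr// lerBlDr -mulrDl ler_pdivlMr//.
  by rewrite addrC natr1 ltW.
have /H Hr : r \in [seq j%:R / N%:R | j <- iota 0 N.+1].
  by apply/mapP; exists j => //; rewrite mem_iota.
have := between_dist _ _ V0 V1 u t r Ku; have := between_dist _ _ V0 V1 v r t Kv.
rewrite (distrC r t).
have -> : u t - v t = (u t - u r) + (u r - v r) + (v r - v t) by ring.
have := ler_normD ((u t - u r) + (u r - v r)) (v r - v t).
have := ler_normD (u t - u r) (u r - v r).
have : 2 * `|t - r| <= 2 * (1 / N%:R) by rewrite ler_pM2l.
have -> : 2 * (1 / N%:R) = (4 / N%:R) / 2 :> R by field; rewrite gt_eqF.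
lra.
Qed.

(** Each defining inequality involves at most three points, so finite pointwise approximation
    preserves it. *)
Lemma between_pointwise_limit (p : R -> R) :
  (forall (l : seq R) e, 0 < e ->
     exists2 u, K u & forall t, t \in l -> `|u t - p t| < e) -> K p.
Proof.
move=> H; split.
- move=> x y z xy yz; apply/ler_addgt0Pr => e e0.
  (* The three errors enter with weights z - x, z - y and y - x, which sum to 2 (z - x); the 1 keeps
     the divisor positive. *)
  have D0 : 0 < 2 * (z - x) + 1 by lra.
  have [u [cu _ _ _] Hu] := H [:: x; y; z] (e / (2 * (z - x) + 1)) ltac:(by rewrite divr_gt0).
  have := cu x y z xy yz.
  have := Hu x ltac:(by rewrite !inE eqxx).
  have := Hu y ltac:(by rewrite !inE eqxx orbT).
  have := Hu z ltac:(by rewrite !inE eqxx !orbT).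
  set d := e / _; have ed : e = d * (2 * (z - x) + 1) by rewrite /d divfK// gt_eqF.
  have d0 : 0 < d by rewrite divr_gt0.
  rewrite !ltr_norml => /andP[h1 h2] /andP[h3 h4] /andP[h5 h6] h7.
  have := ler_wpM2l (_ : 0 <= z - x) (ltW h3).
  have := ler_wpM2l (_ : 0 <= z - y) (ltW h6).
  have := ler_wpM2l (_ : 0 <= y - x) (ltW h2).
  move=> /(_ ltac:(lra)) k1 /(_ ltac:(lra)) k2 /(_ ltac:(lra)) k3.
  rewrite ed; nra.
- move=> t; apply/ler_addgt0Pr => e e0.
  have [u [_ u0 _ _] Hu] := H [:: t] e e0.
  have := Hu t ltac:(by rewrite inE eqxx); have := u0 t.
  rewrite ltr_norml; lra.
- move=> t; apply/ler_addgt0Pr => e e0.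
  have [u [_ _ u0 _] Hu] := H [:: t] e e0.
  have := Hu t ltac:(by rewrite inE eqxx); have := u0 t.
  rewrite ltr_norml; lra.
- move=> t; apply/ler_addgt0Pr => e e0.
  have [u [_ _ _ u0] Hu] := H [:: t] e e0.
  have := Hu t ltac:(by rewrite inE eqxx); have := u0 t.
  rewrite ltr_norml; lra.
Qed.

(** Tychonoff on the product of the segments [0, V t] gives a pointwise cluster point, and
    [between_grid] upgrades pointwise closeness to uniform closeness. *)
Lemma between_uniformly_compact : uniformly_compact K.
Proof.
move=> F FF FK.
have cbox : compact [set f : {ptws R -> R} | forall t, `[0, V t]%classic (f t)].
  exact: (@tychonoff R (fun=> R^o) (fun t => `[0, V t]%classic)
    (fun t => @segment_compact R 0 (V t))).
have [|p [_ pF]] := cbox F FF.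
  apply: filterS FK => u [_ u0 _ uV] t /=; rewrite in_itv/=.
  by rewrite u0 uV.
have [G [FG pG nbG]] : exists G : set_system (R -> R), [/\ Filter G,
    (forall A B, F A -> G B -> A `&` B !=set0) &
    forall t e, 0 < e -> G [set u | `|u t - p t| < e]].
  exists (nbhs (p : {ptws R -> R})); split.
  - by apply: (@filter_filter _ _ (nbhs_pfilter (p : {ptws R -> R^o}))).
    by move=> A B FA GB; exact: pF.
  move=> t e e0; have := @proj_continuous R (fun _ => R^o) t p.
  move=> /(_ [set y | `|y - p t| < e]); apply.
  by apply/nbhs_ballP; exists e => //= y; rewrite /ball/= distrC.
have nbp (l : seq R) e : 0 < e -> G [set u | forall t, t \in l -> `|u t - p t| < e].
  move=> e0; elim: l => [|t l IH]; last first.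
    apply: filterS (filterI (nbG t e e0) IH) => u [ut ul] t'.
    by rewrite inE => /predU1P[->//|]; exact: ul.
  rewrite (_ : [set u | _] = setT); first exact: filterT.
  by rewrite predeqE => u; split => // _ t; rewrite in_nil.
have HF (B : set (R -> R)) (l : seq R) e : F B -> 0 < e ->
    exists f, [/\ B f, K f & forall t, t \in l -> `|f t - p t| < e].
  move=> FB e0; have [f [[Bf density_factor] Hf]] := pG _ _ (filterI FB FK) (nbp l e e0).
  by exists f.
have Kp : K p.
  apply: between_pointwise_limit => l e e0.
  by have [f [_ density_factor Hf]] := HF _ l e FK e0; exists f.
exists p => // B e FB e0.
have [l Hl] := between_grid e e0.
have [f [Bf density_factor Hf]] := HF B l (e / 2) FB ltac:(lra).
by exists f; split => //; apply: Hl.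
Qed.

(* Among the maximizers of J, a maximizer of the strictly convex Q is extreme. *)
Lemma exists_extreme_max J (Q : (R -> R) -> R) (CJ CQ : R) :
  (forall u, K u -> J u <= CJ) -> usc_on K J ->
  (forall u, K u -> Q u <= CQ) -> usc_on K Q ->
  (forall u v w, K u -> K v -> K w -> (forall t, u t = (v t + w t) / 2) ->
     J u <= (J v + J w) / 2) ->
  (forall u v w, K u -> K v -> K w -> (forall t, u t = (v t + w t) / 2) ->
     (exists t, v t <> w t) -> Q u < (Q v + Q w) / 2) ->
  exists2 u, extreme_between R V u & forall v, K v -> J v <= J u.
Proof.
move=> JC Ju QC Qu Javg Qavg.
have cK := between_uniformly_compact.
have KV : K V by exact: between_refl.
have [u0 Ku0 u0max] := uniformly_compact_max K J CJ cK (ex_intro _ V KV) JC Ju.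
have cM := uniformly_compact_superlevel K J (J u0) cK Ju.
pose M := [set u | K u /\ J u0 <= J u].
have MK : M `<=` K by move=> u [].
have [||u [Ku Ju0] umax] := uniformly_compact_max M Q CQ cM _ _ (usc_on_sub _ _ _ MK Qu).
- by exists u0.
- by move=> u [/QC].
exists u; last by move=> v Kv; apply: le_trans (u0max _ Kv) _.
split=> // v w Kv Kw uvw t; apply: contrapT => vw.
have := Javg u v w Ku Kv Kw uvw.
have := u0max v Kv; have := u0max w Kw => h1 h2 h3.
have := Qavg u v w Ku Kv Kw uvw (ex_intro _ t vw).
have Mv : M v by split => //; lra.
have Mw : M w by split => //; lra.
have := umax v Mv; have := umax w Mw; lra.
Qed.

End between_compact.
End uniform_compactness.

(** * The objective functional *)

Section weighted_integral.
Context (R : realType).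
Local Notation mu := (@lebesgue_measure R).
Variables (a b : R) (f : R -> R).
Hypothesis f_ge0 : forall t, a <= t <= b -> 0 <= f t.
Hypothesis f_int : mu.-integrable `[a, b] (EFin \o f).
Implicit Types (phi psi : R -> R).

Definition wint phi := \int[mu]_(t in `[a, b]) (f t * phi t).
Local Notation F := (\int[mu]_(t in `[a, b]) f t).

Lemma wint_mass_ge0 : 0 <= F.
Proof. by apply: Rintegral_ge0 => t /=; rewrite in_itv/=; exact: f_ge0. Qed.

Lemma wint_integrable phi (C : R) : measurable_fun setT phi ->
  (forall t, a <= t <= b -> `|phi t| <= C) ->
  mu.-integrable `[a, b] (EFin \o (fun t => f t * phi t)).
Proof.
move=> mphi phiC.
apply: (@le_integrable _ _ _ mu _ _ _ (fun t => C%:E * (f t)%:E)%E) => //.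
- apply/measurable_EFinP/measurable_funM; last exact: measurable_funTS.
  by apply/measurable_EFinP; exact: (measurable_int _ f_int).
- move=> t /=; rewrite in_itv/= => tab; rewrite lee_fin !normrM mulrC.
  by rewrite ler_wpM2r// (le_trans (phiC t tab))// ler_norm.
- exact: integrableZl.
Qed.

Lemma le_wint phi psi (C : R) : measurable_fun setT phi -> measurable_fun setT psi ->
  (forall t, a <= t <= b -> `|phi t| <= C) ->
  (forall t, a <= t <= b -> `|psi t| <= C) ->
  (forall t, a <= t <= b -> phi t <= psi t) -> wint phi <= wint psi.
Proof.
move=> mphi mpsi phiC psiC H; apply: le_Rintegral => //.
- exact: wint_integrable phiC.
- exact: wint_integrable psiC.
- by move=> t /=; rewrite in_itv/= => tab; rewrite ler_wpM2l ?H ?f_ge0.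
Qed.

Lemma wintD phi psi (C : R) : measurable_fun setT phi -> measurable_fun setT psi ->
  (forall t, a <= t <= b -> `|phi t| <= C) ->
  (forall t, a <= t <= b -> `|psi t| <= C) ->
  wint (fun t => phi t + psi t) = wint phi + wint psi.
Proof.
move=> mphi mpsi phiC psiC; rewrite /wint -RintegralD//.
- by apply: eq_Rintegral => t _; rewrite mulrDr.
- exact: wint_integrable phiC.
- exact: wint_integrable psiC.
Qed.

Lemma wintZ phi (C k : R) : measurable_fun setT phi ->
  (forall t, a <= t <= b -> `|phi t| <= C) ->
  wint (fun t => k * phi t) = k * wint phi.
Proof.
move=> mphi phiC; rewrite /wint -RintegralZl//.
- by apply: eq_Rintegral => t _; ring.
- exact: wint_integrable phiC.
Qed.

Lemma wint_cst (c : R) : wint (cst c) = c * F.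
Proof. by rewrite mulrC -RintegralZr. Qed.

Lemma le_wint_add phi psi (C d : R) : measurable_fun setT phi ->
  measurable_fun setT psi ->
  (forall t, a <= t <= b -> `|phi t| <= C) ->
  (forall t, a <= t <= b -> `|psi t| <= C) ->
  (forall t, a <= t <= b -> phi t <= psi t + d) -> wint phi <= wint psi + d * F.
Proof.
move=> mphi mpsi phiC psiC H.
rewrite -wint_cst -(wintD _ _ (C + `|d|))//.
- apply: (@le_wint _ _ (C + `|d|)) => //.
  + exact: measurable_funD.
  + by move=> t /phiC h; have := normr_ge0 d; lra.
  + by move=> t /psiC h; rewrite (le_trans (ler_normD _ _))//= lerD2r.
- by move=> t /psiC h; have := normr_ge0 d; lra.
- by move=> t /psiC h; rewrite /=; have := normr_ge0 (psi t); lra.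
Qed.

Lemma cvg_wint (phi_ : nat -> R -> R) phi (C : R) :
  (forall k, measurable_fun setT (phi_ k)) -> measurable_fun setT phi ->
  (forall k t, a <= t <= b -> `|phi_ k t| <= C) ->
  (forall t, a <= t <= b -> `|phi t| <= C) ->
  (forall t, a <= t <= b -> phi_ k t @[k --> \oo] --> phi t) ->
  wint (phi_ k) @[k --> \oo] --> wint phi.
Proof.
move=> mphi_ mphi phi_C phiC phi_phi.
have mf : measurable_fun `[a, b] f.
  by apply/measurable_EFinP; exact: (measurable_int _ f_int).
apply: fine_cvg; rewrite fineK; last first.
  by apply: integrable_fin_num => //; exact: wint_integrable phiC.
apply: (@dominated_cvg _ _ _ mu _ (measurable_itv _)
  (fun k t => (f t * phi_ k t)%:E) _ (fun t => C%:E * (f t)%:E)%E).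
- move=> k; apply/measurable_EFinP; apply: measurable_funM; first exact: mf.
  by apply: measurable_funTS; exact: mphi_.
- move=> t /=; rewrite in_itv/= => tab; apply: cvg_EFin.
    by apply: nearW.
  apply: cvgMr; exact: phi_phi.
- by [].
- exact: integrableZl.
- move=> k t /=; rewrite in_itv/= => tab; rewrite lee_fin normrM mulrC.
  by rewrite (ger0_norm (f_ge0 _ tab)) ler_wpM2r ?f_ge0// phi_C.
Qed.

End weighted_integral.

Section objective.
Context (R : realType).
Local Notation mu := (@lebesgue_measure R).
Variable V : R -> R.
Hypothesis V0 : forall t, t <= 0 -> V t = 0.
Hypothesis V1 : forall t, 1 <= t -> V t = 2 * t - 1.
Hypothesis cV : convex3 R V.
Hypothesis V_ge0 : forall t, 0 <= V t.
Hypothesis V_ge1 : forall t, 2 * t - 1 <= V t.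
Local Notation K := (between R V).

Lemma between_le1 u t : K u -> t <= 1 -> u t <= 1.
Proof.
move=> Ku t1; have /andP[+ _] := between_lipschitz _ _ V0 V1 _ _ _ Ku t1.
by rewrite (between_ge1 _ _ V1 _ 1 Ku)//; lra.
Qed.

Lemma measurable_between u : K u -> measurable_fun setT u.
Proof.
by move=> Ku; apply: continuous_measurable_fun; exact: between_continuous V0 V1 _ Ku.
Qed.

Lemma measurable_rderiv u : K u -> measurable_fun setT (rderiv R u).
Proof.
move=> Ku; apply: nondecreasing_measurable => //.
by move=> s t st; apply: rderiv_homo => //; case: Ku.
Qed.

Variables (a b : R) (f : R -> R).
Hypothesis a0 : 0 <= a.
Hypothesis b1 : b <= 1.
Hypothesis f_ge0 : forall t, a <= t <= b -> 0 <= f t.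
Hypothesis f_int : mu.-integrable `[a, b] (EFin \o f).
Local Notation F := (\int[mu]_(t in `[a, b]) f t).
Local Notation wint := (wint R a b f).

(* t p + (1 - t) q along the line t p - (1 - t) q of slope m and value y at t *)
Definition alloc (m y t : R) := 2 * t * (1 - t) * m + (2 * t - 1) * y.

(** [alloc] is nondecreasing in the slope for t in [0, 1], so at a kink the right derivative selects
    the subgradient with the highest acceptance. *)
Definition objective (u : R -> R) := wint (fun t => alloc (rderiv R u t) (u t) t).

Lemma measurable_alloc (m y : R -> R) : measurable_fun setT m ->
  measurable_fun setT y -> measurable_fun setT (fun t => alloc (m t) (y t) t).
Proof.
move=> mm my; rewrite /alloc; apply: measurable_funD; apply: measurable_funM => //.
- apply: measurable_funM; first by apply: measurable_funM.
  exact: measurable_funB.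
- by apply: measurable_funB => //; exact: measurable_funM.
Qed.

Lemma alloc_bound (m y t : R) : a <= t <= b -> 0 <= m <= 2 -> 0 <= y <= 1 ->
  `|alloc m y t| <= 2.
Proof.
move=> /andP[at_ tb] /andP[m0 m2] /andP[y0 y1].
have t0 : 0 <= t := le_trans a0 at_.
have t1 : 0 <= 1 - t by rewrite subr_ge0; exact: le_trans tb b1.
have q0 : 0 <= t * (1 - t) by rewrite mulr_ge0.
have q1 : t * (1 - t) <= 1 / 4 by have := sqr_ge0 (t - 1 / 2); rewrite expr2; nra.
have y2 : `|(2 * t - 1) * y| <= 1.
  by rewrite normrM -[1]mulr1 ler_pM// ler_norml; lra.
have m3 : 0 <= t * (1 - t) * m <= 1 / 4 * 2 by rewrite mulr_ge0//= ler_pM.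
move: y2; rewrite /alloc !ler_norml => /andP[y2 y3].
by apply/andP; split; lra.
Qed.

Lemma alloc_homo (m m' y t : R) : a <= t <= b -> m <= m' -> alloc m y t <= alloc m' y t.
Proof.
move=> /andP[at_ tb] mm'; rewrite /alloc lerD2r ler_wpM2l//.
by rewrite !mulr_ge0// ?subr_ge0 ?(le_trans a0 at_) ?(le_trans tb b1).
Qed.

Lemma objective_bound u : K u -> forall t, a <= t <= b ->
  `|alloc (rderiv R u t) (u t) t| <= 2.
Proof.
move=> Ku t tab; apply: alloc_bound => //.
  exact: between_rderiv V0 V1 _ _ Ku.
rewrite (between_le1 _ _ Ku) ?andbT//; first by case: Ku.
by case/andP: tab => _ tb; exact: le_trans tb b1.
Qed.

Lemma measurable_objective u : K u ->
  measurable_fun setT (fun t => alloc (rderiv R u t) (u t) t).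
Proof.
move=> Ku; apply: measurable_alloc; first exact: measurable_rderiv.
exact: measurable_between.
Qed.

Lemma objective_le u : K u -> objective u <= 2 * F.
Proof.
move=> Ku; rewrite -wint_cst//; apply: (@le_wint _ _ _ _ f_ge0 f_int _ _ 2) => //.
- exact: measurable_objective.
- exact: objective_bound.
- by move=> t _; rewrite ger0_norm.
- by move=> t tab; apply: le_trans (objective_bound _ Ku _ tab); exact: ler_norm.
Qed.

Lemma slope_bound u t s : K u -> t < s -> 0 <= slope R u t s <= 2.
Proof.
move=> Ku ts; have /andP[h1 h2] := between_lipschitz _ _ V0 V1 _ _ _ Ku (ltW ts).
rewrite /slope ler_pdivrMr ?subr_gt0// divr_ge0//=; lra.
Qed.

(** With the difference quotient over a step h k in place of the right derivative, the functional
    majorizes the objective, is Lipschitz for the sup norm, and tends to the objective at u as the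
    step shrinks. *)
Lemma objective_usc : usc_on R K objective.
Proof.
move=> u Ku e e0.
have [cu u0 _ _] := Ku.
pose h (k : nat) : R := k.+1%:R^-1.
have h0 k : 0 < h k by rewrite /h invr_gt0.
pose phi (w : R -> R) k t := alloc (slope R w t (t + h k)) (w t) t.
have mphi w k : K w -> measurable_fun setT (phi w k).
  move=> Kw; apply: measurable_alloc; last exact: measurable_between.
  rewrite /slope; apply: measurable_funM; last first.
    rewrite (_ : (fun _ => _) = cst ((h k)^-1)) //.
    by apply/funext => t /=; congr (_^-1); ring.
  apply: measurable_funB; last exact: measurable_between.
  apply: measurableT_comp; first exact: measurable_between.
  exact: measurable_funD.
have bphi w k t : K w -> a <= t <= b -> `|phi w k t| <= 2.
  move=> Kw tab; apply: alloc_bound => //.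
    by apply: slope_bound => //; rewrite ltrDl.
  rewrite (between_le1 _ _ Kw) ?andbT//; first by case: Kw.
  by case/andP: tab => _ tb; exact: le_trans tb b1.
have cphi : wint (phi u k) @[k --> \oo] --> objective u.
  apply: (@cvg_wint _ _ _ _ f_ge0 f_int _ _ 2).
  - by move=> k; exact: mphi.
  - exact: measurable_objective.
  - by move=> k t; exact: bphi.
  - exact: objective_bound.
  - move=> t tab; rewrite /phi /alloc; apply: cvgD; last exact: cvg_cst.
    apply: cvgMr; apply/cvgrPdist_le => d d0.
    have [s ts H] := rderiv_approx _ _ cu t d d0.
    have st : 0 < s - t by lra.
    near=> k.
    have hk : h k < (PosNum st)%:num.
      by near: k; exact: near_infty_natSinv_lt.
    have hk' := hk; rewrite /= in hk'.
    have tk : t < t + h k by rewrite ltrDl.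
    have h1 := rderiv_le_slope _ _ cu t (t + h k) tk.
    have h2 := H (t + h k) tk ltac:(lra).
    have h3 : slope R u t (t + h k) <= rderiv R u t + d.
      rewrite /slope ler_pdivrMr//; lra.
    rewrite ler_norml; lra.
have /cvgrPdist_lt /(_ (e / 2) ltac:(lra)) [k _ /(_ k (leqnn k))] := cphi.
rewrite /= ltr_norml => /andP[Hk _].
have [G GE] : exists G, F = G by exists F.
have G0 : 0 <= G by rewrite -GE; exact: wint_mass_ge0.
have h2k : 0 < 2 / h k by rewrite divr_gt0.
(* A uniform error d moves a slope over the step h k by at most 2 d / h k, and the value term of
   [alloc] by at most d; G + 1 makes the final inequality strict even if G = 0. *)
pose C := (2 / h k + 1) * (G + 1).
have C0 : 0 < C by rewrite mulr_gt0//; lra.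
exists (e / 2 / C); first by rewrite !divr_gt0.
set d := e / 2 / C => v Kv vu.
have d0 : 0 < d by rewrite !divr_gt0.
have h1 : objective v <= wint (phi v k).
  apply: (@le_wint _ _ _ _ f_ge0 f_int _ _ 2).
  - exact: measurable_objective.
  - exact: mphi.
  - exact: objective_bound.
  - by move=> t; exact: bphi.
  - move=> t tab; apply: alloc_homo => //; apply: rderiv_le_slope; last by rewrite ltrDl.
    by case: Kv.
have h2 : wint (phi v k) <= wint (phi u k) + (d * (2 / h k + 1)) * G.
  rewrite -GE.
  apply: (@le_wint_add _ _ _ _ f_ge0 f_int _ _ 2).
  - exact: mphi.
  - exact: mphi.
  - by move=> t; exact: bphi.
  - by move=> t; exact: bphi.
  - move=> t tab; have /andP[at_ tb] := tab.
    have t0 : 0 <= t := le_trans a0 at_.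
    have t1 : t <= 1 := le_trans tb b1.
    have sl : slope R v t (t + h k) <= slope R u t (t + h k) + d * (2 / h k).
      rewrite /slope (_ : t + h k - t = h k); last ring.
      rewrite (_ : d * (2 / h k) = (2 * d) / h k); last ring.
      rewrite -mulrDl ler_pM2r ?invr_gt0//.
      have := vu t; have := vu (t + h k); rewrite !ler_norml; lra.
    apply: le_trans (alloc_homo _ _ _ _ tab sl) _.
    have dh : 0 < d * (2 / h k) by rewrite mulr_gt0// divr_gt0.
    have tt : 2 * t * (1 - t) <= 1 by nra.
    have := vu t; rewrite /phi /alloc ler_norml => /andP[v1 v2].
    have : (2 * t - 1) * (v t - u t) <= d.
      have [tpos|tneg] := leP 0 (2 * t - 1); nra.
    have : 2 * t * (1 - t) * (d * (2 / h k)) <= d * (2 / h k) by nra.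
    nra.
have h3 : d * (2 / h k + 1) * G < e / 2.
  have -> : e / 2 = d * C by rewrite /d divfK// gt_eqF.
  rewrite /C; have : 0 < d * (2 / h k + 1).
    by rewrite mulr_gt0//; lra.
  nra.
lra.
Unshelve. all: by end_near.
Qed.

(** At a maximizer u this inequality forces v and w to be maximizers as well. *)
Lemma objective_average u v w : K u -> K v -> K w ->
  (forall t, u t = (v t + w t) / 2) ->
  objective u <= (objective v + objective w) / 2.
Proof.
move=> Ku Kv Kw uvw.
have H : objective u <= wint (fun t => 2^-1 * (alloc (rderiv R v t) (v t) t
    + alloc (rderiv R w t) (w t) t)).
  apply: (@le_wint _ _ _ _ f_ge0 f_int _ _ 2).
  - exact: measurable_objective.
  - apply: measurable_funM => //.
    by apply: measurable_funD; exact: measurable_objective.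
  - exact: objective_bound.
  - move=> t tab; have := objective_bound _ Kv t tab; have := objective_bound _ Kw t tab.
    rewrite !ler_norml; lra.
  - move=> t tab; have [cu _ _ _] := Ku; have [cv _ _ _] := Kv; have [cw _ _ _] := Kw.
    have := rderiv_average _ u v w t cu cv cw uvw => h.
    apply: le_trans (alloc_homo _ _ _ _ tab h) _.
    by rewrite uvw /alloc; lra.
apply: le_trans H _.
rewrite (wintZ _ _ _ _ f_int _ 4).
- rewrite (wintD _ _ _ _ f_int _ _ 2).
  + by rewrite -/(objective v) -/(objective w); lra.
  + exact: measurable_objective.
  + exact: measurable_objective.
  + exact: objective_bound.
  + exact: objective_bound.
- by apply: measurable_funD; exact: measurable_objective.
- move=> t tab; have := objective_bound _ Kv t tab; have := objective_bound _ Kw t tab.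
  rewrite !ler_norml; lra.
Qed.

End objective.

(** * A strictly convex functional: the integral of u^2 over [0, 1] *)

Section square_integral.
Context (R : realType).
Local Notation mu := (@lebesgue_measure R).
Variable V : R -> R.
Hypothesis V0 : forall t, t <= 0 -> V t = 0.
Hypothesis V1 : forall t, 1 <= t -> V t = 2 * t - 1.
Local Notation K := (between R V).

(** The factor 1 presents this as [wint] with constant weight. *)
Definition sqint (u : R -> R) := \int[mu]_(t in `[0, 1]) (1 * (u t * u t)).

Let one_ge0 (t : R) : 0 <= t <= 1 -> 0 <= (cst 1 t : R). Proof. by []. Qed.

Let one_int : mu.-integrable `[0, 1] (EFin \o (cst 1 : R -> R)).
Proof.
apply: continuous_compact_integrable; first exact: segment_compact.
by apply: continuous_subspaceT => t; exact: cvg_cst.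
Qed.

Let one_mass : \int[mu]_(t in `[0, 1]) (cst 1 t : R) = 1.
Proof.
rewrite Rintegral_cst// /= lebesgue_measure_itv/= lte_fin ltr01 -EFinD/=.
by rewrite subr0 mul1r.
Qed.

Let measurable_sq u : K u -> measurable_fun setT (fun t => u t * u t).
Proof. by move=> Ku; apply: measurable_funM; exact: measurable_between V0 V1 _ Ku. Qed.

Let u01 u t : K u -> 0 <= t <= 1 -> 0 <= u t <= 1.
Proof.
move=> Ku /andP[t0 t1]; rewrite (between_le1 _ _ V0 V1 _ _ Ku t1) andbT.
by case: Ku.
Qed.

Let sq_bound u : K u -> forall t, 0 <= t <= 1 -> `|u t * u t| <= 1.
Proof.
by move=> Ku t /(u01 _ _ Ku)/andP[h1 h2]; rewrite ger0_norm ?mulr_ge0//; nra.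
Qed.

Lemma sqint_le1 u : K u -> sqint u <= 1.
Proof.
move=> Ku; rewrite -[leRHS]mul1r -[X in _ <= _ * X]one_mass.
rewrite -wint_cst//; apply: (@le_wint _ _ _ _ one_ge0 one_int _ _ 1) => //.
- exact: measurable_sq.
- exact: sq_bound.
- by move=> t _; rewrite normr1.
- by move=> t t01; apply: le_trans (sq_bound _ Ku _ t01); exact: ler_norm.
Qed.

Lemma sqint_usc : usc_on R K sqint.
Proof.
move=> u Ku e e0; exists (e / 4); first lra.
move=> v Kv vu; have : sqint v <= sqint u + (e / 2) * 1.
  rewrite -[X in _ * X]one_mass.
  apply: (@le_wint_add _ _ _ _ one_ge0 one_int _ _ 1).
  - exact: measurable_sq.
  - exact: measurable_sq.
  - exact: sq_bound.
  - exact: sq_bound.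
  - move=> t t01; have /andP[h1 h2] := u01 _ _ Ku t01.
    have /andP[h3 h4] := u01 _ _ Kv t01.
    have := vu t; rewrite ler_norml => /andP[h5 h6].
    nra.
lra.
Qed.

(** Parallelogram identity: with D = (v - w) / 2 the mean of v^2 and w^2 is u^2 + D^2, and the
    continuous D is nonzero at an interior point. *)
Lemma sqint_average u v w : K u -> K v -> K w ->
  (forall t, u t = (v t + w t) / 2) -> (exists t, v t <> w t) ->
  sqint u < (sqint v + sqint w) / 2.
Proof.
move=> Ku Kv Kw uvw [t0 vw].
have t0_gt0 : 0 < t0.
  rewrite ltNge; apply/negP => h; apply: vw.
  by rewrite (between_le0 _ _ V0 v _ Kv h) (between_le0 _ _ V0 w _ Kw h).
have t0_lt1 : t0 < 1.
  rewrite ltNge; apply/negP => h; apply: vw.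
  by rewrite (between_ge1 _ _ V1 v _ Kv h) (between_ge1 _ _ V1 w _ Kw h).
pose D t := 2^-1 * (v t - w t).
have mD : measurable_fun setT D.
  apply: measurable_funM => //.
  by apply: measurable_funB; exact: measurable_between V0 V1 _ _.
have mDD : measurable_fun setT (fun t => D t * D t) by exact: measurable_funM.
have bDD t : 0 <= t <= 1 -> `|D t * D t| <= 1.
  move=> t01; have /andP[h1 h2] := u01 _ _ Kv t01; have /andP[h3 h4] := u01 _ _ Kw t01.
  by rewrite /D ler_norml; apply/andP; split; nra.
have id2 : 2^-1 * (sqint v + sqint w) = sqint u + sqint D.
  pose W := wint R 0 1 (cst 1).
  have e1 : W (fun t => v t * v t + w t * w t) = sqint v + sqint w.
    apply: (wintD _ _ _ _ one_int _ _ 1).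
    - exact: measurable_sq.
    - exact: measurable_sq.
    - exact: sq_bound.
    - exact: sq_bound.
  have e2 : W (fun t => u t * u t + D t * D t) = sqint u + sqint D.
    apply: (wintD _ _ _ _ one_int _ _ 1) => //.
    - exact: measurable_sq.
    - exact: sq_bound.
  have e3 : W (fun t => 2^-1 * (v t * v t + w t * w t)) =
      2^-1 * W (fun t => v t * v t + w t * w t).
    apply: (wintZ _ _ _ _ one_int _ 2).
    - by apply: measurable_funD; exact: measurable_sq.
    - move=> t t01; have := sq_bound _ Kv t t01; have := sq_bound _ Kw t t01.
      by rewrite !ler_norml; lra.
  rewrite -e1 -e2 -e3; apply: eq_Rintegral => t _.
  by rewrite uvw /D; field.
suff : 0 < sqint D by lra.
pose c := `|D t0|.
have c0 : 0 < c by rewrite normr_gt0 mulf_neq0// subr_eq0; apply/eqP.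
(* By the Lipschitz bounds |D| stays above c / 2 over a length c / 4; the other bound keeps the
   interval inside [0, 1]. *)
pose eta := Num.min (c / 4) (1 - t0).
have eta0 : 0 < eta by rewrite lt_min; apply/andP; split; lra.
have eta1 : t0 + eta <= 1.
  have : eta <= 1 - t0 by rewrite ge_min lexx orbT.
  lra.
have eta2 : eta <= c / 4 by rewrite ge_min lexx.
have DI t : t0 <= t <= t0 + eta -> c / 2 <= `|D t|.
  move=> /andP[h1 h2].
  have /andP[k1 k2] := between_lipschitz _ _ V0 V1 _ _ _ Kv h1.
  have /andP[k3 k4] := between_lipschitz _ _ V0 V1 _ _ _ Kw h1.
  have : `|D t0 - D t| <= c / 2.
    by rewrite /D ler_norml; apply/andP; split; lra.
  have := ler_normD (D t0 - D t) (D t); rewrite subrK -/c; lra.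
rewrite /sqint /Rintegral; apply: fine_gt0; apply/andP; split; last first.
  have wi := wint_integrable R 0 1 (cst 1) one_int _ 1 mDD bDD.
  have := integrable_fin_num (mu := mu) (measurable_itv `[0%R, 1%R]) wi.
  by rewrite fin_numE => /andP[_]; rewrite ltey.
have lt1 : (0 < \int[mu]_(t in `[t0, (t0 + eta)%R]) (c / 2 * (c / 2))%:E)%E.
  rewrite integral_cst//= lebesgue_measure_itv/= lte_fin ltrDl eta0 -EFinD -EFinM.
  by rewrite lte_fin !mulr_gt0//; lra.
have le2 : (\int[mu]_(t in `[t0, (t0 + eta)%R]) (c / 2 * (c / 2))%:E <=
    \int[mu]_(t in `[t0, (t0 + eta)%R]) (1 * (D t * D t))%:E)%E.
  apply: ge0_le_integral => //.
  - by move=> t _; rewrite lee_fin mulr_ge0// ltW//; lra.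
  - by apply/measurable_EFinP; apply: measurable_funTS; apply: measurable_funM.
  - move=> t /=; rewrite in_itv/= => /DI h; rewrite lee_fin mul1r.
    have -> : D t * D t = `|D t| * `|D t| by rewrite -normrM ger0_norm// -expr2 sqr_ge0.
    by rewrite ler_pM//; lra.
apply: (lt_le_trans lt1); apply: (le_trans le2).
apply: ge0_subset_integral => //.
- by apply/measurable_EFinP; apply: measurable_funTS; apply: measurable_funM.
- by move=> t _; rewrite lee_fin mul1r -expr2 sqr_ge0.
- by move=> t /=; rewrite !in_itv/= => /andP[h1 h2]; apply/andP; split; lra.
Qed.

End square_integral.

(** * Conditional acceptance probabilities *)

Section conditional_expectation.
Context (R : realType) (n : nat) (a b : R) (i : 'I_n) (d : R -> R).
Local Notation mu := (@lebesgue_measure R).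
Local Notation prof := (n.-tuple R).
Hypothesis d_ge0 : forall t, 0 <= d t.
Hypothesis measurable_d : measurable_fun setT d.
Hypothesis d_int : (\int[mu]_(t in `[a, b]) (d t)%:E = 1)%E.
Implicit Types (x y : prof -> R) (s : prof).

Definition is_test x := measurable_fun setT x /\ forall s, 0 <= x s <= 1.

Definition others_density s := \prod_(k < n | k != i) d (tnth s k).
Local Notation D := others_density.

Definition cexpE x th :=
  iint a b (others i) (fun s => (x s * D s)%:E) (tupd (prof0 R n) i th).

Definition cexp x th := fine (cexpE x th).

Lemma others_density_ge0 s : 0 <= D s. Proof. exact: prodr_ge0. Qed.

Lemma measurable_others_prod (h : R -> R) : measurable_fun setT h ->
  measurable_fun setT (fun s : prof => \prod_(k < n | k != i) h (tnth s k)).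
Proof.
move=> mh; rewrite [X in measurable_fun _ X](_ : _ =
  fun s : prof => \prod_(k <- others i) h (tnth s k)); last first.
  by apply/funext => s; rewrite /others big_filter big_enum_cond.
apply: measurable_prod => k _.
exact: (measurableT_comp mh (measurable_tnth k)).
Qed.

Lemma mem_others k : (k \in others i) = (k != i).
Proof. by rewrite mem_filter mem_enum andbT. Qed.

Lemma uniq_others : uniq (others i).
Proof. by rewrite filter_uniq// enum_uniq. Qed.

Lemma measurable_test_density x : is_test x ->
  measurable_fun setT (fun s => (x s * D s)%:E).
Proof.
move=> [mx _]; apply/measurable_EFinP/measurable_funM => //.
exact: measurable_others_prod.
Qed.

Lemma test_density_ge0 x s : is_test x -> (0 <= (x s * D s)%:E)%E.
Proof.
by move=> [_ x01]; rewrite lee_fin mulr_ge0 ?others_density_ge0//; case/andP: (x01 s).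
Qed.

Hint Resolve measurable_test_density test_density_ge0 : core.

Lemma is_test_cst c : 0 <= c <= 1 -> is_test (cst c).
Proof. by move=> c01; split. Qed.

Lemma cexpE_le x y th : is_test x -> is_test y ->
  (forall s, tnth s i = th -> (forall k, k != i -> Icc a b (tnth s k)) ->
    x s * D s <= y s * D s) -> (cexpE x th <= cexpE y th)%E.
Proof.
move=> tx ty H; apply: le_iint_local => //; try by move=> s; apply: test_density_ge0.
- exact: measurable_test_density.
- exact: measurable_test_density.
move=> s h1 h2; rewrite lee_fin; apply: H.
  by rewrite h1 ?mem_others ?eqxx// tnth_tupd eqxx.
by move=> k ki; apply: h2; rewrite mem_others.
Qed.

Lemma cexpE_cst1 th : cexpE (cst 1) th = 1%E.
Proof.
rewrite -(iint_prod_density R n a b (others i) d (tupd (prof0 R n) i th) uniq_others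
  d_ge0 measurable_d d_int) /cexpE.
congr (iint a b _ _ _); apply/funext => s.
by rewrite /= mul1r /others_density /others big_filter big_enum_cond.
Qed.

Lemma cexpE_ge0 x th : is_test x -> (0 <= cexpE x th)%E.
Proof. by move=> tx; apply: iint_ge0 => s; exact: test_density_ge0. Qed.

Lemma cexpE_le1 x th : is_test x -> (cexpE x th <= 1)%E.
Proof.
move=> tx; rewrite -(cexpE_cst1 th); apply: cexpE_le => //.
  by apply: is_test_cst; rewrite ler01 lexx.
move=> s _ _; rewrite ler_wpM2r ?others_density_ge0//.
by case: tx => _ /(_ s)/andP[].
Qed.

Lemma cexpEE x th : is_test x -> cexpE x th = (cexp x th)%:E.
Proof.
move=> tx; rewrite /cexp fineK// ge0_fin_numE ?cexpE_ge0//.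
by apply: le_lt_trans (cexpE_le1 _ _ tx) _; rewrite ltry.
Qed.

Lemma cexp_ge0 x th : is_test x -> 0 <= cexp x th.
Proof. by move=> tx; rewrite -lee_fin -cexpEE// cexpE_ge0. Qed.

Lemma cexp_le1 x th : is_test x -> cexp x th <= 1.
Proof. by move=> tx; rewrite -lee_fin -cexpEE// cexpE_le1. Qed.

Lemma cexp_cst1 th : cexp (cst 1) th = 1.
Proof. by rewrite /cexp cexpE_cst1. Qed.

Lemma cexp_le x y th : is_test x -> is_test y ->
  (forall s, tnth s i = th -> (forall k, k != i -> Icc a b (tnth s k)) ->
    x s * D s <= y s * D s) -> cexp x th <= cexp y th.
Proof. by move=> tx ty H; rewrite -lee_fin -!cexpEE// cexpE_le. Qed.

Lemma cexp_eq x y th : is_test x -> is_test y ->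
  (forall s, tnth s i = th -> (forall k, k != i -> Icc a b (tnth s k)) ->
    x s * D s = y s * D s) -> cexp x th = cexp y th.
Proof.
move=> tx ty H; apply/eqP; rewrite eq_le.
by rewrite !cexp_le// => s h1 h2; rewrite H.
Qed.

Lemma cexpZ x th (c : R) : is_test x -> 0 <= c <= 1 ->
  cexp (fun s => c * x s) th = c * cexp x th.
Proof.
move=> tx /andP[c0 c1]; apply: EFin_inj; rewrite EFinM -!cexpEE//.
  rewrite /cexpE -iintZ//.
  - by congr (iint a b _ _ _); apply/funext => s; rewrite -EFinM mulrA.
  - by move=> s; apply: test_density_ge0.
  - exact: measurable_test_density.
case: tx => mx x01; split; first exact: measurable_funM.
by move=> s; have /andP[h1 h2] := x01 s; rewrite mulr_ge0//= mulr_ile1.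
Qed.

Lemma cexp_eq0 x th : is_test x ->
  (forall s, tnth s i = th -> (forall k, k != i -> Icc a b (tnth s k)) ->
    x s * D s = 0) -> cexp x th = 0.
Proof.
move=> tx H.
have t0 : is_test (fun s => 0 * x s).
  by rewrite (_ : (fun s => _) = cst 0);
    [apply: is_test_cst; rewrite lexx ler01|apply/funext => s; rewrite mul0r].
rewrite (cexp_eq x _ _ tx t0); last by move=> s h1 h2; rewrite H// !mul0r.
by rewrite cexpZ ?mul0r ?lexx ?ler01.
Qed.

Lemma is_test_onem x : is_test x -> is_test (fun s => 1 - x s).
Proof.
move=> [mx x01]; split; first exact: measurable_funB.
by move=> s; have := x01 s; lra.
Qed.

Lemma cexp_onem x th : is_test x -> cexp (fun s => 1 - x s) th = 1 - cexp x th.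
Proof.
move=> tx; have tx' := is_test_onem _ tx.
suff : cexp (fun s => 1 - x s) th + cexp x th = 1 by lra.
apply: EFin_inj; rewrite EFinD -!cexpEE// -(cexpE_cst1 th) /cexpE -iintD.
- by congr (iint a b _ _ _); apply/funext => s; rewrite -EFinD /=; congr (_%:E); ring.
- by move=> s; exact: test_density_ge0 tx'.
- by move=> s; exact: test_density_ge0 tx.
- exact: measurable_test_density tx'.
- exact: measurable_test_density tx.
Qed.

Lemma iint_tupd ks (g : prof -> \bar R) s k v : k \notin ks ->
  iint a b ks g (tupd s k v) = iint a b ks (fun s => g (tupd s k v)) s.
Proof.
elim: ks s => [//|j ks IH] s; rewrite inE negb_or => /andP[kj kks] /=.
by apply: eq_integral => w _; rewrite tupdC// IH.
Qed.

Lemma cexp_indep x th th' : (forall s v, x (tupd s i v) = x s) ->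
  cexp x th = cexp x th'.
Proof.
move=> xi; rewrite /cexp /cexpE !iint_tupd ?mem_others ?eqxx//.
congr (fine (iint a b _ _ _)); apply/funext => s; rewrite !xi.
congr ((_ * _)%:E); apply: eq_bigr => k ki.
by rewrite !tnth_tupd (negbTE ki).
Qed.

Lemma measurable_cexp x : is_test x -> measurable_fun setT (cexp x).
Proof.
move=> tx; apply/measurable_EFinP.
rewrite (_ : EFin \o _ = fun th => cexpE x th); last first.
  by apply/funext => th /=; rewrite cexpEE.
apply: measurable_iint_tupd.
- by move=> s; exact: test_density_ge0.
- exact: measurable_test_density.
Qed.

(** Order and convergence concern the products with the density: off the support the products of s_k
    and 1 - s_k may be negative and threshold tests need not be ordered. *)
Lemma cvg_cexp (x_ : nat -> prof -> R) x th : (forall k, is_test (x_ k)) -> is_test x ->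
  (forall s k l, (k <= l)%N -> x_ k s * D s <= x_ l s * D s) ->
  (forall s, x_ k s * D s @[k --> \oo] --> x s * D s) ->
  cexp (x_ k) th @[k --> \oo] --> cexp x th.
Proof.
move=> tx_ tx ndx xx; apply: fine_cvg; rewrite -cexpEE//.
apply: cvg_iint.
- by move=> k s; exact: test_density_ge0.
- by move=> k; exact: measurable_test_density.
- by move=> s k l kl; rewrite lee_fin; exact: ndx.
- by move=> s; apply: cvg_EFin; [exact: nearW|exact: xx].
Qed.

(** The nonnegative difference y - x lives on a level set of the likelihood ratio of the others,
    which is null because n >= 2 leaves at least one other agent. *)
Lemma cexp_eq_off_hyperplane x y th (A B : R) : 0 <= a -> b <= 1 -> (2 <= n)%N ->
  is_test x -> is_test y -> 0 <= A -> 0 <= B -> 0 < A + B ->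
  (forall s, x s <= y s) ->
  (forall s, A * \prod_(k < n | k != i) (1 - tnth s k) <>
     B * \prod_(k < n | k != i) tnth s k -> x s = y s) ->
  cexp x th = cexp y th.
Proof.
move=> a0 b1 n2 tx ty A0 B0 AB xley xy.
have tyx : is_test (fun s => y s - x s).
  case: tx => mx x01; case: ty => my y01; split; first exact: measurable_funB.
  by move=> s; have := x01 s; have := y01 s; have := xley s; lra.
have : cexpE (fun s => y s - x s) th = 0%E.
  apply: (iint_eq0_hyperplane _ _ _ _ _ _ _ A B) => //.
  - apply/eqP => o0.
    have [k ki] : exists k : 'I_n, k != i.
      have [i0|i0] := eqVneq (nat_of_ord i) 0%N.
        by exists (Ordinal n2); rewrite -val_eqE /= i0.
      by exists (Ordinal (ltnW n2)); rewrite -val_eqE /= eq_sym.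
    by have := mem_others k; rewrite o0 ki.
  - exact: uniq_others.
  - by move=> s; exact: test_density_ge0 tyx.
  - exact: measurable_test_density tyx.
  move=> s _; rewrite !/others !big_filter !big_enum_cond => ne.
  by rewrite xy// subrr mul0r.
rewrite cexpEE// => /eqP; rewrite eqe => /eqP e0.
suff : cexp (fun s => y s - x s) th + cexp x th = cexp y th by lra.
apply: EFin_inj; rewrite EFinD -!cexpEE// /cexpE -iintD.
- by congr (iint a b _ _ _); apply/funext => s; rewrite -EFinD /=; congr (_%:E); ring.
- by move=> s; exact: test_density_ge0 tyx.
- by move=> s; exact: test_density_ge0 tx.
- exact: measurable_test_density tyx.
- exact: measurable_test_density tx.
Qed.

(* The iterated integral over all coordinates, in the order of the enumeration,
   is rearranged so that coordinate i comes first. *)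
Lemma iint_enum x : is_test x ->
  iint a b (enum 'I_n) (fun s => (x s * \prod_(k < n) d (tnth s k))%:E) (prof0 R n) =
  (\int[mu]_(t in `[a, b]) (d t * cexp x t)%:E)%E.
Proof.
move=> tx; have [mx x01] := tx.
have mD : measurable_fun setT (fun s : prof => \prod_(k < n) d (tnth s k)).
  by apply: measurable_prod => k _; exact: (measurableT_comp measurable_d (measurable_tnth k)).
have g0 s : (0 <= (x s * \prod_(k < n) d (tnth s k))%:E)%E.
  by rewrite lee_fin mulr_ge0 ?prodr_ge0//; case/andP: (x01 s).
have mg : measurable_fun setT (fun s => (x s * \prod_(k < n) d (tnth s k))%:E).
  by apply/measurable_EFinP/measurable_funM.
have iN : i \in enum 'I_n by rewrite mem_enum.
have fid (l : seq 'I_n) : i \notin l -> [seq k <- l | k != i] = l.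
  by move=> il; apply/all_filterP/allP => k kl; apply: contraNneq il => <-.
have : exists l1 l2, [/\ i \notin l1, enum 'I_n = l1 ++ i :: l2 & others i = l1 ++ l2].
  have u := enum_uniq 'I_n; rewrite /others.
  move: iN u; case/splitPr => l1 l2 u; exists l1, l2.
  have [il1 il2] : i \notin l1 /\ i \notin l2.
    by move: u; rewrite cat_uniq /= negb_or => /and3P[_ /andP[-> _] /andP[-> _]].
  by split => //; rewrite filter_cat /= eqxx /= !fid.
move=> [l1 [l2 [il1 -> eo]]].
rewrite iint_move// -eo -[LHS]/(\int[mu]_(v in `[a, b]) _)%E.
apply: eq_integral => t _.
rewrite EFinM -cexpEE// /cexpE -iintZ//.
- apply: eq_iint_local => //.
  + by move=> s; rewrite -EFinM lee_fin !mulr_ge0 ?others_density_ge0//; case/andP: (x01 s).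
  + apply: measurable_funeM; exact: measurable_test_density.
  + move=> s h1 h2; rewrite -EFinM; congr (_%:E).
    rewrite (bigD1 i)//= h1 ?mem_others ?eqxx// tnth_tupd eqxx.
    by rewrite /others_density; ring.
- by move=> s; exact: test_density_ge0.
- exact: measurable_test_density.
Qed.

End conditional_expectation.

(** * Threshold tests and the full-information value *)

Section threshold_tests.
Context (R : realType) (n : nat) (a b : R) (i : 'I_n) (f : R -> R).
Local Notation mu := (@lebesgue_measure R).
Local Notation prof := (n.-tuple R).
Hypothesis n2 : (2 <= n)%N.
Hypothesis a0 : 0 <= a.
Hypothesis b1 : b <= 1.
Hypothesis f_ge0 : forall t, 0 <= f t.
Hypothesis measurable_f : measurable_fun setT f.
Hypothesis f_out : forall t, ~ Icc a b t -> f t = 0.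
Local Notation fp := (dplus f).
Local Notation fm := (dminus f).
Hypothesis fp_int : (\int[mu]_(t in `[a, b]) (fp t)%:E = 1)%E.
Hypothesis fm_int : (\int[mu]_(t in `[a, b]) (fm t)%:E = 1)%E.
Local Notation test := (is_test R n).
Local Notation Ep := (cexp R n a b i fp).
Local Notation Em := (cexp R n a b i fm).
Implicit Types (x y : prof -> R) (s : prof) (r t : R).

Lemma dplus_ge0 t : 0 <= fp t.
Proof.
have [/andP[at_ tb]|/negP tab] := boolP (a <= t <= b).
  have h0 := a0.
  by rewrite /dplus !mulr_ge0//; lra.
by rewrite /dplus f_out ?mulr0// /Icc/= in_itv.
Qed.

Lemma dminus_ge0 t : 0 <= fm t.
Proof.
have [/andP[at_ tb]|/negP tab] := boolP (a <= t <= b).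
  have h1 := b1.
  by rewrite /dminus !mulr_ge0//; lra.
by rewrite /dminus f_out ?mulr0// /Icc/= in_itv.
Qed.

Lemma measurable_dplus : measurable_fun setT fp.
Proof. by apply: measurable_funM => //; apply: measurable_funM. Qed.

Lemma measurable_dminus : measurable_fun setT fm.
Proof.
apply: measurable_funM => //; apply: measurable_funM => //.
exact: measurable_funB.
Qed.

Definition lr_num s := \prod_(k < n | k != i) tnth s k.
Definition lr_den s := \prod_(k < n | k != i) (1 - tnth s k).
(** The common factor of the two conditional densities, which are [lr_num] and [lr_den] times it. *)
Definition density_factor s := \prod_(k < n | k != i) (2 * f (tnth s k)).

Lemma density_plus s : others_density R n i fp s = lr_num s * density_factor s.
Proof.
by rewrite /others_density /lr_num /density_factor -big_split; apply: eq_bigr => k _; rewrite /dplus/=; ring.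
Qed.

Lemma density_minus s : others_density R n i fm s = lr_den s * density_factor s.
Proof.
by rewrite /others_density /lr_den /density_factor -big_split; apply: eq_bigr => k _; rewrite /dminus/=; ring.
Qed.

Lemma density_factor_ge0 s : 0 <= density_factor s.
Proof. by apply: prodr_ge0 => k _; rewrite mulr_ge0. Qed.

(** Reduces pointwise comparisons of integrands to profiles where both products have the right
    sign. *)
Lemma density_factor_cases s : density_factor s = 0 \/ 0 <= lr_num s /\ 0 <= lr_den s.
Proof.
have [H|/existsNP[k /not_implyP[ki kab]]] :=
    pselect (forall k, k != i -> Icc a b (tnth s k)).
  right; split; apply: prodr_ge0 => k /H; rewrite /Icc/= in_itv/= => /andP[h1 h2].
    exact: le_trans a0 h1.
  by rewrite subr_ge0; exact: le_trans h2 b1.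
by left; rewrite /density_factor (bigD1 k)//= f_out// mulr0 mul0r.
Qed.

Lemma measurable_lr_num : measurable_fun setT lr_num.
Proof. exact: (measurable_others_prod R n i id). Qed.

Lemma measurable_lr_den : measurable_fun setT lr_den.
Proof.
apply: (measurable_others_prod R n i (fun t => 1 - t)); exact: measurable_funB.
Qed.

Lemma lr_num_tupd s v : lr_num (tupd s i v) = lr_num s.
Proof. by apply: eq_bigr => k ki; rewrite tnth_tupd (negbTE ki). Qed.

Lemma lr_den_tupd s v : lr_den (tupd s i v) = lr_den s.
Proof. by apply: eq_bigr => k ki; rewrite tnth_tupd (negbTE ki). Qed.

Lemma is_test_indicator (c : prof -> bool) : measurable_fun setT c ->
  test (fun s => (c s)%:R).
Proof.
move=> mc; split; last by move=> s; case: (c s); rewrite /= ?lexx ?ler01.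
rewrite (_ : (fun s => _) = fun s => if c s then 1 else 0).
  exact: measurable_fun_ifT.
by apply/funext => s; case: (c s).
Qed.

(** The likelihood-ratio test with cutoff (1 - r) / r, multiplied out so that it makes sense for
    every real r. *)
Definition chi r s : R := ((1 - r) * lr_den s <= r * lr_num s)%R%:R.
Definition chi' r s : R := ((1 - r) * lr_den s < r * lr_num s)%R%:R.

Lemma is_test_chi r : test (chi r).
Proof.
apply: is_test_indicator; apply: measurable_fun_ler; apply: measurable_funM => //.
  exact: measurable_lr_den.
exact: measurable_lr_num.
Qed.

Lemma is_test_chi' r : test (chi' r).
Proof.
apply: is_test_indicator; apply: measurable_fun_ltr; apply: measurable_funM => //.
  exact: measurable_lr_den.
exact: measurable_lr_num.
Qed.

(* Acceptance probabilities, for omega = +1 and omega = -1, of the test chi r that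
   is optimal for an agent with posterior r. *)
Definition Pr r := Ep (chi r) 0.
Definition Qr r := Em (chi r) 0.
Definition first_best r := r * Pr r - (1 - r) * Qr r.
Local Notation V := first_best.

(** The report 0 in [Pr] is arbitrary, because [chi r] ignores coordinate i. *)
Lemma Ep_chi r th : Ep (chi r) th = Pr r.
Proof. by apply: cexp_indep => s v; rewrite /chi lr_num_tupd lr_den_tupd. Qed.

Lemma Em_chi r th : Em (chi r) th = Qr r.
Proof. by apply: cexp_indep => s v; rewrite /chi lr_num_tupd lr_den_tupd. Qed.

Let dpg := dplus_ge0. Let dmg := dminus_ge0.
Let mdp := measurable_dplus. Let mdm := measurable_dminus.

Lemma Ep_01 x th : test x -> 0 <= Ep x th <= 1.
Proof. by move=> tx; rewrite cexp_ge0// cexp_le1. Qed.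

Lemma Em_01 x th : test x -> 0 <= Em x th <= 1.
Proof. by move=> tx; rewrite cexp_ge0// cexp_le1. Qed.

(** On the support, acceptance means (1 - r) [lr_den] <= r [lr_num] <= 0, so [lr_den] = 0; for r < 0
    also [lr_num] = 0, and for r = 0 the gain r [Pr r] vanishes by itself. *)
Lemma first_best_le0 r : r <= 0 -> V r = 0.
Proof.
move=> r0.
have z1 : Em (chi r) 0 = 0.
  apply: cexp_eq0 => //; first exact: is_test_chi.
  move=> s _ _; rewrite density_minus /chi.
  have [->|[p0 m0]] := density_factor_cases s; first by rewrite !mulr0.
  have [h|h] := leP ((1 - r) * lr_den s) (r * lr_num s); last by rewrite mul0r.
  suff -> : lr_den s = 0 by rewrite mul0r mulr0.
  have : r * lr_num s <= 0 by rewrite mulr_le0_ge0.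
  nra.
rewrite /first_best /Qr z1 mulr0 subr0.
have [->|rN] := eqVneq r 0; first by rewrite mul0r.
suff -> : Pr r = 0 by rewrite mulr0.
apply: cexp_eq0 => //; first exact: is_test_chi.
move=> s _ _; rewrite density_plus /chi.
have [->|[p0 m0]] := density_factor_cases s; first by rewrite !mulr0.
have [h|h] := leP ((1 - r) * lr_den s) (r * lr_num s); last by rewrite mul0r.
have rlt : r < 0 by rewrite lt_neqAle rN.
suff -> : lr_num s = 0 by rewrite mul0r mulr0.
have : 0 <= (1 - r) * lr_den s by rewrite mulr_ge0//; lra.
nra.
Qed.

Lemma first_best_ge1 r : 1 <= r -> V r = 2 * r - 1.
Proof.
move=> r1; rewrite /first_best.
have H d : (forall s, others_density R n i d s = lr_num s * density_factor s \/
                      others_density R n i d s = lr_den s * density_factor s) ->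
  (forall t, 0 <= d t) -> measurable_fun setT d ->
  (\int[mu]_(t in `[a, b]) (d t)%:E = 1)%E ->
  cexp R n a b i d (chi r) 0 = 1.
  move=> dE d0 md d1; rewrite -(cexp_cst1 R n a b i d d0 md d1 0).
  apply: cexp_eq => //; first exact: is_test_chi.
    by apply: is_test_cst; rewrite lexx ler01.
  move=> s _ _; have [K0|[p0 m0]] := density_factor_cases s.
    by case: (dE s) => ->; rewrite K0 !mulr0.
  rewrite /chi (_ : _ <= _ = true)//; apply: (@le_trans _ _ 0).
    by rewrite mulr_le0_ge0// subr_le0.
  by rewrite mulr_ge0//; lra.
rewrite /Pr /Qr !H//; first ring.
- by move=> s; right; exact: density_minus.
- by move=> s; left; exact: density_plus.
Qed.

(** The Neyman-Pearson argument inside ]0, 1[; elsewhere the bounds 0 and 1 on acceptance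
    probabilities suffice. *)
Lemma first_best_opt x r th : test x -> r * Ep x th - (1 - r) * Em x th <= V r.
Proof.
move=> tx.
have /andP[p0 p1] := Ep_01 x th tx; have /andP[q0 q1] := Em_01 x th tx.
have [r0|r0] := leP r 0; first by rewrite first_best_le0//; nra.
have [r1|r1] := leP 1 r; first by rewrite first_best_ge1//; nra.
rewrite /first_best -(Ep_chi r th) -(Em_chi r th).
have tc := is_test_chi r.
have r0' : 0 <= r by lra.
have r1' : 0 <= 1 - r by lra.
(* The negative terms change sides so that every iterated integral has a nonnegative integrand. *)
suff : r * Ep x th + (1 - r) * Em (chi r) th <= r * Ep (chi r) th + (1 - r) * Em x th by lra.
have cg y (d : R -> R) : test y -> (forall t, 0 <= d t) -> measurable_fun setT d ->
   forall c, 0 <= c -> (forall s, (0 <= c%:E * (y s * others_density R n i d s)%:E)%E) /\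
   measurable_fun setT (fun s => c%:E * (y s * others_density R n i d s)%:E)%E.
  move=> ty d0 md c c0; split; first by move=> s; rewrite mule_ge0// test_density_ge0.
  by apply: measurable_funeM; exact: measurable_test_density.
rewrite -lee_fin !EFinD !EFinM -!cexpEE// /cexpE -!iintZ//;
  try (by move=> s; exact: test_density_ge0); try exact: measurable_test_density.
have [g1 m1] := cg x fp tx dpg mdp r r0'.
have [g2 m2] := cg (chi r) fm tc dmg mdm (1 - r) r1'.
have [g3 m3] := cg (chi r) fp tc dpg mdp r r0'.
have [g4 m4] := cg x fm tx dmg mdm (1 - r) r1'.
rewrite -!iintD//; apply: le_iint.
- by move=> s; rewrite adde_ge0.
- by move=> s; rewrite adde_ge0.
- exact: emeasurable_funD.
- exact: emeasurable_funD.
move=> s; rewrite -!EFinM -!EFinD lee_fin density_plus density_minus.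
have K0 := density_factor_ge0 s; have := tx.2 s => /andP[x0 x1].
rewrite -subr_ge0.
(* [chi r s] - x s never has the sign opposite to r [lr_num] - (1 - r) [lr_den]. *)
rewrite [leRHS](_ : _ = density_factor s * ((chi r s - x s) * (r * lr_num s - (1 - r) * lr_den s))); last ring.
rewrite mulr_ge0// /chi; case: (leP ((1 - r) * lr_den s) (r * lr_num s)) => h /=; nra.
Qed.

(** Type t may use the test meant for r, whose gain is affine in t; so V is a supremum of lines. *)
Lemma first_best_line r t : V r + (Pr r + Qr r) * (t - r) <= V t.
Proof.
have := first_best_opt (chi r) t 0 (is_test_chi r).
rewrite -/(Pr r) -/(Qr r) /first_best; lra.
Qed.

Lemma first_best_convex : convex3 R V.
Proof.
apply: subgradient_convex3 => r; exists (Pr r + Qr r) => t; exact: first_best_line.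
Qed.

Lemma first_best_ge0 r : 0 <= V r.
Proof.
have t0 : test (cst 0) by apply: is_test_cst; rewrite lexx ler01.
have := first_best_opt _ r 0 t0.
by rewrite !cexp_eq0 ?mulr0 ?subr0// => s _ _; rewrite mul0r.
Qed.

Lemma first_best_ge_linear r : 2 * r - 1 <= V r.
Proof.
have t1 : test (cst 1) by apply: is_test_cst; rewrite lexx ler01.
have := first_best_opt _ r 0 t1; rewrite !cexp_cst1//; lra.
Qed.

Lemma cexp_chi' (d : R -> R) r : (forall t, 0 <= d t) -> measurable_fun setT d ->
  (\int[mu]_(t in `[a, b]) (d t)%:E = 1)%E -> 0 <= r <= 1 ->
  cexp R n a b i d (chi' r) 0 = cexp R n a b i d (chi r) 0.
Proof.
move=> d0 md d1 /andP[r0 r1].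
apply: (cexp_eq_off_hyperplane _ _ _ _ _ _ _ _ _ _ _ _ (1 - r) r) => //.
- exact: is_test_chi'.
- exact: is_test_chi.
- by rewrite subr_ge0.
- lra.
- by move=> s; rewrite /chi /chi'; case: ltgtP => //=; rewrite ?ler01.
- by move=> s; rewrite -/(lr_den s) -/(lr_num s) /chi /chi' => /eqP; case: ltgtP.
Qed.

Lemma chi_homo_density (d : R -> R) r t s : (forall s, others_density R n i d s = lr_num s * density_factor s \/
      others_density R n i d s = lr_den s * density_factor s) -> r <= t ->
  chi r s * others_density R n i d s <= chi t s * others_density R n i d s.
Proof.
move=> dE rt; have [K0|[p0 m0]] := density_factor_cases s.
  by case: (dE s) => ->; rewrite K0 !mulr0.
have D0 : 0 <= others_density R n i d s.
  by case: (dE s) => ->; rewrite mulr_ge0// density_factor_ge0.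
rewrite ler_wpM2r// /chi ler_nat.
case: (leP ((1 - r) * lr_den s) (r * lr_num s)) => //= h.
by rewrite lt0b; nra.
Qed.

Section one_density.
Variable d : R -> R.
Hypothesis d0 : forall t, 0 <= d t.
Hypothesis md : measurable_fun setT d.
Hypothesis d1 : (\int[mu]_(t in `[a, b]) (d t)%:E = 1)%E.
Hypothesis dE : forall s, others_density R n i d s = lr_num s * density_factor s \/
                      others_density R n i d s = lr_den s * density_factor s.
Local Notation D := (others_density R n i d).
Local Notation E := (cexp R n a b i d).

(** These tests decrease with k wherever the density is positive, so monotone convergence is applied
    to their complements. *)
Lemma cvg_chi_right r : E (chi (r + k.+1%:R^-1)) 0 @[k --> \oo] --> E (chi r) 0.
Proof.
have h0 k : 0 < k.+1%:R^-1 :> R by rewrite invr_gt0.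
pose y t := fun s => 1 - chi t s.
have ty t : test (y t) by apply: is_test_onem; exact: is_test_chi.
have yE t : E (chi t) 0 = 1 - E (y t) 0.
  by rewrite cexp_onem//; [lra|exact: is_test_chi].
rewrite yE; under eq_fun do rewrite yE.
apply: cvgB; first exact: cvg_cst.
apply: (cvg_cexp R n a b i d d0 md d1 (fun k => y (r + k.+1%:R^-1))) => //.
- move=> s k l kl; rewrite /y !mulrBl lerD2l lerN2.
  apply: chi_homo_density => //; rewrite lerD2l lef_pV2 ?posrE//.
  by rewrite ler_nat ltnS.
- move=> s; rewrite /y; under eq_fun do rewrite mulrBl.
  rewrite mulrBl; apply: cvgB; first exact: cvg_cst.
  have [K0|[p0 m0]] := density_factor_cases s.
    have -> : D s = 0 by case: (dE s) => ->; rewrite K0 mulr0.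
    by under eq_fun do rewrite mulr0; rewrite mulr0; exact: cvg_cst.
  apply: cvgMl; rewrite /chi.
  have [h|h] := leP ((1 - r) * lr_den s) (r * lr_num s).
    rewrite (_ : (fun k => _) = fun=> 1); first exact: cvg_cst.
    apply/funext => k; rewrite (_ : _ <= _ = true)//.
    by have := h0 k; set e := _^-1; nra.
  pose g := (1 - r) * lr_den s - r * lr_num s.
  have g0 : 0 < g by rewrite subr_gt0.
  have gS : 0 < g / (lr_den s + lr_num s + 1) by rewrite divr_gt0//; lra.
  apply: cvg_near_cst; near=> k.
  have : k.+1%:R^-1 < (PosNum gS)%:num by near: k; exact: near_infty_natSinv_lt.
  rewrite /= ltr_pdivlMr; last lra.
  have := h0 k; set e := _^-1 => e0 he.
  rewrite leNgt (_ : _ < _ = true)//; rewrite /g in he; nra.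
Unshelve. all: by end_near.
Qed.

(** The limit from below is the strict test: at a tie every smaller parameter rejects, unless both
    products vanish and with them the density. *)
Lemma cvg_chi_left r : E (chi (r - k.+1%:R^-1)) 0 @[k --> \oo] --> E (chi' r) 0.
Proof.
have h0 k : 0 < k.+1%:R^-1 :> R by rewrite invr_gt0.
apply: (cvg_cexp R n a b i d d0 md d1 (fun k => chi (r - k.+1%:R^-1))) => //.
- by move=> k; exact: is_test_chi.
- exact: is_test_chi'.
- move=> s k l kl.
  apply: chi_homo_density => //; rewrite lerD2l lerN2 lef_pV2 ?posrE//.
  by rewrite ler_nat ltnS.
- move=> s.
  have [K0|[p0 m0]] := density_factor_cases s.
    have -> : D s = 0 by case: (dE s) => ->; rewrite K0 mulr0.
    by under eq_fun do rewrite mulr0; rewrite mulr0; exact: cvg_cst.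
  have [S0|SN] := eqVneq (lr_den s + lr_num s) 0.
    have -> : D s = 0.
      have [e1 e2] : lr_num s = 0 /\ lr_den s = 0 by split; lra.
      by case: (dE s) => ->; rewrite ?e1 ?e2 mul0r.
    by under eq_fun do rewrite mulr0; rewrite mulr0; exact: cvg_cst.
  have S0 : 0 < lr_den s + lr_num s by rewrite lt_neqAle eq_sym SN addr_ge0.
  apply: cvgMl; rewrite /chi /chi'.
  have [h|h] := ltP ((1 - r) * lr_den s) (r * lr_num s); last first.
    rewrite (_ : (fun k => _) = fun=> 0); first exact: cvg_cst.
    apply/funext => k; rewrite leNgt (_ : _ < _ = true)//.
    have := h0 k; set e := _^-1 => e0.
    have : 0 < e * (lr_den s + lr_num s) by rewrite mulr_gt0.
    nra.
  pose g := r * lr_num s - (1 - r) * lr_den s.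
  have g0 : 0 < g by rewrite subr_gt0.
  have gS : 0 < g / (lr_den s + lr_num s) by rewrite divr_gt0.
  apply: cvg_near_cst; near=> k.
  have : k.+1%:R^-1 < (PosNum gS)%:num by near: k; exact: near_infty_natSinv_lt.
  rewrite /= ltr_pdivlMr//.
  have := h0 k; set e := _^-1 => e0 he.
  rewrite (_ : _ <= _ = true)//; rewrite /g in he; nra.
Unshelve. all: by end_near.
Qed.

End one_density.

(* V is differentiable on [0, 1] because the hyperplanes {LR = const} are null,
   so a line below V touching it is its tangent. *)
Lemma touching_line p q r : 0 <= r <= 1 ->
  (forall t, t * p - (1 - t) * q <= V t) -> r * p - (1 - r) * q = V r ->
  p = Pr r /\ q = Qr r.
Proof.
move=> r01 H Hr.
have h0 k : 0 < k.+1%:R^-1 :> R by rewrite invr_gt0.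
(* The slope p + q of the line is squeezed between the slopes of V at r - e and r + e, which both
   tend to that at r; slope and value at r then determine p and q. *)
have up k : p + q <= Pr (r + k.+1%:R^-1) + Qr (r + k.+1%:R^-1).
  have := h0 k; set e := _^-1 => e0.
  have h1 := first_best_line (r + e) r; have h2 := H (r + e).
  by rewrite -(ler_pM2r e0); lra.
have lo k : Pr (r - k.+1%:R^-1) + Qr (r - k.+1%:R^-1) <= p + q.
  have := h0 k; set e := _^-1 => e0.
  have h1 := first_best_line (r - e) r; have h2 := H (r - e).
  by rewrite -(ler_pM2r e0); lra.
have dEp s : others_density R n i fp s = lr_num s * density_factor s \/
    others_density R n i fp s = lr_den s * density_factor s by left; exact: density_plus.
have dEm s : others_density R n i fm s = lr_num s * density_factor s \/
    others_density R n i fm s = lr_den s * density_factor s by right; exact: density_minus.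
have pq : p + q = Pr r + Qr r.
  apply/eqP; rewrite eq_le; apply/andP; split.
    apply: (@cvgr_to_ge _ (nbhs \oo) _ _ _ _ _
      (cvgD (cvg_chi_right fp dpg mdp fp_int dEp r)
            (cvg_chi_right fm dmg mdm fm_int dEm r))).
    by apply: nearW => k; exact: up.
  rewrite /Pr /Qr -(cexp_chi' fp)// -(cexp_chi' fm)//.
  apply: (@cvgr_to_le _ (nbhs \oo) _ _ _ _ _
    (cvgD (cvg_chi_left fp dpg mdp fp_int dEp r)
          (cvg_chi_left fm dmg mdm fm_int dEm r))).
  by apply: nearW => k; exact: lo.
by move: Hr; rewrite /first_best; split; nra.
Qed.

End threshold_tests.

(** * Mechanisms and indirect utilities *)

Section mechanisms.
Context (R : realType) (n : nat) (a b : R) (i : 'I_n) (f : R -> R).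
Local Notation mu := (@lebesgue_measure R).
Local Notation prof := (n.-tuple R).
Hypothesis n2 : (2 <= n)%N.
Hypothesis a0 : 0 <= a.
Hypothesis b1 : b <= 1.
Hypothesis f_ge0 : forall t, 0 <= f t.
Hypothesis measurable_f : measurable_fun setT f.
Hypothesis f_out : forall t, ~ Icc a b t -> f t = 0.
Local Notation fp := (dplus f).
Local Notation fm := (dminus f).
Hypothesis f_integrable : mu.-integrable `[a, b] (EFin \o f).
Hypothesis fp_int : (\int[mu]_(t in `[a, b]) (fp t)%:E = 1)%E.
Hypothesis fm_int : (\int[mu]_(t in `[a, b]) (fm t)%:E = 1)%E.
Local Notation test := (is_test R n).
Local Notation Ep := (cexp R n a b i fp).
Local Notation Em := (cexp R n a b i fm).
Local Notation V := (first_best R n a b i f).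
Local Notation K := (between R V).
Local Notation J := (objective R a b f).
Local Notation lr_num := (lr_num R n i).
Local Notation lr_den := (lr_den R n i).
Local Notation density_factor := (density_factor R n i f).
Implicit Types (x y : prof -> R) (s : prof) (r t th : R).

Let dpg := dplus_ge0 R a b f a0 f_ge0 f_out.
Let dmg := dminus_ge0 R a b f b1 f_ge0 f_out.
Let mdp := measurable_dplus R f measurable_f.
Let mdm := measurable_dminus R f measurable_f.

Let V0 r : r <= 0 -> V r = 0.
Proof. exact: first_best_le0. Qed.
Let V1 r : 1 <= r -> V r = 2 * r - 1.
Proof. exact: first_best_ge1. Qed.
Let cV : convex3 R V.
Proof. exact: first_best_convex. Qed.
Let Vge0 r : 0 <= V r.
Proof. exact: first_best_ge0. Qed.
Let Vge1 r : 2 * r - 1 <= V r.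
Proof. exact: first_best_ge_linear. Qed.
Let opt x r th : test x -> r * Ep x th - (1 - r) * Em x th <= V r.
Proof. exact: first_best_opt. Qed.
Let touch p q r : 0 <= r <= 1 ->
  (forall t, t * p - (1 - t) * q <= V t) -> r * p - (1 - r) * q = V r ->
  p = Pr R n a b i f r /\ q = Qr R n a b i f r.
Proof. exact: touching_line. Qed.

Definition scaled_threshold (kappa tau : R) s : R := kappa * (tau * lr_den s <= lr_num s)%R%:R.

Lemma is_test_scaled_threshold kappa tau : 0 <= kappa <= 1 ->
  test (scaled_threshold kappa tau).
Proof.
move=> /andP[k0 k1].
have [mt t01] : test (fun s => (tau * lr_den s <= lr_num s)%R%:R).
  apply: is_test_indicator; apply: measurable_fun_ler; last exact: measurable_lr_num.
  by apply: measurable_funM => //; exact: measurable_lr_den.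
split; first exact: measurable_funM.
by move=> s; have /andP[h1 h2] := t01 s; rewrite /scaled_threshold mulr_ge0//= mulr_ile1.
Qed.

Definition represents (p q kappa tau : R) :=
  [/\ 0 <= kappa <= 1, 0 <= tau,
   (forall th, Ep (scaled_threshold kappa tau) th = p) &
   (forall th, Em (scaled_threshold kappa tau) th = q)].

Lemma scaled_thresholdE kappa tau : scaled_threshold kappa tau =
  fun s => kappa * scaled_threshold 1 tau s.
Proof. by apply/funext => s; rewrite /scaled_threshold mul1r. Qed.

Lemma represents_scale (p q kappa tau : R) : 0 <= kappa <= 1 -> represents p q 1 tau ->
  represents (kappa * p) (kappa * q) kappa tau.
Proof.
move=> k01 [h01 t0 hp hq]; have tt := is_test_scaled_threshold 1 tau h01.
by split => // th; rewrite scaled_thresholdE cexpZ// ?hp ?hq.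
Qed.

Lemma represents_chi r : 0 < r <= 1 ->
  represents (Pr R n a b i f r) (Qr R n a b i f r) 1 ((1 - r) / r).
Proof.
move=> /andP[r0 r1].
have E : scaled_threshold 1 ((1 - r) / r) = chi R n i r.
  apply/funext => s; rewrite /scaled_threshold /chi mul1r mulrAC ler_pdivrMr//.
  by rewrite [lr_num s * r]mulrC.
split; first by rewrite ler01 lexx.
- by rewrite divr_ge0//; lra.
- by move=> th; rewrite E; exact: Ep_chi.
- by move=> th; rewrite E; exact: Em_chi.
Qed.

Lemma represents_full : represents 1 1 1 0.
Proof.
have h : 0 <= (1 : R) <= 1 by rewrite ler01 lexx.
have t1 : test (cst 1) by exact: is_test_cst.
have tt : test (scaled_threshold 1 0) by exact: is_test_scaled_threshold.
split => // th.
- transitivity (Ep (cst 1) th); last exact: cexp_cst1.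
  apply: cexp_eq => // s _ _; rewrite density_plus.
  have [->|[p0 m0]] := density_factor_cases R n a b i f a0 b1 f_out s; first by rewrite !mulr0.
  by rewrite /scaled_threshold mul0r p0 mulr1.
- transitivity (Em (cst 1) th); last exact: cexp_cst1.
  apply: cexp_eq => // s _ _; rewrite density_minus.
  have [->|[p0 m0]] := density_factor_cases R n a b i f a0 b1 f_out s; first by rewrite !mulr0.
  by rewrite /scaled_threshold mul0r p0 mulr1.
Qed.

(** At r = 0 the cutoff (1 - r) / r would be infinite. The zero line also touches V there, so
    uniqueness of the touching line gives the pair (0, 0), served by kappa = 0. *)
Lemma touching_at0 p q : (forall t, t * p - (1 - t) * q <= V t) ->
  0 * p - (1 - 0) * q = V 0 -> p = 0 /\ q = 0.
Proof.
move=> H H0; have r01 : 0 <= (0 : R) <= 1 by rewrite ler01 lexx.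
have [-> ->] := touch p q 0 r01 H H0.
have [<- <-] := touch 0 0 0 r01 (fun t => ltac:(by rewrite !mulr0 subr0)) ltac:(by rewrite V0 ?lexx// !mulr0 subr0).
by [].
Qed.

Lemma line_bounds p q : (forall t, t * p - (1 - t) * q <= V t) -> 0 <= q /\ p <= 1.
Proof.
move=> H; have := H 0; have := H 1; rewrite V1// V0//; lra.
Qed.

Lemma touching_represents p q r : 0 <= r <= 1 ->
  (forall t, t * p - (1 - t) * q <= V t) -> r * p - (1 - r) * q = V r ->
  exists kappa tau, represents p q kappa tau /\ (kappa = 0 \/ kappa = 1).
Proof.
move=> r01 H Hr; have /andP[r0 r1] := r01.
have [re0|rN] := eqVneq r 0.
  rewrite re0 in Hr; have [-> ->] := touching_at0 _ _ H Hr.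
  exists 0, 0; split; last by left.
  rewrite -[X in represents X](mul0r 1) -[X in represents _ X](mul0r 1).
  by apply: represents_scale; [rewrite lexx ler01|exact: represents_full].
have [-> ->] := touch p q r r01 H Hr.
exists 1, ((1 - r) / r); split; last by right.
by apply: represents_chi; rewrite lt_neqAle eq_sym rN r0.
Qed.

(* The largest multiple of the line that stays below V touches V, and the
   factor by which the line was scaled up becomes 1 / kappa. *)
Lemma line_represents p q : (forall t, t * p - (1 - t) * q <= V t) -> q <= p ->
  exists kappa tau, represents p q kappa tau.
Proof.
move=> H qp; have [q0 p1] := line_bounds _ _ H.
have [pq|pNq] := eqVneq p q.
  exists p, 0; rewrite -{1}(mulr1 p) -pq -{2}(mulr1 p).
  by apply: represents_scale; [rewrite p1 andbT; exact: le_trans q0 qp|exact: represents_full].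
have qltp : q < p by rewrite lt_neqAle eq_sym pNq.
have p_gt0 : 0 < p by exact: le_lt_trans q0 qltp.
pose L t := t * p - (1 - t) * q.
(* L (1 / 2) = (p - q) / 2 is positive, which bounds the admissible scalings. *)
have Lhalf : 0 < L (1 / 2) by rewrite /L; lra.
pose A := [set l : R | 1 <= l /\ forall t, 0 <= t <= 1 -> l * L t <= V t].
have A1 : A 1 by split => // t _; rewrite mul1r; exact: H.
have hA : has_sup A.
  split; first by exists 1.
  exists (V (1 / 2) / L (1 / 2)) => l [_ /(_ (1 / 2) ltac:(lra)) h].
  by rewrite ler_pdivlMr.
set l := sup A.
have l1 : 1 <= l by apply: ub_le_sup => //; exact: hA.2.
have lA t : 0 <= t <= 1 -> l * L t <= V t.
  move=> t01; have [Lt|Lt] := leP (L t) 0.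
    by apply: le_trans (Vge0 t); nra.
  rewrite -ler_pdivlMr//; apply: ge_sup; first by exists 1.
  by move=> l' [_ /(_ t t01)]; rewrite ler_pdivlMr.
have lp : l * p <= 1.
  have := lA 1; rewrite V1// /L; lra.
have lV t : t * (l * p) - (1 - t) * (l * q) <= V t.
  have E : t * (l * p) - (1 - t) * (l * q) = l * L t by rewrite /L; ring.
  have [t0|t0] := leP t 0.
    rewrite V0// E mulr_ge0_le0//; first lra.
    have h1 : t * p <= 0 by rewrite mulr_le0_ge0// ltW.
    have h2 : 0 <= (1 - t) * q by rewrite mulr_ge0//; lra.
    rewrite /L; lra.
  have [t1|t1] := leP 1 t; last by rewrite E; apply: lA; lra.
  rewrite V1//; have lq : l * q <= 1.
    by apply: le_trans lp; rewrite ler_wpM2l//; lra.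
  have := ler_wpM2l (_ : 0 <= t) lp => /(_ ltac:(lra)).
  have := ler_wpM2l (_ : 0 <= t - 1) lq => /(_ ltac:(lra)).
  lra.
have [r r01 Hr] : exists2 r, 0 <= r <= 1 & l * L r = V r.
  apply: contrapT => noR.
  have [|tm] := @EVT_min R (fun t => V t - l * L t) 0 1 ler01.
    apply: continuous_subspaceT => t; apply: cvgB.
      exact: (between_continuous R V V0 V1 V (between_refl R V cV Vge0 Vge1)).
    apply: cvgMr; rewrite /L; apply: cvgB; apply: cvgMl; first exact: cvg_id.
    by apply: cvgB; [exact: cvg_cst|exact: cvg_id].
  rewrite in_itv/= => tmI tmP.
  (* If V - l L were at least d > 0 on [0, 1], then l + d would be admissible too, since L <= 1
     there. *)
  set d := V tm - l * L tm in tmP.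
  have d0 : 0 < d.
    rewrite subr_gt0 lt_neqAle lA// andbT; apply/eqP => h; apply: noR.
    by exists tm.
  have : A (l + d).
    split; first lra.
    move=> t t01; have := tmP t; rewrite in_itv/= => /(_ t01).
    have : L t <= 1 by rewrite /L; case/andP: t01 => t0 t1; nra.
    nra.
  by move=> /(ub_le_sup hA.2); rewrite -/l; lra.
have Hr' : r * (l * p) - (1 - r) * (l * q) = V r by rewrite -Hr /L; ring.
have [rz|rN] := eqVneq r 0.
  rewrite rz in Hr'; have [lp0 _] := touching_at0 _ _ lV Hr'; nra.
have [ep eq] := touch _ _ _ r01 lV Hr'.
have l0 : 0 < l by lra.
exists l^-1, ((1 - r) / r).
have -> : p = l^-1 * (l * p) by rewrite mulKf// gt_eqF.
have -> : q = l^-1 * (l * q) by rewrite mulKf// gt_eqF.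
rewrite ep eq; apply: represents_scale.
  by rewrite invr_ge0 (ltW l0)/= invf_le1.
by apply: represents_chi; case/andP: r01 => r0 r1; rewrite lt_neqAle eq_sym rN r0.
Qed.

Lemma interimE x t th : test x ->
  interim a b f i x t th = (t * Ep x th - (1 - t) * Em x th)%:E.
Proof.
move=> tx; rewrite EFinB !EFinM -(cexpEE R n a b i fp)// -(cexpEE R n a b i fm)//.
Qed.

Lemma exanteE x : test x ->
  exante a b f x = (wint R a b f (fun t => t * Ep x t + (1 - t) * Em x t))%:E.
Proof.
move=> tx.
have mEp : measurable_fun setT (Ep x) by exact: measurable_cexp.
have mEm : measurable_fun setT (Em x) by exact: measurable_cexp.
have tbd t : a <= t <= b -> 0 <= t <= 1.
  by have h0 := a0; have h1 := b1; lra.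
pose phi t := t * Ep x t; pose psi t := (1 - t) * Em x t.
have mphi : measurable_fun setT phi by exact: measurable_funM.
have mpsi : measurable_fun setT psi.
  by apply: measurable_funM => //; exact: measurable_funB.
have bphi t : a <= t <= b -> `|phi t| <= 1.
  move=> /tbd /andP[t0 t1]; have h0 : 0 <= Ep x t by exact: cexp_ge0.
  have h1 : Ep x t <= 1 by exact: cexp_le1.
  by rewrite ger0_norm ?mulr_ge0// mulr_ile1.
have bpsi t : a <= t <= b -> `|psi t| <= 1.
  move=> /tbd /andP[t0 t1]; have h0 : 0 <= Em x t by exact: cexp_ge0.
  have h1 : Em x t <= 1 by exact: cexp_le1.
  by rewrite ger0_norm ?mulr_ge0// ?mulr_ile1//; lra.
rewrite (wintD _ _ _ _ f_integrable _ _ 1 mphi mpsi bphi bpsi) EFinD.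
have EW (ph : R -> R) : measurable_fun setT ph -> (forall t, a <= t <= b -> `|ph t| <= 1) ->
    ((2^-1)%:E * \int[mu]_(t in `[a, b]) (2 * (f t * ph t))%:E = (wint R a b f ph)%:E)%E.
  move=> mph bph; have ig := wint_integrable R a b f f_integrable ph 1 mph bph.
  under eq_integral do rewrite EFinM.
  rewrite integralZl//; rewrite muleA -EFinM mulVf// mul1e /wint /Rintegral fineK//.
  exact: integrable_fin_num.
rewrite /exante; congr (_ + _)%E.
  rewrite (iint_enum R n a b i fp dpg mdp fp_int x tx) -EW//; congr (_ * _)%E.
  by apply: eq_integral => t _; rewrite /phi /dplus; congr (_%:E); ring.
rewrite (iint_enum R n a b i fm dmg mdm fm_int x tx) -EW//; congr (_ * _)%E.
by apply: eq_integral => t _; rewrite /psi /dminus; congr (_%:E); ring.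
Qed.

(* Offering the options "never" and "always" in addition keeps the indirect
   utility feasible and can only raise the allocation probability. *)
Lemma feasible_exante_le y : feasible a b f i y ->
  exists2 u, K u & (exante a b f y <= (J u)%:E)%E.
Proof.
move=> [my y01 yP yIC].
have ty : test y by split.
pose G := [set pq : R * R | [\/ pq = (0, 0), pq = (1, 1) |
  exists2 th, Icc a b th & pq = (Ep y th, Em y th)]].
pose ell (pq : R * R) t := t * pq.1 - (1 - t) * pq.2.
have ellV pq t : G pq -> ell pq t <= V t.
  move=> [->|->|[th _ ->]]; rewrite /ell/=; last exact: opt.
    by rewrite !mulr0 subr0.
  by have := Vge1 t; lra.
pose u t := sup [set ell pq t | pq in G].
have G0 : G (0, 0) by apply: Or31.
have G1 : G (1, 1) by apply: Or32.
have hs t : has_sup [set ell pq t | pq in G].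
  split; first by exists (ell (0, 0) t), (0, 0).
  by exists (V t) => _ [pq Gpq <-]; exact: ellV.
have uge pq t : G pq -> ell pq t <= u t.
  by move=> Gpq; apply: ub_le_sup; [exact: (hs t).2|exists pq].
have ule t c : (forall pq, G pq -> ell pq t <= c) -> u t <= c.
  by move=> H; apply: ge_sup; [exact: (hs t).1|move=> _ [pq Gpq <-]; exact: H].
have Ku : K u.
  split.
  - move=> x1 x2 x3 x12 x23; have [x13|x13] := leP x3 x1.
      have -> : x3 - x1 = 0 by lra.
      have -> : x3 - x2 = 0 by lra.
      have -> : x2 - x1 = 0 by lra.
      by rewrite !mul0r addr0.
    have x0 : 0 < x3 - x1 by lra.
    rewrite mulrC -ler_pdivlMr//; apply: ule => pq Gpq; rewrite ler_pdivlMr//.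
    have := ler_wpM2l (_ : 0 <= x3 - x2) (uge pq x1 Gpq).
    have := ler_wpM2l (_ : 0 <= x2 - x1) (uge pq x3 Gpq).
    move=> /(_ ltac:(lra)) h1 /(_ ltac:(lra)) h2.
    apply: le_trans (lerD h2 h1); rewrite /ell; lra.
  - by move=> t; have := uge _ t G0; rewrite /ell/= !mulr0 subr0.
  - by move=> t; have := uge _ t G1; rewrite /ell/=; lra.
  - by move=> t; apply: ule => pq; exact: ellV.
exists u => //; rewrite exanteE// lee_fin.
have mEp : measurable_fun setT (Ep y) by exact: measurable_cexp.
have mEm : measurable_fun setT (Em y) by exact: measurable_cexp.
have fg t : a <= t <= b -> 0 <= f t by [].
have tbd t : a <= t <= b -> 0 <= t <= 1.
  by have h0 := a0; have h1 := b1; lra.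
have Epb t : 0 <= Ep y t <= 1 by exact: Ep_01.
have Emb t : 0 <= Em y t <= 1 by exact: Em_01.
apply: (le_wint R a b f fg f_integrable _ _ 2).
- apply: measurable_funD; apply: measurable_funM => //.
  exact: measurable_funB.
- exact: (measurable_objective R V V0 V1 _ Ku).
- move=> t /tbd /andP[t0 t1]; have /andP[h1 h2] := Epb t; have /andP[h3 h4] := Emb t.
  by rewrite ger0_norm; nra.
- move=> t tab; exact: (objective_bound R V V0 V1 a b a0 b1 u Ku t tab).
move=> t tab; have /andP[t0 t1] := tbd t tab.
have It : Icc a b t by rewrite /Icc/= in_itv.
set p := Ep y t; set q := Em y t.
have Gt : G (p, q) by apply: Or33; exists t.
have cu : convex3 R u by case: Ku.
(* If type t's own option is at least as good as always accepting, (P) and (IC) make it best on the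
   enlarged menu; so p + q is a subgradient, and [alloc] at this slope is t p + (1 - t) q. *)
have [h|h] := leP (2 * t - 1) (ell (p, q) t).
  have ut : u t = ell (p, q) t.
    apply/eqP; rewrite eq_le uge// andbT; apply: ule => pq [->|->|[th Ith ->]].
    - have := yP t It; rewrite interimE// lee_fin /ell/= !mulr0 subr0.
      exact.
    - by move: h; rewrite /ell/=; lra.
    - by have := yIC t th It Ith; rewrite !interimE// lee_fin.
  have sg : subgradient R u t (p + q).
    by move=> s; apply: le_trans (uge _ s Gt); rewrite ut /ell/=; lra.
  apply: le_trans (alloc_homo R a b a0 b1 _ _ _ _ tab (subgradient_le_rderiv R u cu _ _ sg)).
  by rewrite ut /alloc /ell/= le_eqVlt; apply/orP; left; apply/eqP; ring.
(* Otherwise always accepting is best: slope 2 is a subgradient and the acceptance probability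
   becomes 1. *)
have ut : u t = 2 * t - 1.
  apply/eqP; rewrite eq_le; apply/andP; split; last first.
    by have := uge _ t G1; rewrite /ell/=; lra.
  apply: ule => pq [->|->|[th Ith ->]].
  - have := yP t It; rewrite interimE// lee_fin -/p -/q.
    by move: h; rewrite /ell/=; lra.
  - by rewrite /ell/=; lra.
  - have := yIC t th It Ith; rewrite !interimE// lee_fin -/p -/q.
    by move: h; rewrite /ell/=; lra.
have sg : subgradient R u t 2.
  by move=> s; apply: le_trans (uge _ s G1); rewrite ut /ell/=; lra.
apply: le_trans (alloc_homo R a b a0 b1 _ _ _ _ tab (subgradient_le_rderiv R u cu _ _ sg)).
rewrite ut /alloc; have /andP[h1 h2] := Epb t; have /andP[h3 h4] := Emb t.
rewrite -/p -/q in h1 h2 h3 h4; nra.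
Qed.

Lemma exists_optimal_utility :
  exists2 u, extreme_between R V u & forall v, K v -> J v <= J u.
Proof.
have fg t : a <= t <= b -> 0 <= f t by [].
apply: (exists_extreme_max R V V0 V1 cV Vge0 Vge1 J (sqint R)
  (2 * \int[mu]_(t in `[a, b]) f t) 1).
- by move=> u Ku; exact: (objective_le R V V0 V1 a b f a0 b1 fg f_integrable u Ku).
- exact: (objective_usc R V V0 V1 a b f a0 b1 fg f_integrable).
- by move=> u Ku; exact: (sqint_le1 R V V0 V1 u Ku).
- exact: (sqint_usc R V V0 V1).
- move=> u v w Ku Kv Kw.
  exact: (objective_average R V V0 V1 a b f a0 b1 fg f_integrable u v w Ku Kv Kw).
- move=> u v w Ku Kv Kw; exact: (sqint_average R V V0 V1 u v w Ku Kv Kw).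
Qed.

End mechanisms.

(** * Cells of an extreme utility *)

Section cells.
Context (R : realType).
Variables (V u : R -> R).
Hypothesis V0 : forall t, t <= 0 -> V t = 0.
Hypothesis V1 : forall t, 1 <= t -> V t = 2 * t - 1.
Hypothesis cV : convex3 R V.
Hypothesis V_ge0 : forall t, 0 <= V t.
Hypothesis V_ge1 : forall t, 2 * t - 1 <= V t.
Hypothesis eu : extreme_between R V u.
Local Notation g := (rderiv R u).
Implicit Types (s t r z : R).

Let Ku : between R V u. Proof. exact: eu.1. Qed.
Let cu : convex3 R u. Proof. by case: Ku. Qed.
Let KV : between R V V. Proof. exact: between_refl. Qed.
Let u_le_V t : u t <= V t. Proof. by case: Ku. Qed.
Let gap_lipschitz s t : s <= t -> V s - u s - 2 * (t - s) <= V t - u t /\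
  V t - u t - 2 * (t - s) <= V s - u s.
Proof.
move=> st; have := between_lipschitz R V V0 V1 u s t Ku st.
by have := between_lipschitz R V V0 V1 V s t KV st; lra.
Qed.

(** Membership in the same component of {u < V}; both orders are allowed so that the relation is
    symmetric. *)
Definition gap_on s t := forall r, (s <= r <= t) || (t <= r <= s) -> u r < V r.

Lemma gap_onC s t : gap_on s t -> gap_on t s.
Proof. by move=> H r; rewrite orbC; exact: H. Qed.

Lemma gap_onP s t : s <= t -> gap_on s t <-> (forall r, s <= r <= t -> u r < V r).
Proof.
move=> st; split=> H r; first by move=> rI; apply: H; rewrite rI.
by move=> /orP[|/andP[tr rs]]; [exact: H|apply: H; lra].
Qed.

Lemma gap_on_trans s t r : gap_on s t -> gap_on t r -> gap_on s r.
Proof.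
move=> H1 H2 z /orP[]/andP[h1 h2]; have [zt|/ltW tz] := leP z t.
- by apply: H1; rewrite h1 zt.
- by apply: H2; rewrite tz h2.
- by apply: H2; rewrite h1 zt orbT.
- by apply: H1; rewrite tz h2 orbT.
Qed.

Lemma gap_on_sub s t r : s <= t -> gap_on s t -> s <= r <= t -> gap_on s r /\ gap_on r t.
Proof.
move=> st /(gap_onP _ _ st) H /andP[sr rt]; split; apply/gap_onP => // z zI; apply: H; lra.
Qed.

Lemma gap_on_refl t : u t < V t -> gap_on t t.
Proof.
by move=> h; apply/gap_onP => // r rt; have -> : r = t by lra.
Qed.

Lemma rderiv_eq_line s t : g s = g t -> u t = u s + g s * (t - s).
Proof.
move=> e; have := rderiv_subgradient R u cu s t; have := rderiv_subgradient R u cu t s.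
rewrite -e; lra.
Qed.

Lemma no_four_slopes t1 t2 t3 t4 : t1 <= t4 -> gap_on t1 t4 ->
  t1 < t2 -> t2 < t3 -> t3 < t4 ->
  g t1 < g t2 -> g t2 < g t3 -> g t3 < g t4 -> False.
Proof.
move=> t14 /(gap_onP _ _ t14) H t12 t23 t34.
exact: (extreme_four_slopes R V V0 V1 cV V_ge0 V_ge1 u t1 t2 t3 t4 eu t12 t23 t34).
Qed.

Lemma gap_right t b : t < b -> u t < V t -> exists2 T, t < T <= b & gap_on t T.
Proof.
move=> tb ut; pose d := V t - u t; have d0 : 0 < d by rewrite subr_gt0.
(* V - u falls at a rate of at most 2, so over a length d / 4 it keeps at least d / 2. *)
exists (Num.min b (t + d / 4)).
  by rewrite lt_min tb ge_min lexx; rewrite ltrDl divr_gt0.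
apply/gap_onP; first by rewrite le_min (ltW tb) lerDl divr_ge0// ltW.
move=> r /andP[tr]; rewrite le_min => /andP[_ rd].
have [h _] := gap_lipschitz t r tr.
by rewrite -subr_gt0; rewrite -/d in h; lra.
Qed.

(** If slopes grew strictly right after t, right continuity would produce points t < s1 < s2 < T
    with four different slopes. Hence a piece of constant slope extends to the right of each of its
    points below b. *)
Lemma rderiv_right_constant t b : t < b -> u t < V t ->
  exists2 T, t < T <= b & gap_on t T /\ g T = g t.
Proof.
move=> tb ut; have [T /andP[tT Tb] H] := gap_right t b tb ut.
apply: contrapT => no.
have lt_g s : t < s -> s <= T -> g t < g s.
  move=> ts sT; rewrite lt_neqAle rderiv_homo ?(ltW ts)// andbT; apply/eqP => e.
  apply: no; exists s; first by rewrite ts/=; lra.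
  by split => //; apply: (gap_on_sub t T s (ltW tT) H _).1; lra.
have step s : t < s -> s <= T -> exists2 s', t < s' < s & g s' < g s.
  move=> ts sT; have gts := lt_g s ts sT.
  have [s' ts' gs'] := rderiv_right_continuous R u cu t (g s - g t) ltac:(lra).
  have gs's : g s' < g s by lra.
  exists s' => //; rewrite ts' /= ltNge; apply/negP => ss'.
  have := rderiv_homo R u cu s s' ss'; lra.
have [s2 /andP[ts2 s2T] g2] := step T tT (lexx _).
have [s1 /andP[ts1 s12] g1] := step s2 ts2 (ltW s2T).
apply: (no_four_slopes t s1 s2 T) => //; first exact: ltW.
by apply: lt_g => //; lra.
Qed.

(* At the left end of a component of {u < V} the utility u meets V; if no slope
   is smaller than g s there, the supporting line at s passes through that point. *)
Lemma left_touch s : u s < V s ->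
  (exists2 r, r < s & gap_on r s /\ g r < g s) \/
  (exists2 r, 0 <= r <= 1 & u s + g s * (r - s) = V r).
Proof.
move=> us; have [ex|nex] := pselect (exists2 r, r < s & gap_on r s /\ g r < g s).
  by left.
right; have /andP[s0 s1] := between_lt01 R V V0 V1 u s Ku us.
pose A := [set r | r <= s /\ gap_on r s].
have As : A s by split => //; exact: gap_on_refl.
have A0 r : A r -> 0 <= r.
  move=> [rs H]; rewrite leNgt; apply/negP => r0.
  have := (gap_onP _ _ rs).1 H r; rewrite lexx rs => /(_ isT).
  by rewrite V0 ?(between_le0 R V V0 u r Ku) ?ltxx//; exact: ltW.
have hA : has_inf A by split; [exists s|exists 0 => r /A0].
have Ag r : A r -> g r = g s.
  move=> [rs H]; move: rs; rewrite le_eqVlt => /predU1P[->//|rs].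
  apply/eqP; rewrite eq_le rderiv_homo ?(ltW rs)//= leNgt; apply/negP => h.
  by apply: nex; exists r.
set al := inf A.
have al0 : 0 <= al by apply: (lb_le_inf hA.1) => r; exact: A0.
have als : al <= s by apply: ge_inf => //; exact: hA.2.
exists al; first by rewrite al0/=; lra.
have ual : V al <= u al.
  rewrite leNgt; apply/negP => h.
  (* A gap d at the infimum would persist down to al - d / 8, since V - u changes at a rate of at
     most 2. *)
  pose d := V al - u al; have d0 : 0 < d by rewrite subr_gt0.
  have d4 : 0 < d / 4 by lra.
  have [r Ar rd] := inf_adherent d4 hA.
  rewrite -/al in rd.
  have alr : al <= r by apply: ge_inf => //; exact: hA.2.
  have [rs Hr] := Ar.
  have : A (al - d / 8).
    split; first lra.
    apply/gap_onP; first lra.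
    move=> z /andP[z1 z2]; have [zr|rz] := leP z r; last first.
      by apply: (gap_onP _ _ rs).1 => //; lra.
    have [zal|alz] := leP z al.
      by have := gap_lipschitz z al zal; rewrite -/d; lra.
    by have := gap_lipschitz al z (ltW alz); rewrite -/d; lra.
  by move=> /(ge_inf hA.2); rewrite -/al; lra.
have E : u al = V al by apply/eqP; rewrite eq_le u_le_V.
rewrite -E; apply/eqP; rewrite eq_le (rderiv_subgradient R u cu s al)/=.
apply/ler_addgt0Pr => e e0.
(* The infimum itself is a contact point outside A; u agrees with the line at members r close to it,
   and the Lipschitz bound carries this over. *)
have e4 : 0 < e / 4 by lra.
have [r Ar rd] := inf_adherent e4 hA.
rewrite -/al in rd.
have alr : al <= r by apply: ge_inf => //; exact: hA.2.
have er := rderiv_eq_line s r (esym (Ag r Ar)).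
have /andP[h1 h2] := between_lipschitz R V V0 V1 u al r Ku alr.
have /andP[g0 g2] := between_rderiv R V V0 V1 u s Ku.
have : g s * (r - al) <= 2 * (r - al) by rewrite ler_wpM2r//; lra.
lra.
Qed.

(** Mirror image of [left_touch], at the right end of the component. *)
Lemma right_touch s : u s < V s ->
  (exists2 r, s < r & gap_on s r /\ g s < g r) \/
  (exists2 r, 0 <= r <= 1 & u s + g s * (r - s) = V r).
Proof.
move=> us; have [ex|nex] := pselect (exists2 r, s < r & gap_on s r /\ g s < g r).
  by left.
right; have /andP[s0 s1] := between_lt01 R V V0 V1 u s Ku us.
pose A := [set r | s <= r /\ gap_on s r].
have As : A s by split => //; exact: gap_on_refl.
have A1 r : A r -> r <= 1.
  move=> [sr H]; rewrite leNgt; apply/negP => r1.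
  have := (gap_onP _ _ sr).1 H r; rewrite lexx sr => /(_ isT).
  by rewrite V1 ?(between_ge1 R V V1 u r Ku) ?ltxx//; exact: ltW.
have hA : has_sup A by split; [exists s|exists 1 => r /A1].
have Ag r : A r -> g s = g r.
  move=> [sr H]; move: sr; rewrite le_eqVlt => /predU1P[->//|sr].
  apply/eqP; rewrite eq_le rderiv_homo ?(ltW sr)//= leNgt; apply/negP => h.
  by apply: nex; exists r.
set al := sup A.
have al1 : al <= 1 by apply: (ge_sup hA.1) => r; exact: A1.
have sal : s <= al by apply: ub_le_sup => //; exact: hA.2.
exists al; first by rewrite al1 andbT; lra.
have ual : V al <= u al.
  rewrite leNgt; apply/negP => h.
  pose d := V al - u al; have d0 : 0 < d by rewrite subr_gt0.
  have d4 : 0 < d / 4 by lra.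
  have [r Ar rd] := sup_adherent d4 hA.
  rewrite -/al in rd.
  have ral : r <= al by apply: ub_le_sup => //; exact: hA.2.
  have [sr Hr] := Ar.
  have : A (al + d / 8).
    split; first lra.
    apply/gap_onP; first lra.
    move=> z /andP[z1 z2]; have [zr|rz] := leP z r.
      by apply: (gap_onP _ _ sr).1 => //; lra.
    have [zal|alz] := leP z al.
      by have := gap_lipschitz z al zal; rewrite -/d; lra.
    by have := gap_lipschitz al z (ltW alz); rewrite -/d; lra.
  by move=> /(ub_le_sup hA.2); rewrite -/al; lra.
have E : u al = V al by apply/eqP; rewrite eq_le u_le_V.
rewrite -E; apply/eqP; rewrite eq_le (rderiv_subgradient R u cu s al)/=.
apply/ler_addgt0Pr => e e0.
have e4 : 0 < e / 4 by lra.
have [r Ar rd] := sup_adherent e4 hA.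
rewrite -/al in rd.
have ral : r <= al by apply: ub_le_sup => //; exact: hA.2.
have er := rderiv_eq_line s r (Ag r Ar).
have /andP[h1 h2] := between_lipschitz R V V0 V1 u r al Ku ral.
have /andP[g0 g2] := between_rderiv R V V0 V1 u s Ku.
have : 0 <= g s * (al - r) by rewrite mulr_ge0//; lra.
lra.
Qed.

(** If neither line touched V, there would be a smaller slope to the left of s and a larger one to
    the right of t, four in one component. *)
Lemma adjacent_slopes_touch s t : s < t -> gap_on s t -> g s < g t ->
  (exists2 r, 0 <= r <= 1 & u s + g s * (r - s) = V r) \/
  (exists2 r, 0 <= r <= 1 & u t + g t * (r - t) = V r).
Proof.
move=> st H gst; have Hst := (gap_onP _ _ (ltW st)).1 H.
have [[r rs [Hr gr]]|] := left_touch s (Hst s ltac:(lra)); last by left.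
have [[z tz [Hz gz]]|] := right_touch t (Hst t ltac:(lra)); last by right.
exfalso; apply: (no_four_slopes r s t z) => //; first lra.
exact: gap_on_trans (gap_on_trans _ _ _ Hr H) Hz.
Qed.

Variables (a b : R).

(** The stretch around t, inside its component of {u < V}, on which u follows one line, cut down to
    [a, b]. *)
Definition cell t := [set s | [/\ a <= s <= b, gap_on t s & g s = g t]].

Lemma cell_refl t : a <= t <= b -> u t < V t -> cell t t.
Proof. by move=> tab ut; split => //; exact: gap_on_refl. Qed.

Lemma cell_eq s t : cell t s -> cell s = cell t.
Proof.
move=> [_ Hts gst]; apply/seteqP; split => r [rab H gr]; split => //.
- exact: gap_on_trans Hts H.
- by rewrite gr.
- exact: gap_on_trans (gap_onC _ _ Hts) H.
- by rewrite gr.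
Qed.

Lemma cell_gap s t : cell t s -> u s < V s.
Proof. by move=> [_ H _]; apply: H; rewrite lexx andbT /=; case: leP => // /ltW. Qed.

Lemma is_interval_cell t : is_interval (cell t).
Proof.
move=> x y [xab Hx gx] [yab Hy gy] z /andP[xz zy]; split; first lra.
  have Hxy : gap_on x y by exact: gap_on_trans (gap_onC _ _ Hx) Hy.
  have Hxz : gap_on x z by apply: (gap_on_sub x y z _ Hxy _).1; lra.
  exact: gap_on_trans Hx Hxz.
have h1 := rderiv_homo R u cu x z xz; have h2 := rderiv_homo R u cu z y zy.
apply/eqP; rewrite eq_le; lra.
Qed.

(** A cell extends to the right of each of its points below b and so contains a rational; the cell
    reduced to the point b may contain none. *)
Lemma cell_rat t : a <= t <= b -> u t < V t ->
  cell t b \/ exists q : rat, cell t (ratr q).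
Proof.
move=> tab ut; have [tb|bt] := ltP t b; last first.
  left; have -> : b = t by lra.
  exact: cell_refl.
have [T /andP[tT Tb] [H gT]] := rderiv_right_constant t b tb ut.
have [q] := rat_in_itvoo tT.
rewrite in_itv/= => /andP[tq qT]; right; exists q.
apply: (is_interval_cell t t T) => //.
- exact: cell_refl.
- by split => //; lra.
- by rewrite (ltW tq) (ltW qT).
Qed.

(** Indexes the cells by rationals, [None] standing for b; the condition on c discards centres that
    do not lie in their own cell. *)
Definition rcell (o : option rat) : set R :=
  let c := if o is Some q then ratr q else b in
  [set s | cell c s /\ cell c c].

Lemma rcell_cover t : a <= t <= b -> u t < V t -> exists o, cell t = rcell o.
Proof.
move=> tab ut; have [cb|[q cq]] := cell_rat t tab ut.
  exists None; rewrite /rcell -(cell_eq _ _ cb); apply/seteqP; split => s; last by case.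
  by move=> cs; split => //; rewrite (cell_eq _ _ cb).
exists (Some q); rewrite /rcell -(cell_eq _ _ cq); apply/seteqP; split => s; last by case.
by move=> cs; split => //; rewrite (cell_eq _ _ cq).
Qed.

Lemma measurable_rcell o : measurable (rcell o).
Proof.
rewrite /rcell; set c := (X in cell X).
have [cc|ncc] := pselect (cell c c).
  rewrite (_ : [set s | _] = cell c).
    by apply: is_interval_measurable; exact: is_interval_cell.
  by apply/seteqP; split => s; [case|].
rewrite (_ : [set s | _] = set0) //.
by apply/seteqP; split => s // [].
Qed.

(** There are countably many cells, each an interval, so h is measurable however its values were
    chosen. This serves thresholds obtained by the axiom of choice. *)
Lemma measurable_cellwise (h : R -> R) : (forall s t, cell t t -> cell t s -> h s = h t) ->
  (forall t, ~ (a <= t <= b /\ u t < V t) -> h t = 0) -> measurable_fun setT h.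
Proof.
move=> hc h0.
have [dec decK] : exists dec : nat -> option (option rat), forall q, dec (pickle q) = Some q.
  by exists unpickle => q; exact: pickleK.
pose E k : set R := if k is k'.+1 then
    if dec k' is Some o then rcell o else set0
  else [set t | ~ (a <= t <= b /\ u t < V t)].
have mgap : measurable [set t | a <= t <= b /\ u t < V t].
  have -> : [set t | a <= t <= b /\ u t < V t] =
     [set` `[a, b]] `&` ((fun t => u t < V t) @^-1` [set true]).
    by apply/seteqP; split => t; rewrite /= in_itv.
  apply: measurableI => //.
  have c (w : R -> R) : between R V w -> measurable_fun setT w.
    by move=> Kw; apply: continuous_measurable_fun; exact: (between_continuous R V V0 V1 w Kw).
  have := measurable_fun_ltr (c u Ku) (c V KV).
  by move=> /(_ measurableT [set true] ltac:(by [])); rewrite setTI.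
have mE k : measurable (E k).
  case: k => [|k] /=; first exact: measurableC.
  by case: (dec k) => [q|]; [exact: measurable_rcell|exact: measurable0].
have ET : \bigcup_k E k = setT.
  apply/seteqP; split => // t _.
  have [[tab ut]|ng] := pselect (a <= t <= b /\ u t < V t); last by exists 0%N.
  have [q e] := rcell_cover t tab ut.
  by exists (pickle q).+1 => //=; rewrite decK -e; exact: cell_refl.
rewrite -ET; apply/(measurable_fun_bigcup _ mE) => k.
have [c Hc] : exists c, forall t, E k t -> h t = c.
  case: k => [|k] /=; first by exists 0 => t; exact: h0.
  case: (dec k) => [q|]; last by exists 0.
  by exists (h (if q is Some r then ratr r else b)) => t [ct cc]; exact: hc.
apply: (eq_measurable_fun (cst c)) => //.
by move=> t; rewrite inE => /Hc ->.
Qed.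

End cells.

(** * The optimal mechanism *)

Section optimal_mechanism.
Context (R : realType) (n : nat) (a b : R) (i : 'I_n) (f : R -> R).
Local Notation mu := (@lebesgue_measure R).
Local Notation prof := (n.-tuple R).
Hypothesis n2 : (2 <= n)%N.
Hypothesis a0 : 0 <= a.
Hypothesis b1 : b <= 1.
Hypothesis f_ge0 : forall t, 0 <= f t.
Hypothesis measurable_f : measurable_fun setT f.
Hypothesis f_out : forall t, ~ Icc a b t -> f t = 0.
Local Notation fp := (dplus f).
Local Notation fm := (dminus f).
Hypothesis f_integrable : mu.-integrable `[a, b] (EFin \o f).
Hypothesis fp_int : (\int[mu]_(t in `[a, b]) (fp t)%:E = 1)%E.
Hypothesis fm_int : (\int[mu]_(t in `[a, b]) (fm t)%:E = 1)%E.
Local Notation test := (is_test R n).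
Local Notation Ep := (cexp R n a b i fp).
Local Notation Em := (cexp R n a b i fm).
Local Notation V := (first_best R n a b i f).
Local Notation K := (between R V).
Local Notation J := (objective R a b f).
Local Notation lr_num := (lr_num R n i).
Local Notation lr_den := (lr_den R n i).
Local Notation represents := (represents R n a b i f).
Implicit Types (x y : prof -> R) (s : prof) (r t th : R).

Let dpg := dplus_ge0 R a b f a0 f_ge0 f_out.
Let dmg := dminus_ge0 R a b f b1 f_ge0 f_out.
Let mdp := measurable_dplus R f measurable_f.
Let mdm := measurable_dminus R f measurable_f.

Let V0 r : r <= 0 -> V r = 0.
Proof. exact: first_best_le0. Qed.
Let V1 r : 1 <= r -> V r = 2 * r - 1.
Proof. exact: first_best_ge1. Qed.
Let cV : convex3 R V.
Proof. exact: first_best_convex. Qed.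
Let Vge0 r : 0 <= V r.
Proof. exact: first_best_ge0. Qed.
Let Vge1 r : 2 * r - 1 <= V r.
Proof. exact: first_best_ge_linear. Qed.
Let touch p q r : 0 <= r <= 1 ->
  (forall t, t * p - (1 - t) * q <= V t) -> r * p - (1 - r) * q = V r ->
  p = Pr R n a b i f r /\ q = Qr R n a b i f r.
Proof. exact: touching_line. Qed.

(** The line m t + l is t p - (1 - t) q with p = m + l and q = - l. The hypotheses sit inside the
    predicate so that every pair has some threshold and choice yields a total function. *)
Definition good_threshold (ml kt : R * R) :=
  (forall t, ml.1 * t + ml.2 <= V t) -> - ml.2 <= ml.1 + ml.2 ->
  represents (ml.1 + ml.2) (- ml.2) kt.1 kt.2 /\
  ((exists2 r, 0 <= r <= 1 & ml.1 * r + ml.2 = V r) -> kt.1 = 0 \/ kt.1 = 1).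

Lemma exists_good_threshold ml : exists kt, good_threshold ml kt.
Proof.
case: ml => m l.
have lineE t : t * (m + l) - (1 - t) * (- l) = m * t + l by ring.
have [H|nH] := pselect ((forall t, m * t + l <= V t) /\ - l <= m + l); last first.
  by exists (0, 0) => H1 H2; case: nH.
have [H1 H2] := H.
have H1' t : t * (m + l) - (1 - t) * (- l) <= V t by rewrite lineE.
have [[r r01 Hr]|no] := pselect (exists2 r, 0 <= r <= 1 & m * r + l = V r).
  have Hr' : r * (m + l) - (1 - r) * (- l) = V r by rewrite lineE.
  have [k [tau [rep k01]]] := touching_represents R n a b i f n2 a0 b1 f_ge0
    measurable_f f_out fp_int fm_int _ _ r r01 H1' Hr'.
  by exists (k, tau).
have [k [tau rep]] := line_represents R n a b i f n2 a0 b1 f_ge0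
    measurable_f f_out fp_int fm_int _ _ H1' H2.
by exists (k, tau).
Qed.

Variable u : R -> R.
Hypothesis eu : extreme_between R V u.
Hypothesis umax : forall v, K v -> J v <= J u.
Variable kt : R * R -> R * R.
Hypothesis ktP : forall ml, good_threshold ml (kt ml).

Local Notation g := (rderiv R u).
Local Notation cell := (cell R V u a b).
Let Ku : K u. Proof. exact: eu.1. Qed.
Let cu : convex3 R u. Proof. by case: Ku. Qed.

Definition gapb t := (a <= t <= b) && (u t < V t).
Definition line t := (g t, u t - g t * t).
(** Chosen as a function of the line and not of the type, hence constant on each cell; the default 0
    off the gap is what [measurable_cellwise] asks for. *)
Definition kap t := if gapb t then (kt (line t)).1 else 0.
Definition tau t := if gapb t then (kt (line t)).2 else 0.
Definition mech s : R :=
  if gapb (tnth s i) then scaled_threshold R n i (kap (tnth s i)) (tau (tnth s i)) s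
  else (lr_all_ge1 s)%:R.

Lemma line_le t r : (line t).1 * r + (line t).2 <= V r.
Proof.
have [_ _ _ uV] := Ku; apply: le_trans (uV r).
have := rderiv_subgradient R u cu t r; rewrite /line/=; lra.
Qed.

(** q <= p says that the supporting line is nonnegative at 1/2: left of 1/2 because u and its slope
    are nonnegative, right of 1/2 because u >= 2 t - 1 and its slope is at most 2. *)
Lemma line_qp t : - (line t).2 <= (line t).1 + (line t).2.
Proof.
have /andP[g0 g2] := between_rderiv R V V0 V1 u t Ku.
have [_ u0 u1 _] := Ku; have := u0 t; have := u1 t; rewrite /line/=.
have [h|h] := leP (2 * t - 1) 0; nra.
Qed.

Lemma kt_represents t :
  represents ((line t).1 + (line t).2) (- (line t).2) (kt (line t)).1 (kt (line t)).2.
Proof. exact: (ktP (line t) (line_le t) (line_qp t)).1. Qed.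

Lemma kap01 t : 0 <= kap t <= 1.
Proof.
rewrite /kap; case: ifP => _; last by rewrite lexx ler01.
by case: (kt_represents t).
Qed.

Lemma line_cell t r : cell t r -> line r = line t.
Proof.
move=> [_ _ e]; rewrite /line e; congr (_, _).
by have := rderiv_eq_line R V u eu t r (esym e); lra.
Qed.

Lemma gapb_cell t r : cell t r -> gapb r.
Proof.
by move=> ctr; rewrite /gapb (cell_gap _ _ _ _ _ _ _ ctr) andbT; case: ctr.
Qed.

Lemma kap_cell t r : cell t t -> cell t r -> kap r = kap t.
Proof.
move=> ctt ctr; rewrite /kap (gapb_cell _ _ ctt) (gapb_cell _ _ ctr).
by rewrite (line_cell _ _ ctr).
Qed.

Lemma tau_cell t r : cell t t -> cell t r -> tau r = tau t.
Proof.
move=> ctt ctr; rewrite /tau (gapb_cell _ _ ctt) (gapb_cell _ _ ctr).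
by rewrite (line_cell _ _ ctr).
Qed.

Let cellwise := measurable_cellwise R V u V0 V1 cV Vge0 Vge1 eu a b.

Lemma measurable_kap : measurable_fun setT kap.
Proof.
apply: cellwise => [r t|t nt]; first exact: kap_cell.
by rewrite /kap ifF//; apply/negbTE/negP => /andP[h1 h2]; exact: nt.
Qed.

Lemma measurable_tau : measurable_fun setT tau.
Proof.
apply: cellwise => [r t|t nt]; first exact: tau_cell.
by rewrite /tau ifF//; apply/negbTE/negP => /andP[h1 h2]; exact: nt.
Qed.

Lemma measurable_gapb : measurable_fun setT (fun t => (gapb t)%:R : R).
Proof.
apply: cellwise => [r t ctt ctr|t nt].
  by rewrite (gapb_cell _ _ ctt) (gapb_cell _ _ ctr).
by rewrite (_ : gapb t = false)//; apply/negbTE/negP => /andP[h1 h2]; exact: nt.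
Qed.

Lemma lr_all_chi s : (lr_all_ge1 s)%:R = chi R n i (tnth s i) s.
Proof.
by rewrite /lr_all_ge1 /chi (bigD1 i)//= [X in _ <= X](bigD1 i).
Qed.

Lemma is_test_lr_all : test (fun s => (lr_all_ge1 s)%:R).
Proof.
apply: is_test_indicator; apply: measurable_fun_ler; apply: measurable_prod => k _.
  apply: measurable_funB => //; exact: measurable_tnth.
exact: measurable_tnth.
Qed.

Lemma is_test_mech : test mech.
Proof.
have mi : measurable_fun setT (fun s : prof => tnth s i) by exact: measurable_tnth.
have [ml l01] := is_test_lr_all.
split; last first.
  move=> s; rewrite /mech; case: ifP => _ //.
  by have [_] := is_test_scaled_threshold R n i _ (tau (tnth s i)) (kap01 (tnth s i)).
have -> : mech = fun s => kap (tnth s i) * (tau (tnth s i) * lr_den s <= lr_num s)%R%:R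
    + (1 - (gapb (tnth s i))%:R) * (lr_all_ge1 s)%:R.
  apply/funext => s; rewrite /mech /scaled_threshold /kap.
  case: (gapb (tnth s i)) => /=; first by rewrite subrr mul0r addr0.
  by rewrite mul0r add0r subr0 mul1r.
apply: measurable_funD; apply: measurable_funM => //.
- exact: (measurableT_comp measurable_kap mi).
- apply: (is_test_indicator R n _ _).1; apply: measurable_fun_ler.
    apply: measurable_funM; last exact: measurable_lr_den.
    exact: (measurableT_comp measurable_tau mi).
  exact: measurable_lr_num.
- by apply: measurable_funB => //; exact: (measurableT_comp measurable_gapb mi).
Qed.

(** In the gap the chosen threshold represents the supporting line by construction. At a contact
    point that line touches V, so [touching_line] identifies it with the first-best test of type
    th. *)
Lemma cexp_mech th : a <= th <= b ->
  Ep mech th = g th + (u th - g th * th) /\ Em mech th = - (u th - g th * th).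
Proof.
move=> thab; have tm := is_test_mech.
have [ut|uV] := ltP (u th) (V th).
  have gth : gapb th by rewrite /gapb thab ut.
  have [_ _ hp hq] := kt_represents th.
  have tk := is_test_scaled_threshold R n i _ (tau th) (kap01 th).
  rewrite -[g th + _](hp th) -[- _](hq th).
  have ek : kap th = (kt (line th)).1 by rewrite /kap gth.
  have et : tau th = (kt (line th)).2 by rewrite /tau gth.
  by rewrite -ek -et; split; apply: cexp_eq => // s sth _; rewrite /mech sth gth.
have uE : u th = V th.
  by apply/eqP; rewrite eq_le uV andbT; case: Ku.
have tc : test (chi R n i th) by exact: is_test_chi.
have th01 : 0 <= th <= 1 by have h1 := a0; have h2 := b1; lra.
have [-> ->] : g th + (u th - g th * th) = Pr R n a b i f th /\
    - (u th - g th * th) = Qr R n a b i f th.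
  apply: touch => //; last by rewrite -uE; ring.
  by move=> t; have := line_le th t; rewrite /line/=; lra.
rewrite -(Ep_chi R n a b i f th th) -(Em_chi R n a b i f th th).
by split; apply: cexp_eq => // s sth _; rewrite /mech sth /gapb thab ltNge uV /= lr_all_chi sth.
Qed.

Lemma mech_feasible : feasible a b f i mech.
Proof.
have tm := is_test_mech.
have IccE t : Icc a b t -> a <= t <= b by rewrite /Icc/= in_itv.
(* Reporting th yields the supporting line of u at th, evaluated at t; (IC) becomes the subgradient
   inequality. *)
have intE t th : Icc a b th ->
    interim a b f i mech t th = (u th + g th * (t - th))%:E.
  move=> /IccE /cexp_mech[ep em]; rewrite interimE// ep em; congr (_%:E); ring.
split; [exact: tm.1|exact: tm.2|move=> t It|move=> t th It Ith].
  by rewrite intE// lee_fin subrr mulr0 addr0; case: Ku.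
by rewrite !intE// lee_fin subrr mulr0 addr0; exact: rderiv_subgradient.
Qed.

Lemma exante_mech : exante a b f mech = (J u)%:E.
Proof.
rewrite (exanteE R n a b i f)//; last exact: is_test_mech.
congr (_%:E); apply: eq_Rintegral => t; rewrite inE/= in_itv/= => /cexp_mech[-> ->].
by rewrite /alloc; ring.
Qed.

Lemma mech_optimal : optimal a b f i mech.
Proof.
split; first exact: mech_feasible.
move=> y fy; rewrite exante_mech.
have [v Kv] := feasible_exante_le R n a b i f a0 b1 f_ge0 measurable_f f_out
  f_integrable fp_int fm_int y fy.
by move=> /le_trans; apply; rewrite lee_fin; exact: umax.
Qed.

Definition piece t : set R := if u t < V t then cell t else [set t].
Definition pieces : set (set R) := [set S | exists2 t, Icc a b t & S = piece t].
Definition gap_pieces : set (set R) :=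
  [set S | exists2 t, gapb t & S = cell t].

Lemma gapb_self t : gapb t -> cell t t.
Proof. by move=> /andP[tab ut]; exact: cell_refl. Qed.

Lemma piece_gap t : gapb t -> piece t = cell t.
Proof. by move=> /andP[_ ut]; rewrite /piece ut. Qed.

Lemma gap_pieces_sub : gap_pieces `<=` pieces.
Proof.
move=> S [t gt ->]; exists t; last by rewrite piece_gap.
by case/andP: gt => + _; rewrite /Icc/= in_itv.
Qed.

Lemma countable_gap_pieces : countable gap_pieces.
Proof.
apply: (@sub_countable _ _ _ (rcell R V u a b @` setT)).
  apply: subset_card_le => S [t /andP[tab ut] ->].
  have [q e] := rcell_cover R V u V0 V1 cV Vge0 Vge1 eu a b t tab ut.
  by exists q.
exact: (sub_countable (card_image_le _ _) (countableP _)).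
Qed.

Lemma piece_interval t : Icc a b t -> [/\ piece t !=set0, is_interval (piece t) &
  piece t `<=` Icc a b].
Proof.
move=> It; have tab : a <= t <= b by move: It; rewrite /Icc/= in_itv.
rewrite /piece; case: ifP => ut; split.
- by exists t; exact: cell_refl.
- exact: is_interval_cell.
- by move=> r [rab _ _]; rewrite /Icc/= in_itv.
- by exists t.
- by move=> x y -> -> z /andP[h1 h2] /=; apply/eqP; rewrite eq_le h2 h1.
- by move=> r ->.
Qed.

Lemma interval_partition_pieces : interval_partition a b pieces.
Proof.
split.
- by move=> S [t It ->]; exact: piece_interval.
- move=> S T [s Is ->] [t It ->] [r []]; rewrite /piece.
  case: ifP => us; case: ifP => ut.
  + by move=> csr ctr; rewrite -(cell_eq _ _ _ _ _ _ _ csr) -(cell_eq _ _ _ _ _ _ _ ctr).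
  + by move=> csr rt; move: (cell_gap _ _ _ _ _ _ _ csr); rewrite rt ut.
  + by move=> rs ctr; move: (cell_gap _ _ _ _ _ _ _ ctr); rewrite rs us.
  + by move=> -> ->.
- move=> t It; exists (piece t); first by exists t.
  have tab : a <= t <= b by move: It; rewrite /Icc/= in_itv.
  by rewrite /piece; case: ifP => ut //; exact: cell_refl.
Qed.

Lemma mech_on_cell t s : gapb t -> cell t (tnth s i) ->
  mech s = kap t * (lr_others_ge i s (tau t))%:R.
Proof.
move=> gt cts; rewrite /mech (gapb_cell _ _ cts).
by rewrite (kap_cell _ _ (gapb_self _ gt) cts) (tau_cell _ _ (gapb_self _ gt) cts).
Qed.

Lemma mech_on_contact t s : ~~ (u t < V t) -> tnth s i = t ->
  mech s = (lr_all_ge1 s)%:R.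
Proof. by move=> ut st; rewrite /mech /gapb st (negbTE ut) andbF. Qed.

Lemma tau_ge0 t : 0 <= tau t.
Proof. by rewrite /tau; case: ifP => // _; case: (kt_represents t). Qed.

Lemma threshold_on_cell (Ks : set R) t : gapb t -> Ks (kap t) ->
  threshold_on a b Ks i mech (cell t).
Proof.
move=> gt Kt; exists (kap t) => //; left; exists (tau t); first exact: tau_ge0.
by move=> s _; exact: mech_on_cell.
Qed.

Lemma mech_monotone_threshold : monotone_threshold a b i mech pieces.
Proof.
split; first exact: interval_partition_pieces.
move=> S [t It ->]; have tab : a <= t <= b by move: It; rewrite /Icc/= in_itv.
have [gt|ngt] := boolP (gapb t).
  rewrite piece_gap//; apply: threshold_on_cell => //.
  by rewrite /Icc/= in_itv; exact: kap01.
have ut : ~~ (u t < V t) by move: ngt; rewrite /gapb tab.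
rewrite /piece (negbTE ut); exists 1; first by rewrite /Icc/= in_itv/= ler01 lexx.
right; split; first by exists t.
by move=> s _ st; rewrite mul1r; exact: mech_on_contact ut st.
Qed.

Lemma mech_off_gap S : pieces S -> ~ gap_pieces S ->
  forall s, insupp a b s -> S (tnth s i) -> mech s = (lr_all_ge1 s)%:R.
Proof.
move=> [t It ->] ng s _; have tab : a <= t <= b by move: It; rewrite /Icc/= in_itv.
have [gt|ngt] := boolP (gapb t).
  by exfalso; apply: ng; exists t => //; exact: piece_gap.
have ut : ~~ (u t < V t) by move: ngt; rewrite /gapb tab.
by rewrite /piece (negbTE ut) => st; exact: mech_on_contact ut st.
Qed.

Lemma touching_deterministic t : gapb t ->
  (exists2 r, 0 <= r <= 1 & u t + g t * (r - t) = V r) ->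
  deterministic_on a b i mech (cell t).
Proof.
move=> gt [r r01 Hr]; apply: threshold_on_cell => //.
rewrite /kap gt; apply: (ktP (line t) (line_le t) (line_qp t)).2.
by exists r => //; rewrite -Hr /line/=; ring.
Qed.

Lemma adjacent_deterministic S T : gap_pieces S -> gap_pieces T ->
  adjacent_cells S T -> deterministic_on a b i mech S \/ deterministic_on a b i mech T.
Proof.
move=> [s gs ->] [t gt ->] [].
wlog st : s t gs gt / s <= t.
  move=> W ne itv; have [st|/ltW ts] := leP s t; first exact: W.
  by apply/or_comm; apply: W => //; [exact/nesym|rewrite setUC].
move=> ne itv; have css := gapb_self _ gs; have ctt := gapb_self _ gt.
(* The union of adjacent cells is an interval, so no contact point separates s from t; two different
   cells of one component must then have different slopes. *)
have H : gap_on R V u s t.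
  apply/gap_onP => // r rI.
  have [c|c] : (cell s `|` cell t) r by apply: (itv s t) => //; [left|right].
    exact: cell_gap c.
  exact: cell_gap c.
have gst : g s != g t.
  apply/eqP => e; apply: ne; apply/esym; apply: cell_eq.
  by split => //; case/andP: gt.
have lt : s < t by rewrite lt_neqAle st andbT; apply: contraNneq gst => ->.
have glt : g s < g t by rewrite lt_neqAle gst rderiv_homo.
by have [] := adjacent_slopes_touch R V u V0 V1 cV Vge0 Vge1 eu s t lt H glt;
  [left|right]; exact: touching_deterministic.
Qed.

End optimal_mechanism.

Theorem theoremA1 (R : realType) (n : nat) (a b : R) (f f' : R -> R) :
  (2 <= n)%N ->
  0 <= a -> a < b -> b <= 1 ->
  (* f is the density of F = (F_{-1}+F_{+1})/2, with support [a,b] *)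
  (forall t, Icc a b t -> 0 < f t) ->
  (forall t, ~ Icc a b t -> f t = 0) ->
  (\int[@lebesgue_measure R]_(t in `[a, b]) (f t)%:E = 1)%E ->
  (* F_{+1}, with density 2 t f(t), is a probability measure *)
  (\int[@lebesgue_measure R]_(t in `[a, b]) (2 * t * f t)%:E = 1)%E ->
  (* f is C^1 on its support, with |f'/f| bounded *)
  {within Icc a b, continuous f} ->
  {within Icc a b, continuous f'} ->
  (forall t, `]a, b[%classic t -> is_derive t 1 f (f' t)) ->
  (exists M : R, forall t, Icc a b t -> `|f' t / f t| <= M) ->
  forall i : 'I_n,
  exists (x : n.-tuple R -> R) (P Tc : set (set R)),
    [/\ optimal a b f i x,
        monotone_threshold a b i x P,
        Tc `<=` P /\ countable Tc,
        (forall S, P S -> ~ Tc S ->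
           forall s, insupp a b s -> S (tnth s i) -> x s = (lr_all_ge1 s)%:R) &
        (forall S T, Tc S -> Tc T -> adjacent_cells S T ->
           deterministic_on a b i x S \/ deterministic_on a b i x T)].
Proof.
move=> n2 a0 ab b1 f_gt0 f_out f_int fp_int cf _ _ _ i.
have f_ge0 t : 0 <= f t.
  by have [/f_gt0/ltW//|/f_out ->] := pselect (Icc a b t).
have mI : measurable (Icc a b : set R) by exact: measurable_itv.
have measurable_f : measurable_fun setT f.
  have -> : f = f \_ (Icc a b).
    apply/funext => t; rewrite /patch; case: ifPn => //.
    by rewrite notin_setE => /f_out.
  apply/(measurable_restrictT _ mI).
  exact: subspace_continuous_measurable_fun.
have f_integrable : (@lebesgue_measure R).-integrable `[a, b] (EFin \o f).
  apply/integrableP; split; first by apply/measurable_EFinP; exact: measurable_funTS.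
  apply: (@le_lt_trans _ _ 1%E); last exact: ltry.
  rewrite -f_int le_eqVlt; apply/orP; left; apply/eqP.
  by apply: eq_integral => t _ /=; rewrite ger0_norm.
(* [dminus f] and [dplus f] add up to 2 f, of total mass 2, and [dplus f] has mass 1. *)
have fm_int : (\int[@lebesgue_measure R]_(t in `[a, b]) (dminus f t)%:E = 1)%E.
  have Rd : (\int[@lebesgue_measure R]_(t in `[a, b]) (dminus f t)%:E +
      \int[@lebesgue_measure R]_(t in `[a, b]) (dplus f t)%:E = 2%:E)%E.
    rewrite -ge0_integralD//.
    - transitivity (\int[@lebesgue_measure R]_(t in `[a, b]) (2%:E * (f t)%:E))%E.
        by apply: eq_integral => t _; rewrite -EFinD -EFinM /dminus /dplus; congr (_%:E); ring.
      rewrite ge0_integralZl_EFin// ?f_int ?mule1//.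
        by move=> t _; rewrite lee_fin.
      by apply/measurable_EFinP; exact: measurable_funTS.
    - by move=> t _; rewrite lee_fin; exact: (dminus_ge0 R a b f b1 f_ge0 f_out).
    - by apply/measurable_EFinP/measurable_funTS; exact: measurable_dminus.
    - by move=> t _; rewrite lee_fin; exact: (dplus_ge0 R a b f a0 f_ge0 f_out).
    - by apply/measurable_EFinP/measurable_funTS; exact: measurable_dplus.
  rewrite fp_int in Rd.
  have := congr1 (fun z => z - 1%:E)%E Rd.
  by rewrite addeK// => ->; rewrite -EFinB; congr (_%:E); ring.
have [u eu umax] := exists_optimal_utility R n a b i f a0 b1 f_ge0 measurable_f
  f_out f_integrable fp_int fm_int.
have [kt ktP] := choice (exists_good_threshold R n a b i f n2 a0 b1 f_ge0 measurable_f
  f_out fp_int fm_int).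
exists (mech R n a b i f u kt), (pieces R n a b i f u), (gap_pieces R n a b i f u).
split.
- exact: mech_optimal.
- exact: mech_monotone_threshold.
- by split; [exact: gap_pieces_sub|exact: countable_gap_pieces].
- exact: mech_off_gap.
- exact: adjacent_deterministic.
Qed.
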